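(* For every $n\ge1$ and $w\in S_n$: (i) $G^{(\alpha,\beta)}_w$ is a finite $\mathbb{Z}[\alpha,\beta]$-linear combination of the functions $G^{(\alpha,\beta)}_\lambda$, $\lambda$ a partition; (ii) $\omega(G^{(\alpha,\beta)}_w)=G^{(\beta,\alpha)}_{w^{-1}}=G^{(\beta,\alpha)}_{w_0ww_0}$, where $w_0=n(n-1)\cdots21\in S_n$ is the longest permutation.
   Context: Let $\alpha,\beta$ be indeterminates, $\gamma=\alpha+\beta$, $\hat\Lambda$ the ring of symmetric formal power series in $x_1,x_2,\ldots$ over $\mathbb{Z}[\alpha,\beta]$, and $\omega$ the involutive automorphism of $\hat\Lambda$ with $\omega(s_\lambda)=s_{\lambda'}$. For a partition $\lambda$ and $m\ge1$, $G^{(a,b)}_\lambda(x_1,\ldots,x_m)=\det\Big[\frac{x_i^{\lambda_j+m-j}(1+bx_i)^{j-1}}{(1-ax_i)^{\lambda_j}}\Big]_{1\le i,j\le m}\Big/\prod_{i<j}(x_i-x_j)$, stable under $x_{m+1}=0$, defining $G^{(a,b)}_\lambda\in\hat\Lambda$. Grothendieck polynomials: $S_N$ acts on polynomials by permuting variables; $s_i=(i,i+1)$; define $\tilde\pi_if=\dfrac{(1+\gamma x_{i+1})f-s_i\big((1+\gamma x_{i+1})f\big)}{x_i-x_{i+1}}$; for $v\in S_N$ with reduced word $v=s_{i_1}\cdots s_{i_l}$ put $\tilde\pi_v=\tilde\pi_{i_1}\cdots\tilde\pi_{i_l}$ (independent of the reduced word). With $w_0^{(N)}$ the longest element of $S_N$,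 set $\mathfrak G^{(\gamma)}_{w_0^{(N)}}=x_1^{N-1}x_2^{N-2}\cdots x_{N-1}$ and $\mathfrak G^{(\gamma)}_v=\tilde\pi_{v^{-1}w_0^{(N)}}\mathfrak G^{(\gamma)}_{w_0^{(N)}}$. For $w\in S_n$ and $m\ge0$, $1^m\times w\in S_{n+m}$ fixes $1,\ldots,m$ and sends $i>m$ to $w(i-m)+m$; the polynomials $\mathfrak G^{(\gamma)}_{1^m\times w}$ stabilize as $m\to\infty$ to a symmetric power series $G^{(\gamma)}_w$. Define $G^{(\alpha,\beta)}_w(x_1,x_2,\ldots)=G^{(\alpha+\beta)}_w\big(\frac{x_1}{1-\alpha x_1},\frac{x_2}{1-\alpha x_2},\ldots\big)$ (and $G^{(\beta,\alpha)}_w$ with $\alpha,\beta$ interchanged, i.e. substituting $x_i/(1-\beta x_i)$). *)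

(* Defs.v *)
From HB Require Import structures.
From mathcomp Require Import all_boot all_fingroup all_algebra.
From mathcomp Require Import finmap multiset.
From mathcomp Require Import boolp classical_sets functions cardinality fsbigop.

Set Implicit Arguments.
Unset Strict Implicit.
Unset Printing Implicit Defensive.

Import GRing.Theory.

Local Open Scope ring_scope.

(* Monomials in countably many variables x_0, x_1, x_2, ... (numbered from 0, *)
(* so that index i here is index i + 1 in the usual notation), each given by  *)
(* the multiset of the indices of its factors: mu stands for                  *)
(* \prod_i x_i ^ (mu i), mset0 for 1 and mu `+` nu for the product.           *)
Notation monomial := ({mset nat})%mset.

Record pseries (R : Type) := PSeries { pcoef :> monomial -> R }.

HB.instance Definition _ (R : Type) := gen_eqMixin (pseries R).
HB.instance Definition _ (R : Type) := gen_choiceMixin (pseries R).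

Lemma pseriesP (R : Type) (f g : pseries R) : (f : _ -> _) =1 g <-> f = g.
Proof.
split=> [|->//]; case: f g => [f] [g] /= fg; congr PSeries; exact/funext.
Qed.

Lemma finite_msubset (mu : monomial) :
  finite_set [set nu : monomial | (nu `<=` mu)%mset]%classic.
Proof.
pose F (s : {ffun finsupp mu -> 'I_(size mu).+1}) : monomial :=
  [fsfun x : finsupp mu => nat_of_ord (s x)].
apply: (@sub_finite_set _ _ (range F)); last exact: finite_image.
move=> nu /= /msubsetP le_nu.
exists [ffun x : finsupp mu => inord (nu (val x))] => //.
apply/msetP => x; rewrite /F fsfun_ffun.
case: insubP => [u xmu ux|] /=.
  rewrite ffunE inordK ux //.
  rewrite ltnS (leq_trans (le_nu x)) // -count_mem_mset.
  exact: count_size.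
rewrite memNfinsupp => /eqP mux.
by have := le_nu x; rewrite mux leqn0 => /eqP ->.
Qed.

Section PSeriesRing.
Variable R : comNzRingType.
Implicit Types f g h : pseries R.

Definition ps_zero : pseries R := PSeries (fun=> 0).
Definition ps_opp f : pseries R := PSeries (fun mu => - f mu).
Definition ps_add f g : pseries R := PSeries (fun mu => f mu + g mu).

Fact ps_addA : associative ps_add.
Proof. by move=> f g h; apply/pseriesP => mu /=; rewrite addrA. Qed.
Fact ps_addC : commutative ps_add.
Proof. by move=> f g; apply/pseriesP => mu /=; rewrite addrC. Qed.
Fact ps_add0 : left_id ps_zero ps_add.
Proof. by move=> f; apply/pseriesP => mu /=; rewrite add0r. Qed.
Fact ps_addN : left_inverse ps_zero ps_opp ps_add.
Proof. by move=> f; apply/pseriesP => mu /=; rewrite addNr. Qed.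

HB.instance Definition _ :=
  GRing.isZmodule.Build (pseries R) ps_addA ps_addC ps_add0 ps_addN.

Definition ps_one : pseries R := PSeries (fun mu => (mu == mset0)%:R).

(* Cauchy product; the index set is finite *)
Definition ps_mul f g : pseries R :=
  PSeries (fun mu =>
    \sum_(p \in [set p : monomial * monomial | (p.1 `+` p.2)%mset = mu]%classic)
      f p.1 * g p.2).

Let subs mu := fset_set [set nu : monomial | (nu `<=` mu)%mset]%classic.

Let in_subs mu nu : (nu \in subs mu) = (nu `<=` mu)%mset.
Proof.
rewrite in_fset_set; last exact: finite_msubset.
by apply/idP/idP; rewrite inE.
Qed.

Let ps_mulE (S : {fset monomial}) f g mu :
    (forall nu, (nu `<=` mu)%mset -> nu \in S) ->
  ps_mul f g mu =
  \sum_(a <- S) \sum_(b <- S | (a `+` b)%mset == mu) f a * g b.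
Proof.
move=> sub_S.
pose r := [seq p <- [seq (a, b) | a <- S, b <- S] | (p.1 `+` p.2)%mset == mu].
rewrite /= (fsbigE r).
- rewrite big_filter_cond (eq_bigl (fun p => (p.1 `+` p.2)%mset == mu)).
    rewrite big_mkcond big_allpairs /=; apply: eq_bigr => a _.
    by rewrite [RHS]big_mkcond.
  by move=> p /=; case: eqP => //= pmu; apply/mem_set.
- by rewrite filter_uniq // allpairs_uniq // => -[? ?] [? ?].
- by move=> p /=; rewrite mem_filter => /andP[/eqP].
- move=> [a b] /= abmu; rewrite mem_filter abmu eqxx /= => /negP[].
  apply: allpairs_f; apply: sub_S; rewrite -abmu.
    by apply/msubsetP => x; rewrite msetE2 leq_addr.
  by apply/msubsetP => x; rewrite msetE2 leq_addl.
Qed.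

Let sum_pred1 (S : {fset monomial}) c (F : monomial -> R) :
  c \in S -> \sum_(d <- S | d == c) F d = F c.
Proof.
move=> cS; rewrite big_mkcond (bigD1_seq c) ?fset_uniq //= eqxx.
by rewrite big1 ?addr0 // => d /negPf ->.
Qed.

Fact ps_mulC : commutative ps_mul.
Proof.
move=> f g; apply/pseriesP => mu; rewrite !(@ps_mulE (subs mu)); first last.
- by move=> nu; rewrite in_subs.
- by move=> nu; rewrite in_subs.
rewrite (exchange_big_dep predT) //=; apply: eq_bigr => a _.
by apply: eq_big => b; rewrite 1?msetDC // mulrC.
Qed.

Fact ps_mulA : associative ps_mul.
Proof.
move=> f g h; apply/pseriesP => mu; pose S := subs mu.
have subS d : d \in S -> forall nu, (nu `<=` d)%mset -> nu \in S.
  by rewrite in_subs => dmu nu nud; rewrite in_subs (msubset_trans nud).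
have memS a b : (a `+` b)%mset = mu -> (a \in S) /\ (b \in S).
  move=> abmu; rewrite !in_subs -abmu; split; apply/msubsetP => x.
    by rewrite msetE2 leq_addr.
  by rewrite msetE2 leq_addl.
have muS : forall nu, (nu `<=` mu)%mset -> nu \in S.
  by move=> nu; rewrite in_subs.
pose T f1 g1 h1 := \sum_(a <- S) \sum_(b <- S)
  \sum_(c <- S | (a `+` (b `+` c))%mset == mu) f1 a * (g1 b * h1 c) : R.
have eq1 f1 g1 h1 : ps_mul f1 (ps_mul g1 h1) mu = T f1 g1 h1.
  rewrite (ps_mulE _ _ muS); apply: eq_bigr => a _.
  transitivity (\sum_(d <- S | (a `+` d)%mset == mu) \sum_(b <- S)
      \sum_(c <- S | (b `+` c)%mset == d) f1 a * (g1 b * h1 c)).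
    rewrite big_seq_cond [RHS]big_seq_cond; apply: eq_bigr => d /andP[dS _].
    rewrite (ps_mulE _ _ (subS _ dS)) big_distrr; apply: eq_bigr => b _.
    by rewrite big_distrr.
  rewrite exchange_big; apply: eq_bigr => b _.
  rewrite (exchange_big_dep predT) //= [RHS]big_mkcond; apply: eq_bigr => c _.
  case: eqP => [abc|Nabc].
    have [_ bcS] := memS _ _ abc.
    rewrite (eq_bigl (fun d => d == (b `+` c)%mset)) ?sum_pred1 //.
    move=> d /=; rewrite [RHS]eq_sym andbC; case: eqP => //= <-.
    by rewrite abc eqxx.
  rewrite big1 // => d /andP[/eqP ad /eqP bcd].
  by case: Nabc; rewrite bcd.
have -> : ps_mul (ps_mul f g) h = ps_mul h (ps_mul f g) by exact: ps_mulC.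
rewrite !eq1 /T.
rewrite [RHS]exchange_big; apply: eq_bigr => a _ /=.
rewrite [RHS](exchange_big_dep predT) //=; apply: eq_bigr => b _.
rewrite [LHS]big_mkcond [RHS]big_mkcond; apply: eq_bigr => c _ /=.
by rewrite [in RHS]msetDC -msetDA mulrA (mulrC (h c)).
Qed.

Fact ps_mul1 : left_id ps_one ps_mul.
Proof.
move=> f; apply/pseriesP => mu; rewrite (@ps_mulE (subs mu)); last first.
  by move=> nu; rewrite in_subs.
rewrite (bigD1_seq mset0) ?in_subs ?msub0set ?fset_uniq //=.
rewrite [X in _ + X]big1 ?addr0 => [|a /negPf a0]; last first.
  by apply: big1 => b _; rewrite a0 mul0r.
rewrite (eq_bigl (fun b => b == mu)) => [|b /=]; last by rewrite mset0D.
by rewrite sum_pred1 ?in_subs ?msubset_refl // eqxx mul1r.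
Qed.

Fact ps_mulDl : left_distributive ps_mul ps_add.
Proof.
move=> f g h; apply/pseriesP => mu.
rewrite -[RHS]/(ps_mul f h mu + ps_mul g h mu) !(@ps_mulE (subs mu)); first last.
- by move=> nu; rewrite in_subs.
- by move=> nu; rewrite in_subs.
- by move=> nu; rewrite in_subs.
rewrite -big_split /=; apply: eq_bigr => a _; rewrite -big_split /=.
by apply: eq_bigr => b _; rewrite mulrDl.
Qed.

Fact ps_oner_neq0 : ps_one != 0.
Proof.
apply/eqP => /pseriesP /(_ mset0) /= /eqP.
by rewrite eqxx oner_eq0.
Qed.

HB.instance Definition _ := GRing.Zmodule_isComNzRing.Build (pseries R)
  ps_mulA ps_mulC ps_mul1 ps_mulDl ps_oner_neq0.

Definition ps_scale (c : R) f : pseries R := PSeries (fun mu => c * f mu).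

Fact ps_scaleA c d f : ps_scale c (ps_scale d f) = ps_scale (c * d) f.
Proof. by apply/pseriesP => mu /=; rewrite mulrA. Qed.
Fact ps_scale1 : left_id 1 ps_scale.
Proof. by move=> f; apply/pseriesP => mu /=; rewrite mul1r. Qed.
Fact ps_scaleDr : right_distributive ps_scale +%R.
Proof. by move=> c f g; apply/pseriesP => mu /=; rewrite mulrDr. Qed.
Fact ps_scaleDl f : {morph ps_scale^~ f : c d / c + d}.
Proof. by move=> c d; apply/pseriesP => mu /=; rewrite mulrDl. Qed.

HB.instance Definition _ := GRing.Zmodule_isLmodule.Build R (pseries R)
  ps_scaleA ps_scale1 ps_scaleDr ps_scaleDl.

End PSeriesRing.

Definition ps_var (R : comNzRingType) (i : nat) : pseries R :=
  PSeries (fun mu => (mu == [mset i]%mset)%:R).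

Section PSeriesOps.
Variable R : comNzRingType.
Implicit Types f g : pseries R.

(* The quotient f / g: the series q such that q * g = f (0 if there is none). *)
(* It is only used for g a non-zero-divisor, so that q is unique.             *)
Definition ps_quo f g : pseries R := xget 0 [set q | q * g = f]%classic.

(* The coefficientwise limit: the coefficient of mu is the eventually constant*)
(* value of the coefficients of mu in u 0, u 1, ... (0 if there is none).     *)
Definition ps_lim (u : nat -> pseries R) : pseries R :=
  PSeries (fun mu =>
    xget 0 [set c | exists M : nat, forall m : nat, (M <= m)%N -> u m mu = c]%classic).

(* The substitution x_i := v i in f, i.e. \sum_mu f mu * \prod_i v i ^+ mu i. *)
(* When each v i is divisible by x_i, only the finitely many mu dividing nu   *)
(* contribute to the coefficient of nu.                                       *)
Definition ps_subst (v : nat -> pseries R) f : pseries R :=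
  PSeries (fun nu =>
    \sum_(mu \in [set: monomial]%classic) f mu * (\prod_(i <- enum_mset mu) v i) nu).

End PSeriesOps.

(* the transposition s_i of i and i + 1 *)
Definition swap (i j : nat) : nat :=
  if j == i then i.+1 else if j == i.+1 then i else j.

Definition ps_swap (R : comNzRingType) (i : nat) (f : pseries R) : pseries R :=
  PSeries (fun mu => f (seq_mset [seq swap i j | j <- enum_mset mu])).

(* A partition is the nonincreasing sequence of its (nonzero) parts.          *)
Definition is_part (la : seq nat) : bool := sorted geq la && (0%N \notin la).

Definition conj_part (la : seq nat) : seq nat :=
  mkseq (fun i => count (fun p => i < p)%N la) (head 0%N la).

Section SymmetricSeries.
Variable R : comNzRingType.
Local Notation "''x_' i" := (ps_var R i) (at level 8, i at level 2).

Definition vandermonde (m : nat) : pseries R :=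
  \prod_(i < m) \prod_(j < m | (i < j)%N) ('x_i - 'x_j).

Definition schur (la : seq nat) : pseries R :=
  ps_lim (fun m => ps_quo
    (\det (\matrix_(i < m, j < m) 'x_i ^+ (nth 0%N la j + (m - j.+1))))
    (vandermonde m)).

Definition schur_sum (c : seq nat -> R) : pseries R :=
  PSeries (fun mu =>
    \sum_(la \in [set la | is_part la]%classic) c la * schur la mu).

Definition schur_coef (f : pseries R) : seq nat -> R :=
  xget (fun=> 0) [set c | schur_sum c = f]%classic.

(* Every symmetric f has a unique expansion \sum_la c_la s_la, usually with   *)
(* infinitely many terms, and omega f = \sum_la c_la s_(la') then. The value  *)
(* of omega at a series that is not symmetric is irrelevant.                  *)
Definition omega (f : pseries R) : pseries R :=
  schur_sum (fun la => schur_coef f (conj_part la)).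

Variables a b : R.

Definition Gpart_fin (m : nat) (la : seq nat) : pseries R :=
  ps_quo
    (\det (\matrix_(i < m, j < m)
       ps_quo ('x_i ^+ (nth 0%N la j + (m - j.+1)) * (1 + b *: 'x_i) ^+ j)
              ((1 - a *: 'x_i) ^+ nth 0%N la j)))
    (vandermonde m).

Definition Gpart (la : seq nat) : pseries R :=
  ps_lim (fun m => Gpart_fin m la).

End SymmetricSeries.

(* Permutations of {1, ..., n} are represented by 'S_n, on {0, ..., n - 1}.   *)
(* MathComp composes permutations from left to right: the product v w of the  *)
(* usual convention, (v w) i = v (w i), is (w * v)%g in 'S_n.                 *)
Section Grothendieck.
Variables (R : comNzRingType) (gamma : R).
Local Notation "''x_' i" := (ps_var R i) (at level 8, i at level 2).

Definition longest (n : nat) : 'S_n := perm (@rev_ord_inj n).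

(* v = s_(i_1) o ... o s_(i_l), where s = [:: i_1; ...; i_l] *)
Definition is_word (N : nat) (v : 'S_N) (s : seq nat) : Prop :=
  all (fun i => i.+1 < N)%N s /\ forall x : 'I_N, foldr swap x s = v x.

Definition is_reduced_word (N : nat) (v : 'S_N) (s : seq nat) : Prop :=
  is_word v s /\ forall t, is_word v t -> (size s <= size t)%N.

Definition reduced_word (N : nat) (v : 'S_N) : seq nat :=
  xget [::] [set s | is_reduced_word v s]%classic.

Definition isobaric (i : nat) (f : pseries R) : pseries R :=
  let h := (1 + gamma *: 'x_(i.+1)) * f in
  ps_quo (h - ps_swap i h) ('x_i - 'x_(i.+1)).

Definition isobaric_perm (N : nat) (v : 'S_N) (f : pseries R) : pseries R :=
  foldr isobaric f (reduced_word v).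

Definition grothendieck (N : nat) (v : 'S_N) : pseries R :=
  isobaric_perm (longest N * v^-1)%g (\prod_(i < N) 'x_i ^+ (N - i.+1)).

Definition shift_fun (m n : nat) (w : 'S_n) (i : 'I_(m + n)) : 'I_(m + n) :=
  match fintype.split i with
  | inl j => lshift n j
  | inr k => rshift m (w k)
  end.

Fact shift_fun_inj (m n : nat) (w : 'S_n) : injective (@shift_fun m n w).
Proof.
apply: (can_inj (g := @shift_fun m n w^-1%g)) => i; rewrite /shift_fun.
case: (splitP i) => j ij.
  by rewrite -[lshift n j]/(unsplit (inl j)) unsplitK; apply: val_inj.
rewrite -[rshift m (w j)]/(unsplit (inr (w j))) unsplitK permK.
exact: val_inj.
Qed.

(* 1^m x w *)
Definition shift_perm (m n : nat) (w : 'S_n) : 'S_(m + n) :=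
  perm (@shift_fun_inj m n w).

Definition stable_grothendieck (n : nat) (w : 'S_n) : pseries R :=
  ps_lim (fun m => grothendieck (shift_perm m w)).

End Grothendieck.

Definition Gperm (R : comNzRingType) (a b : R) (n : nat) (w : 'S_n) : pseries R :=
  ps_subst (fun i => ps_quo (ps_var R i) (1 - a *: ps_var R i))
           (stable_grothendieck (a + b) w).

(* Z[alpha, beta] *)
Notation Zab := {poly {poly int}}.
Definition alpha : Zab := ('X)%:P.
Definition beta : Zab := 'X.

(* Main.v *)
(* Let the operators u_j (u_j^2 = gamma u_j, braid and commutation relations)  *)
(* act on families of coefficients indexed by permutations. By Fomin and       *)
(* Kirillov, the stable Grothendieck series of w in S_n is the coefficient at  *)
(* w of \prod_i A(x_i), where A(x) = \prod_(j < n - 1) (1 + x u_j) =           *)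
(* \sum_k h_k x^k and the h_k commute. Let y_i = x_i / (1 - a x_i) and         *)
(* gamma = a + b.                                                              *)
(*                                                                             *)
(* (i) A(y) B(y) = (1 + gamma y)^d for d = n - 1 and a polynomial B of degree  *)
(* <= d with B(0) = 1. Unitriangular column operations turn the Vandermonde    *)
(* determinant times \prod_i A(y_i) into a determinant whose columns j >= d    *)
(* are those of every G_la, and whose first d columns are polynomials that do  *)
(* not depend on the number of variables. Straightening these d columns gives  *)
(* finitely many G_la.                                                         *)
(*                                                                             *)
(* (ii) Expand A(y_i) = \sum_k H_k x_i^k. The coefficient of s_la is then the  *)
(* Jacobi-Trudi determinant of H for la. The reversed product                  *)
(* \prod_j (1 + y' u_j), y'_i = x_i / (1 - b x_i), has coefficients E_k with   *)
(* (\sum_k H_k x^k) (\sum_k (-1)^k E_k x^k) = 1, because the factors cancel in *)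
(* pairs, so that the dual Jacobi-Trudi identity computes omega by replacing H *)
(* with E. Reversing the product amounts to inverting w, as the T_w with left  *)
(* and right multiplications show, or to conjugating w by w_0.                 *)
Require Import Defs.
From HB Require Import structures.
From mathcomp Require Import all_boot all_order all_fingroup all_algebra.
From mathcomp Require Import finmap multiset.
From mathcomp Require Import boolp classical_sets functions cardinality fsbigop.
From mathcomp Require Import zify ring.

Set Implicit Arguments.
Unset Strict Implicit.
Unset Printing Implicit Defensive.

Import GRing.Theory.
Local Open Scope ring_scope.

(** * Formal power series *)

(** The plan sketched above is carried out in one commutative ring of operators, [bicom g d], with g
    = a + b and d = n - 1. It contains the coefficients [hC g d k] of A(x), which commute by the
    Yang-Baxter equation ([AopC], [hopC]), and the coefficients [hbC g d k] of the reversed product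
    ([hbC_in]). By [grothendieckE] and [stable_grothendieckE], [trunc_Gperm] writes [Gperm] in m
    variables as the entry at w of the product of the A(y_i). Since [entry] is linear over scalars,
    identities proved over the ring can be read off at w ([map_ps_linear]).

    Both halves rest on [AserAbar]. If y - z = g y z, then u_j^2 = g u_j gives (1 - z u_j)(1 + y
    u_j) = 1, so A(y) times the reversed product at -z is 1. This applies to y = x/(1 - a x) and z =
    x/(1 + b x) = y/(1 + g y).

    For (i), multiplying by (1 + g y)^d clears the denominators of z and gives a polynomial B with
    A(y) B(y) = (1 + g y)^d. Then [det_columns] and [expandable_all] yield an expansion whose
    coefficients are the same for all m.

    For (ii), -z is x/(1 - b x) evaluated at -x, so the relation reads H(x) E(-x) = 1.
    [schur_expansion] gives Jacobi-Trudi determinants as Schur coefficients, and [dual_jacobi_trudi]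
    turns those of H into those of E for the conjugate partition, which is what omega does. The
    reversed product arises from T_v -> T_(v^-1), an anti-automorphism ([hprod_rev]), and also from
    conjugation by w_0, which sends u_j to u_(n-2-j) ([hprod_conj]). *)

Definition msubs (mu : monomial) : {fset monomial} :=
  fset_set [set nu : monomial | (nu `<=` mu)%mset]%classic.

Lemma in_msubs mu nu : (nu \in msubs mu) = (nu `<=` mu)%mset.
Proof.
rewrite in_fset_set; last exact: finite_msubset.
by apply/idP/idP; rewrite inE.
Qed.

(* Sealed, lest unification compare distinct variables by unfolding the       *)
(* multisets [mset i] and [mset j].                                           *)
Fact var_key : unit. Proof. exact tt. Qed.
Definition var (R : comNzRingType) : nat -> pseries R := locked_with var_key (ps_var R).
Lemma varE (R : comNzRingType) : ps_var R = var R.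
Proof. by rewrite /var unlock. Qed.

Section Coefficients.
Variable R : comNzRingType.
Implicit Types f g h : pseries R.
Local Notation "''x_' i" := (var R i) (at level 8, i at level 2).

Lemma ps_coefD f g mu : (f + g) mu = f mu + g mu. Proof. by []. Qed.
Lemma ps_coefB f g mu : (f - g) mu = f mu - g mu. Proof. by []. Qed.
Lemma ps_coef1 mu : (1 : pseries R) mu = (mu == mset0)%:R. Proof. by []. Qed.
Lemma ps_coefZ c f mu : (c *: f) mu = c * f mu. Proof. by []. Qed.

Lemma ps_coef_sum I (r : seq I) (P : pred I) (F : I -> pseries R) mu :
  (\sum_(i <- r | P i) F i) mu = \sum_(i <- r | P i) F i mu.
Proof. by elim/big_rec2: _ => //= i a b _ <-. Qed.

Lemma ps_coefM f g mu :
  (f * g) mu = \sum_(nu <- msubs mu) f nu * g (mu `\` nu)%mset.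
Proof.
pose r := [seq (nu, (mu `\` nu)%mset) | nu <- msubs mu].
rewrite -[LHS]/(ps_mul f g mu) /= (fsbigE r).
- rewrite big_map /= big_seq_cond [RHS]big_seq.
  apply: eq_bigl => nu /=; rewrite in_msubs andbC.
  case: (boolP (nu `<=` mu)%mset) => [le_nu|]; last by rewrite andbF.
  by rewrite andbT; apply/mem_set => /=; rewrite msetBDKC.
- by rewrite map_inj_uniq ?fset_uniq // => a b [].
- move=> p /mapP[nu]; rewrite in_msubs => le_nu ->.
  by rewrite /= msetBDKC.
- move=> [a b] /= abmu /negP[]; apply/mapP; exists a.
    rewrite in_msubs -abmu; apply/msubsetP => x; rewrite msetE2; exact: leq_addr.
  congr (_, _); apply/msetP => x; rewrite -abmu !msetE2 addKn //.
Qed.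

Lemma ps_coefXM i f mu :
  ('x_i * f) mu = if i \in mu then f (mu `\ i)%mset else 0.
Proof.
rewrite -varE ps_coefM; case: ifP => imu.
  rewrite (bigD1_seq [mset i]%mset) ?in_msubs ?msub1set ?fset_uniq //= eqxx mul1r.
  by rewrite big1 ?addr0 // => nu /negPf ->; rewrite mul0r.
rewrite big_seq big1 // => nu; rewrite in_msubs /= => le_nu.
case: eqP => [nui|]; last by rewrite mul0r.
by move: le_nu; rewrite nui msub1set imu.
Qed.

Lemma ps_coefXMD i f mu : ('x_i * f) (i +` mu)%mset = f mu.
Proof. by rewrite ps_coefXM mset1D1 msetD1K. Qed.

Lemma ps_scaleAl c f g : c *: (f * g) = (c *: f) * g.
Proof.
apply/pseriesP => mu; rewrite ps_coefZ !ps_coefM mulr_sumr.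
by apply: eq_bigr => nu _; rewrite ps_coefZ mulrA.
Qed.

Lemma ps_scaleAr c f g : c *: (f * g) = f * (c *: g).
Proof. by rewrite mulrC ps_scaleAl mulrC. Qed.

End Coefficients.

HB.instance Definition _ (R : comNzRingType) :=
  GRing.Lmodule_isLalgebra.Build R (pseries R) (@ps_scaleAl R).
HB.instance Definition _ (R : comNzRingType) :=
  GRing.Lalgebra_isAlgebra.Build R (pseries R) (@ps_scaleAr R).
HB.instance Definition _ (R : comNzRingType) :=
  GRing.Lalgebra.on (pseries R).

Definition regular_series (R : comNzRingType) (f : pseries R) :=
  forall g, f * g = 0 -> g = 0.

Section Regular.
Variable R : comNzRingType.
Implicit Types f g h : pseries R.
Local Notation "''x_' i" := (var R i) (at level 8, i at level 2).

Lemma regular_inj f g h : regular_series f -> f * g = f * h -> g = h.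
Proof.
move=> rf fgh; apply/eqP; rewrite -subr_eq0; apply/eqP/rf.
by rewrite mulrBr fgh subrr.
Qed.

Lemma regularM f g : regular_series f -> regular_series g -> regular_series (f * g).
Proof. by move=> rf rg h; rewrite -mulrA => /rf/rg. Qed.

Lemma regular1 : regular_series (1 : pseries R).
Proof. by move=> f; rewrite mul1r. Qed.

Lemma regular_prod I (r : seq I) (P : pred I) (F : I -> pseries R) :
  (forall i, P i -> regular_series (F i)) ->
  regular_series (\prod_(i <- r | P i) F i).
Proof. by move=> rF; elim/big_ind: _ => //; [exact: regular1|exact: regularM]. Qed.

Lemma ps_quoP f g q : regular_series g -> q * g = f -> ps_quo f g = q.
Proof.
move=> rg qgf; rewrite /ps_quo; case: xgetP => [r _ /= rgf|/(_ q) /=]; last by rewrite qgf.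
by apply: (regular_inj rg); rewrite mulrC rgf -qgf mulrC.
Qed.

Lemma regular_var i : regular_series 'x_i.
Proof.
move=> g /pseriesP xg; apply/pseriesP => mu.
by rewrite -(ps_coefXMD i) xg.
Qed.

(** If x_i - x_j kills g, a coefficient of g does not change when a factor x_j of its monomial is
    traded for x_i. Once no x_j is left, the next trade gives 0. *)
Lemma regular_varB i j : i != j -> regular_series ('x_i - 'x_j).
Proof.
move=> neq_ij g /pseriesP xg; apply/pseriesP => mu.
have step nu : g nu = ('x_j * g) (i +` nu)%mset.
  rewrite -(ps_coefXMD i); apply/eqP; rewrite -subr_eq0 -ps_coefB -mulrBl.
  exact/eqP/xg.
elim: {mu}(mu j) {-2}mu (erefl (mu j)) => [|k IH] mu muj.
  rewrite step ps_coefXM in_mset1D eq_sym (negPf neq_ij) /=.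
  by rewrite in_mset muj.
rewrite step ps_coefXM; case: ifP => // _; apply: IH.
by rewrite msetE2 mset1DE msetnxx (eq_sym j) (negPf neq_ij) muj subn1.
Qed.

Lemma vandermonde_var m :
  vandermonde R m = \prod_(i < m) \prod_(j < m | (i < j)%N) ('x_i - 'x_j).
Proof. by rewrite /vandermonde varE. Qed.

Lemma regular_vandermonde m : regular_series (vandermonde R m).
Proof.
rewrite vandermonde_var.
apply: regular_prod => i _; apply: regular_prod => j ij.
by apply: regular_varB; rewrite neq_ltn ij.
Qed.

(** The series 1 / (1 - a x_i). *)
Definition geom_def (a : R) (i : nat) : pseries R :=
  PSeries (fun mu => if mu == msetn (mu i) i then a ^+ mu i else 0).

Fact geom_key : unit. Proof. exact tt. Qed.
Definition geom : R -> nat -> pseries R := locked_with geom_key geom_def.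

Lemma geomK a i : geom a i * (1 - a *: 'x_i) = 1.
Proof.
apply/pseriesP => mu; rewrite mulrC mulrBl mul1r -scalerAl ps_coefB ps_coefZ ps_coefXM.
rewrite ps_coef1 /geom unlock /=.
case: (boolP (i \in mu)) => imu.
  have mui : (0 < mu i)%N by rewrite mset_gt0.
  have -> : (mu == mset0) = false.
    by apply/negP => /eqP mu0; move: imu; rewrite mu0 in_mset0.
  rewrite msetE2 msetnxx.
  have -> : ((mu `\ i)%mset == msetn (mu i - 1)%N i) = (mu == msetn (mu i) i).
    apply/eqP/eqP => [e|{1}->]; apply/msetP => x; last first.
      by rewrite msetE2 !msetnE; case: eqP.
    move/msetP/(_ x): e; rewrite msetE2 !msetnE; case: eqP => [->|_] //.
    by rewrite subn0.
  case: ifP => _; last by rewrite mulr0 subr0.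
  by rewrite -exprS subn1 prednK // subrr.
have -> : mu i = 0%N by apply/mset_eq0P.
by rewrite msetn0 mulr0 subr0 expr0; case: eqP.
Qed.

Lemma regular_1BX a i : regular_series (1 - a *: 'x_i).
Proof.
move=> g xg; rewrite -[g]mul1r -(geomK a i) -mulrA xg mulr0 //.
Qed.

Lemma regular_geom a i : regular_series (geom a i).
Proof. by move=> g xg; rewrite -[g]mul1r -(geomK a i) mulrAC xg mul0r. Qed.

Lemma ps_quo_geom a i k f : ps_quo f ((1 - a *: 'x_i) ^+ k) = f * geom a i ^+ k.
Proof.
apply: ps_quoP; last by rewrite -mulrA -exprMn geomK expr1n mulr1.
elim: k => [|k IH]; first exact: regular1.
by rewrite exprS; apply: regularM => //; exact: regular_1BX.
Qed.

End Regular.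

(* Setting x_i := 0 for all i >= m. *)
Definition below (m : nat) (mu : monomial) : bool := all (fun i => i < m)%N mu.

Lemma belowP m (mu : monomial) : reflect (forall i, i \in mu -> (i < m)%N) (below m mu).
Proof. exact: allP. Qed.

Lemma below_leP m (mu : monomial) : reflect (forall i, (m <= i)%N -> mu i = 0%N) (below m mu).
Proof.
apply: (iffP (belowP _ _)) => H i.
  move=> mi; apply/mset_eq0P/negP => /H; by rewrite ltnNge mi.
by rewrite ltnNge => imu; apply/negP => /H /mset_eq0P; rewrite imu.
Qed.

Lemma belowD m mu nu : below m (mu `+` nu)%mset = below m mu && below m nu.
Proof.
apply/belowP/andP => [H|[/belowP H1 /belowP H2] i].
  by split; apply/belowP => i imu; apply: H; rewrite in_msetD imu ?orbT.
by rewrite in_msetD => /orP[/H1|/H2].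
Qed.

Lemma below_sub m (mu nu : monomial) : (nu `<=` mu)%mset -> below m mu -> below m nu.
Proof.
move=> /msubset_subset sub /belowP H; apply/belowP => i /sub; exact: H.
Qed.

Lemma below_le m m' mu : (m <= m')%N -> below m mu -> below m' mu.
Proof. by move=> mm' /belowP H; apply/belowP => i /H /leq_trans; apply. Qed.

Lemma below_exists (mu : monomial) : exists m, below m mu.
Proof.
exists (\max_(i <- mu) i).+1; apply/belowP => i imu.
by rewrite ltnS; exact: leq_bigmax_seq.
Qed.

Section Trunc.
Variable R : comNzRingType.
Implicit Types f g h : pseries R.
Local Notation "''x_' i" := (var R i) (at level 8, i at level 2).

Definition trunc m f : pseries R := PSeries (fun mu => if below m mu then f mu else 0).

Fact trunc_is_zmod m : zmod_morphism (trunc m).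
Proof. by move=> f g; apply/pseriesP => mu /=; case: ifP; rewrite ?subrr. Qed.
Fact trunc_is_monoid m : monoid_morphism (trunc m).
Proof.
split=> [|f g]; apply/pseriesP => mu.
  rewrite -[LHS]/(if below m mu then (1 : pseries R) mu else 0) ps_coef1; case: eqP => [->|_]; last by case: ifP.
  by case: belowP => // -[] i; rewrite in_mset0.
rewrite -[LHS]/(if below m mu then (f * g) mu else 0) !ps_coefM; case: ifP => [bmu|/negbT bmu].
  rewrite [LHS]big_seq [RHS]big_seq; apply: eq_bigr => nu; rewrite in_msubs => le_nu /=.
  by rewrite !(below_sub _ bmu) // msubsetDl.
rewrite big_seq big1 // => nu; rewrite in_msubs => le_nu /=.
case: ifP; rewrite ?mul0r // => bnu; case: ifP; rewrite ?mulr0 // => bnu'.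
by move: bmu; rewrite -(msetBDKC le_nu) belowD bnu bnu'.
Qed.
HB.instance Definition _ m := GRing.isZmodMorphism.Build _ _ (trunc m) (trunc_is_zmod m).
HB.instance Definition _ m := GRing.isMonoidMorphism.Build _ _ (trunc m) (trunc_is_monoid m).

Lemma truncD m f g : trunc m (f + g) = trunc m f + trunc m g.
Proof. exact: rmorphD. Qed.
Lemma truncB m f g : trunc m (f - g) = trunc m f - trunc m g.
Proof. exact: rmorphB. Qed.
Lemma truncM m f g : trunc m (f * g) = trunc m f * trunc m g.
Proof. exact: rmorphM. Qed.
Lemma truncX m f k : trunc m (f ^+ k) = trunc m f ^+ k.
Proof. exact: rmorphXn. Qed.
Lemma trunc0 m : trunc m 0 = 0.
Proof. exact: rmorph0. Qed.
Lemma trunc1 m : trunc m 1 = 1.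
Proof. exact: rmorph1. Qed.
Lemma trunc_prod m I (r : seq I) (P : pred I) (F : I -> pseries R) :
  trunc m (\prod_(i <- r | P i) F i) = \prod_(i <- r | P i) trunc m (F i).
Proof. exact: rmorph_prod. Qed.
Lemma trunc_sum m I (r : seq I) (P : pred I) (F : I -> pseries R) :
  trunc m (\sum_(i <- r | P i) F i) = \sum_(i <- r | P i) trunc m (F i).
Proof. exact: rmorph_sum. Qed.

Lemma trunc_det m k (A : 'I_k -> 'I_k -> pseries R) :
  trunc m (\det (\matrix_(i, j) A i j)) = \det (\matrix_(i, j) trunc m (A i j)).
Proof.
transitivity (\det (map_mx (trunc m) (\matrix_(i, j) A i j))).
  by rewrite det_map_mx.
by congr (\det _); apply/matrixP => i j; rewrite !mxE.
Qed.

Lemma truncZ m c f : trunc m (c *: f) = c *: trunc m f.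
Proof. by apply/pseriesP => mu /=; case: ifP; rewrite ?mulr0. Qed.

Lemma trunc_var m i : trunc m 'x_i = if (i < m)%N then 'x_i else 0.
Proof.
rewrite -varE; apply/pseriesP => mu /=; case: eqP => [->|neq]; last by case: ifP; case: ifP => //= _ _; case: eqP.
have -> : below m [mset i]%mset = (i < m)%N.
  apply/belowP/idP => [|im j]; first by apply; rewrite mset11.
  by rewrite in_mset1 => /eqP ->.
by case: ifP => //=; rewrite eqxx.
Qed.

Lemma trunc_trunc m m' f : trunc m (trunc m' f) = trunc (minn m m') f.
Proof.
apply/pseriesP => mu /=.
case: (leqP m m') => mm'.
  by case: ifP => // /(below_le mm') ->.
case: ifP => [_ //|]; case: ifP => // /(below_le (ltnW mm')) -> //.
Qed.

Lemma trunc_geom m a i : (i < m)%N -> trunc m (geom a i) = geom a i.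
Proof.
move=> im; rewrite /geom unlock; apply/pseriesP => mu /=; case: belowP => //.
case: eqP => // -> []; move=> j; rewrite in_msetn => /andP[_ /eqP ->] //.
Qed.

(** A monomial involves finitely many variables, so identities of series can be checked in m
    variables for all large m, where determinants are available. *)
Lemma eq_trunc f g M : (forall m, (M <= m)%N -> trunc m f = trunc m g) -> f = g.
Proof.
move=> fg; apply/pseriesP => mu; have [m bmu] := below_exists mu.
have bmu' : below (maxn m M) mu by rewrite (below_le _ bmu) ?leq_maxl.
by have /pseriesP/(_ mu) /= := fg _ (leq_maxr m M); rewrite bmu'.
Qed.

Lemma ps_limP (u : nat -> pseries R) (M : nat) :
  (forall m, (M <= m)%N -> trunc m (u m.+1) = trunc m (u m)) ->
  forall m, (M <= m)%N -> trunc m (ps_lim u) = trunc m (u m).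
Proof.
move=> H m Mm; apply/pseriesP => mu /=; case: ifP => // bmu.
have stab k : (m <= k)%N -> u k mu = u m mu.
  elim: k => [|k IH]; first by rewrite leqn0 => /eqP ->.
  rewrite leq_eqVlt => /orP[/eqP -> //|]; rewrite ltnS => mk.
  rewrite -IH //.
  have := H k (leq_trans Mm mk) => /pseriesP/(_ mu) /=.
  by rewrite (below_le mk bmu).
case: xgetP => [c _ [M' H']|/(_ (u m mu)) []]; last by exists m.
rewrite -(H' (maxn m M')) ?leq_maxr // stab ?leq_maxl //.
Qed.

Lemma ps_lim_eq (u : nat -> pseries R) mu c M :
  (forall m, (M <= m)%N -> u m mu = c) -> ps_lim u mu = c.
Proof.
move=> H /=; case: xgetP => [c' _ [M' H']|/(_ c) []]; last by exists M.
by rewrite -(H' (maxn M M')) ?leq_maxr // H ?leq_maxl.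
Qed.

End Trunc.

(** * Alternants and the determinantal formula for G_la *)

Section Determinants.
Variable S : comNzRingType.

Lemma det_scale_rows m (c : 'I_m -> S) (A : 'I_m -> 'I_m -> S) :
  \det (\matrix_(i, j) (c i * A i j)) = (\prod_i c i) * \det (\matrix_(i, j) A i j).
Proof.
transitivity (\det (diag_mx (\row_i c i) *m \matrix_(i, j) A i j)).
  by congr (\det _); apply/matrixP => i j; rewrite mul_diag_mx !mxE.
rewrite det_mulmx det_diag; congr (_ * _).
by apply: eq_bigr => i _; rewrite mxE.
Qed.

Lemma det_rev m (A : 'I_m -> 'I_m -> S) :
  \det (\matrix_(i, j) A (rev_ord i) (rev_ord j)) = \det (\matrix_(i, j) A i j).
Proof.
pose s := perm (@rev_ord_inj m).
have -> : \matrix_(i, j) A (rev_ord i) (rev_ord j)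
          = perm_mx s *m (\matrix_(i, j) A i j) *m (perm_mx s)^T.
  apply/matrixP => i j; rewrite tr_perm_mx -col_permE -row_permE.
  by rewrite !mxE !permE.
by rewrite !det_mulmx det_tr mulrAC -det_mulmx -perm_mxM det_perm odd_permM addbb mul1r.
Qed.

Lemma det_alternant m (y : 'I_m -> S) :
  \det (\matrix_(i < m, j < m) y i ^+ (m - j.+1)) =
  \prod_(i < m) \prod_(j < m | (i < j)%N) (y i - y j).
Proof.
have -> : \det (\matrix_(i < m, j < m) y i ^+ (m - j.+1)) =
          \det (\matrix_(i < m, j < m) y j ^+ (m - i.+1)).
  by rewrite -det_tr; congr (\det _); apply/matrixP => i j; rewrite !mxE.
rewrite -(det_rev (fun i j : 'I_m => y j ^+ (m - i.+1))).
have := det_Vandermonde (\row_j y (rev_ord j)).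
rewrite /Vandermonde => e.
transitivity (\det (\matrix_(i, j) (\row_j y (rev_ord j)) 0 j ^+ (i : 'I_m))).
  congr (\det _); apply/matrixP => i j; rewrite !mxE /=; congr (_ ^+ _).
  by case: i => i /= ltim; lia.
rewrite e [RHS](reindex_inj rev_ord_inj) /=.
rewrite (eq_bigr (fun i : 'I_m => \prod_(j < m | (i < j)%N) (y (rev_ord j) - y (rev_ord i)))); last first.
  by move=> i _; apply: eq_bigr => j _; rewrite !mxE.
rewrite (exchange_big_dep predT) //=; apply: eq_bigr => i _.
rewrite [RHS](reindex_inj rev_ord_inj) /=.
by apply: eq_bigl => j; case: i j => i ? [j ?] /=; lia.
Qed.

(** Reducing the column polynomials modulo the monic product of the X - y_i keeps their values at
    the y_i and brings their degrees below m. The matrix then factors through the Vandermonde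
    matrix. *)
Lemma alternant_dvd m (y : 'I_m -> S) (p : 'I_m -> {poly S}) :
  exists c, \det (\matrix_(i, j) (p j).[y i])
            = c * \det (\matrix_(i < m, j < m) y i ^+ (m - j.+1)).
Proof.
pose M := \prod_i ('X - (y i)%:P) : {poly S}.
have monM : M \is monic by exact: monic_prod_XsubC.
have szM : size M = m.+1 by rewrite /M size_prod_XsubC /index_enum -enumT size_enum_ord.
pose r j := Pdiv.Ring.rmodp (p j) M.
have rE i j : (p j).[y i] = (r j).[y i].
  rewrite {1}(Pdiv.RingMonic.rdivp_eq monM (p j)) hornerD hornerM.
  rewrite [M.[_]](_ : _ = 0) ?mulr0 ?add0r //.
  by rewrite /M horner_prod (bigD1 i) //= hornerXsubC subrr mul0r.
have szr j : (size (r j) <= m)%N.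
  by rewrite -ltnS -szM Pdiv.Ring.ltn_rmodpN0 // monic_neq0.
exists (\det (\matrix_(k < m, j < m) (r j)`_(m - k.+1))).
rewrite mulrC -det_mulmx; congr (\det _); apply/matrixP => i j; rewrite !mxE rE.
rewrite (horner_coef_wide _ (szr j)) (reindex_inj rev_ord_inj) /=.
by apply: eq_bigr => k _; rewrite !mxE mulrC.
Qed.

Lemma horner_Gentry (a b x : S) e j l :
  ('X ^+ e * (1 + b%:P * 'X) ^+ j * (1 - a%:P * 'X) ^+ l).[x]
  = x ^+ e * (1 + b * x) ^+ j * (1 - a * x) ^+ l.
Proof. by rewrite !hornerE. Qed.

End Determinants.

Section Gpart.
Variable R : comNzRingType.
Local Notation "''x_' i" := (var R i) (at level 8, i at level 2).
Implicit Types (la : seq nat) (m : nat).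

Lemma vandermondeE m :
  vandermonde R m = \det (\matrix_(i < m, j < m) 'x_i ^+ (m - j.+1)).
Proof. by rewrite det_alternant vandermonde_var. Qed.

Variables a b : R.

Definition Gnum m la : pseries R :=
  \det (\matrix_(i < m, j < m)
    ('x_i ^+ (nth 0%N la j + (m - j.+1)) * (1 + b *: 'x_i) ^+ j * geom a i ^+ nth 0%N la j)).

Lemma geom_expB L k i : (k <= L)%N ->
  geom a i ^+ k = geom a i ^+ L * (1 - a *: 'x_i) ^+ (L - k).
Proof.
move=> kL; rewrite -[in X in X * _](subnKC kL) exprD -mulrA -exprMn geomK expr1n mulr1 //.
Qed.

(** The quotient in [Gpart_fin] exists: once the denominators are cleared, the numerator is a
    determinant of polynomial values, to which [alternant_dvd] applies. *)
Lemma Gpart_finM m la : Gpart_fin a b m la * vandermonde R m = Gnum m la.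
Proof.
suff [c ec] : exists c, Gnum m la = c * vandermonde R m.
  rewrite /Gpart_fin.
  rewrite [X in ps_quo X _](_ : _ = Gnum m la); last first.
    by congr (\det _); apply/matrixP => i j; rewrite !mxE varE ps_quo_geom.
  rewrite (ps_quoP (@regular_vandermonde R m) (esym ec)) //.
(* L bounds all exponents of 1/(1 - a x_i), so its L-th power can be taken out of row i. *)
pose L := \max_(j < m) nth 0%N la j.
pose p (j : 'I_m) : {poly pseries R} := 'X ^+ (nth 0%N la j + (m - j.+1)) *
  (1 + b%:A%:P * 'X) ^+ j * (1 - a%:A%:P * 'X) ^+ (L - nth 0%N la j).
have [c ec] := alternant_dvd (fun i : 'I_m => 'x_i) p.
exists ((\prod_(i < m) geom a i ^+ L) * c); rewrite vandermondeE -mulrA -ec.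
rewrite -(det_scale_rows (fun i => geom a i ^+ L)).
congr (\det _); apply/matrixP => i j; rewrite !mxE /p horner_Gentry.
have := @leq_bigmax _ (fun j : 'I_m => nth 0%N la j) j.
move=> /(geom_expB i) ->.
by rewrite !mulr_algl mulrCA !mulrA.
Qed.

Lemma trunc_vandermonde m : trunc m (vandermonde R m) = vandermonde R m.
Proof.
rewrite vandermonde_var trunc_prod; apply: eq_bigr => i _.
rewrite trunc_prod; apply: eq_bigr => j _.
rewrite truncB.
by rewrite !trunc_var !ltn_ord.
Qed.

Lemma trunc_vandermondeS m :
  trunc m (vandermonde R m.+1) = (\prod_(i < m) 'x_i) * vandermonde R m.
Proof.
rewrite !vandermonde_var big_ord_recr /= [X in _ * X]big1 ?mulr1; last first.
  by move=> j; rewrite ltnNge -ltnS ltn_ord.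
rewrite trunc_prod -big_split; apply: eq_bigr => i _ /=.
rewrite trunc_prod big_mkcond big_ord_recr /= ltn_ord truncB !trunc_var ltnn ltn_ord subr0.
rewrite mulrC; congr (_ * _); rewrite [RHS]big_mkcond /=; apply: eq_bigr => j _.
by case: ifP => // _; rewrite truncB !trunc_var !ltn_ord.
Qed.

Lemma trunc_Gentry m i e j l : (i < m)%N ->
  trunc m ('x_i ^+ e * (1 + b *: 'x_i) ^+ j * geom a i ^+ l)
  = 'x_i ^+ e * (1 + b *: 'x_i) ^+ j * geom a i ^+ l.
Proof.
move=> im; rewrite !truncM !truncX truncD trunc1 truncZ trunc_var im.
by rewrite trunc_geom.
Qed.

Lemma trunc_Gnum m la : trunc m (Gnum m la) = Gnum m la.
Proof.
rewrite /Gnum trunc_det; congr (\det _); apply/matrixP => i j; rewrite !mxE.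
by rewrite trunc_Gentry.
Qed.

(** At x_m = 0 the last row vanishes except for its last entry, which is 1 because la has at most m
    parts. The remaining minor has an extra factor x_i in row i, exactly as in [trunc_vandermondeS];
    the quotients are therefore stable. *)
Lemma trunc_GnumS m la : (size la <= m)%N ->
  trunc m (Gnum m.+1 la) = (\prod_(i < m) 'x_i) * Gnum m la.
Proof.
move=> lam; rewrite /Gnum trunc_det (expand_det_row _ ord_max) big_ord_recr /=.
rewrite big1 ?add0r => [|j _]; last first.
  rewrite !mxE !truncM !truncX trunc_var ltnn.
  have -> : (nth 0%N la j + (m.+1 - j.+1) = (nth 0%N la j + (m - j.+1)).+1)%N by case: j => j /=; lia.
  by rewrite expr0n /= !mul0r.
rewrite !mxE !truncM !truncX trunc_var ltnn nth_default // subnn !expr0 mulr1.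
rewrite truncD trunc1 truncZ trunc_var ltnn scaler0 addr0 expr1n !mul1r.
rewrite /cofactor /= -signr_odd oddD addbb mul1r.
rewrite -det_scale_rows; congr (\det _); apply/matrixP => i j.
rewrite !mxE /= /bump !(leqNgt m) !ltn_ord /= !add0n trunc_Gentry //.
have -> : (nth 0%N la j + (m.+1 - j.+1) = (nth 0%N la j + (m - j.+1)).+1)%N by case: j => j /=; lia.
by rewrite exprS !mulrA.
Qed.

Lemma regular_prod_var m : regular_series (\prod_(i < m) 'x_i).
Proof. by apply: regular_prod => i _; exact: regular_var. Qed.

Lemma trunc_Gpart m la : (size la <= m)%N ->
  trunc m (Gpart a b la) = Gpart_fin a b m la.
Proof.
have idem k : trunc k (Gpart_fin a b k la) = Gpart_fin a b k la.
  apply: (regular_inj (@regular_vandermonde R k)).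
  by rewrite ![vandermonde R k * _]mulrC -{1}trunc_vandermonde -truncM Gpart_finM trunc_Gnum.
move=> lam; rewrite (@ps_limP _ _ (size la)) // => k lak.
rewrite idem; apply: (regular_inj (regularM (@regular_prod_var k) (@regular_vandermonde R k))).
rewrite -{1}trunc_vandermondeS -truncM [vandermonde _ _ * _]mulrC Gpart_finM.
by rewrite trunc_GnumS // -Gpart_finM mulrA mulrAC.
Qed.

Lemma trunc_GpartM m la : (size la <= m)%N ->
  vandermonde R m * trunc m (Gpart a b la) = Gnum m la.
Proof. by move=> lam; rewrite trunc_Gpart // mulrC Gpart_finM. Qed.

End Gpart.

(** * Hecke operators at q = 0 *)

(* Permutations of nat rather than of 'I_N, so that S_N and the shifts          *)
(* 1^m x w live in one type.                                                  *)
Record natperm := NatPerm {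
  pfwd :> nat -> nat;
  pback : nat -> nat;
  pfwdK : cancel pfwd pback;
  pbackK : cancel pback pfwd }.

Lemma natpermP (v w : natperm) : pfwd v =1 pfwd w -> v = w.
Proof.
move=> vw.
have vw' : pback v =1 pback w.
  by move=> i; apply: (can_inj (pfwdK w)); rewrite -vw !pbackK.
case: v w vw vw' => [v v' vK v'K] [w w' wK w'K] /= /funext vw /funext vw'.
by subst w w'; congr NatPerm; exact: Prop_irrelevance.
Qed.

Lemma natperm_inj (v : natperm) : injective v.
Proof. exact: can_inj (pfwdK v). Qed.

Lemma swapK i : involutive (swap i).
Proof. by move=> j; rewrite /swap; repeat (case: eqP => //=); lia. Qed.

Lemma swap_id i k : (i.+1 < k)%N -> swap i k = k.
Proof. by rewrite /swap; repeat (case: eqP => //=); lia. Qed.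

Lemma swap_id_lt i k : (k < i)%N -> swap i k = k.
Proof. by rewrite /swap; repeat (case: eqP => //=); lia. Qed.

Lemma swapl i : swap i i = i.+1.
Proof. by rewrite /swap eqxx. Qed.

Lemma swapr i : swap i i.+1 = i.
Proof. by rewrite /swap eqxx; case: eqP => //; lia. Qed.

Definition np1 : natperm := @NatPerm id id (fun=> erefl) (fun=> erefl).
Definition npsw j : natperm := @NatPerm (swap j) (swap j) (swapK j) (swapK j).
Definition npinv (v : natperm) : natperm := @NatPerm (pback v) v (pbackK v) (pfwdK v).
Definition npmul (v w : natperm) : natperm :=
  @NatPerm (v \o w) (pback w \o pback v)
    (can_comp (pfwdK v) (pfwdK w)) (can_comp (pbackK w) (pbackK v)).

Lemma npmulA v w x : npmul v (npmul w x) = npmul (npmul v w) x.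
Proof. exact: natpermP. Qed.
Lemma npmul1 v : npmul v np1 = v. Proof. exact: natpermP. Qed.
Lemma np1mul v : npmul np1 v = v. Proof. exact: natpermP. Qed.
Lemma npVmul v : npmul (npinv v) v = np1.
Proof. by apply: natpermP => i /=; rewrite pfwdK. Qed.
Lemma npinvM v w : npinv (npmul v w) = npmul (npinv w) (npinv v).
Proof. exact: natpermP. Qed.
Lemma npinvK v : npinv (npinv v) = v. Proof. exact: natpermP. Qed.
Lemma npsw2 j : npmul (npsw j) (npsw j) = np1.
Proof. by apply: natpermP => i /=; rewrite swapK. Qed.
Lemma npinv_sw j : npinv (npsw j) = npsw j. Proof. exact: natpermP. Qed.

(* Right multiplication by the generator u_j of the Hecke algebra with        *)
(* u_j ^ 2 = g u_j, on families of coefficients: F stands for                 *)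
(* \sum_w F w T_w, where T_w u_j is T_(w s_j) if w j < w (j + 1), and         *)
(* g T_w otherwise.                                                           *)
Section Hecke.
Variables (K : comNzRingType) (g : K).
Implicit Types (F G : natperm -> K) (x y : K).

Definition uop j F : natperm -> K := fun w =>
  if (w j.+1 < w j)%N then F (npmul w (npsw j)) + g * F w else 0.

Lemma uopD j F G : uop j (fun w => F w + G w) = fun w => uop j F w + uop j G w.
Proof. by apply/funext => w; rewrite /uop; case: ifP => _; ring. Qed.
Lemma uopZ j c F : uop j (fun w => c * F w) = fun w => c * uop j F w.
Proof. by apply/funext => w; rewrite /uop; case: ifP => _; ring. Qed.

Lemma uopK j F : uop j (uop j F) = fun w => g * uop j F w.
Proof.
apply/funext => w; rewrite {1}/uop; case: ifP => [lt_w|nlt_w].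
  rewrite {1}/uop /= /swap !eqxx eqn_leq ltnn /=.
  by rewrite ltnNge (ltnW lt_w) add0r.
by rewrite /uop nlt_w mulr0.
Qed.

Lemma uop_far j k F : (j.+1 < k)%N -> uop j (uop k F) = uop k (uop j F).
Proof.
move=> jk; apply/funext => w; rewrite /uop /= /swap.
have -> : (k.+1 == j) = false by lia.
have -> : (k.+1 == j.+1) = false by lia.
have -> : (k == j) = false by lia.
have -> : (k == j.+1) = false by lia.
have -> : (j.+1 == k) = false by lia.
have -> : (j.+1 == k.+1) = false by lia.
have -> : (j == k) = false by lia.
have -> : (j == k.+1) = false by lia.
have -> : npmul (npmul w (npsw j)) (npsw k) = npmul (npmul w (npsw k)) (npsw j).
  rewrite -!npmulA; congr npmul; apply: natpermP => i /=; rewrite /swap.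
  by repeat (case: eqP => //=); lia.
by case: ifP; case: ifP => _ _; ring.
Qed.

Lemma uop_braid j F :
  uop j (uop j.+1 (uop j F)) = uop j.+1 (uop j (uop j.+1 F)).
Proof.
apply/funext => w; rewrite /uop /= /swap.
have e1 : (j.+1 == j) = false by lia.
have e2 : (j.+2 == j) = false by lia.
have e3 : (j == j.+1) = false by lia.
have e4 : (j == j.+2) = false by lia.
have e5 : (j.+2 == j.+1) = false by lia.
have e6 : (j.+1 == j.+2) = false by lia.
rewrite !(eqxx, e1, e2, e3, e4, e5, e6).
have -> : npmul (npmul (npmul w (npsw j)) (npsw j.+1)) (npsw j) =
          npmul (npmul (npmul w (npsw j.+1)) (npsw j)) (npsw j.+1).
  rewrite -!npmulA; congr npmul; apply: natpermP => i /=; rewrite /swap.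
  by repeat (case: eqP => //=); lia.
have: w j != w j.+1 by rewrite (inj_eq (@natperm_inj w)); lia.
have: w j != w j.+2 by rewrite (inj_eq (@natperm_inj w)); lia.
have: w j.+1 != w j.+2 by rewrite (inj_eq (@natperm_inj w)); lia.
have sqj : npmul (npmul w (npsw j)) (npsw j) = w by rewrite -npmulA npsw2 npmul1.
have sqj1 : npmul (npmul w (npsw j.+1)) (npsw j.+1) = w by rewrite -npmulA npsw2 npmul1.
(* The comparisons depend only on the relative order of w j, w (j + 1), w (j + 2); impossible orders
   are discarded by arithmetic. *)
move=> ? ? ?; repeat (case: ifP => ?); first [exfalso; lia | rewrite ?sqj ?sqj1; ring].
Qed.

Definition top x j F : natperm -> K := fun w => F w + x * uop j F w.

Lemma topC x y j F : top x j (top y j F) = top y j (top x j F).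
Proof.
by apply/funext => w; rewrite /top !uopD !uopZ !uopK; ring.
Qed.

Lemma top_far x y j k F : (j.+1 < k)%N -> top x j (top y k F) = top y k (top x j F).
Proof.
move=> jk; apply/funext => w; rewrite /top !uopD !uopZ uop_far //; ring.
Qed.

(* The Yang-Baxter equation, in a form that involves no division by 1 + g x.  *)
Lemma yang_baxter x y i F F' :
  top y i.+1 F = top x i.+1 F' ->
  top y i (top y i.+1 (top x i F)) = top x i (top x i.+1 (top y i F')).
Proof.
move=> H; apply/funext => w.
have H1 := congr1 (fun G => G w) H.
have H2 := congr1 (fun G => uop i G w) H.
have H3 := congr1 (fun G => uop i.+1 (uop i G) w) H.
have H4 := congr1 (fun G => uop i (uop i.+1 G) w) H.
move: H1 H2 H3 H4; rewrite /top !(uopD, uopZ) !uopK !(uopD, uopZ) -!uop_braid.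
move=> /eqP; rewrite -subr_eq0 => /eqP H1.
move=> /eqP; rewrite -subr_eq0 => /eqP H2.
move=> /eqP; rewrite -subr_eq0 => /eqP H3.
move=> /eqP; rewrite -subr_eq0 => /eqP H4.
apply/eqP; rewrite -subr_eq0; apply/eqP.
(* With D the difference of the two sides of the hypothesis, the two sides of the goal differ by D +
   (x + y + g x y) u_i D + x y u_(i+1) u_i D - x y u_i u_(i+1) D. *)
rewrite -[RHS](_ : 0 + (x + y + g * x * y) * 0 + x * y * 0 - x * y * 0 = 0); last by ring.
rewrite -{1}H1 -{1}H2 -{1}H3 -H4; ring.
Qed.

Definition Aop (js : seq nat) x F : natperm -> K := foldr (top x) F js.

Lemma Aop_far x y i js F : all (fun j => i.+1 < j)%N js ->
  Aop js y (top x i F) = top x i (Aop js y F).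
Proof.
elim: js => [//|j js IH] /= /andP[ij /IH ->].
by rewrite -(top_far x y _ ij).
Qed.

Lemma iota_far i k m : (i <= m)%N -> all (fun j => i.+1 < j)%N (iota m.+2 k).
Proof. by move=> im; apply/allP => j; rewrite mem_iota; lia. Qed.

Lemma Aop_cons j js x F : Aop (j :: js) x F = top x j (Aop js x F).
Proof. by []. Qed.

Lemma AopS i k x F : Aop (iota i k.+1) x F = top x i (Aop (iota i.+1 k) x F).
Proof. by []. Qed.

(** Commutation of A(x) and A(y), after Fomin and Kirillov. The factors with indices from i + 2 on
    move past u_i; what remains is [yang_baxter], whose hypothesis is the induction hypothesis for
    the product starting at i + 1. *)
Lemma AopC i k x y F :
  Aop (iota i k) y (Aop (iota i k) x F) = Aop (iota i k) x (Aop (iota i k) y F).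
Proof.
elim: k i F => [//|[|k] IH] i F; first exact: topC.
move: (IH i.+1 F); rewrite !(AopS i) !(AopS i.+1) => H.
by rewrite (@Aop_far x y i) ?(@Aop_far y x i) ?iota_far //; apply: yang_baxter.
Qed.

End Hecke.

(** * Length and reduced words *)

Section Swap.
Variables (R : comNzRingType) (i : nat).
Local Notation "''x_' i" := (var R i) (at level 8, i at level 2).

Definition mswap (mu : monomial) : monomial :=
  seq_mset [seq swap i j | j <- enum_mset mu].

Lemma mswapE mu j : mswap mu j = mu (swap i j).
Proof.
rewrite /mswap mset_seqE count_map -count_mem_mset; apply: eq_count => k /=.
by rewrite -(inj_eq (inv_inj (swapK i))) swapK.
Qed.

Lemma mswapK : involutive mswap.
Proof. by move=> mu; apply/msetP => j; rewrite !mswapE swapK. Qed.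

Lemma ps_swapE (f : pseries R) mu : ps_swap i f mu = f (mswap mu).
Proof. by []. Qed.

Lemma mswap_sub (mu nu : monomial) : (mswap nu `<=` mswap mu)%mset = (nu `<=` mu)%mset.
Proof.
apply/msubsetP/msubsetP => H j; last by rewrite !mswapE.
by have := H (swap i j); rewrite !mswapE swapK.
Qed.

Fact ps_swap_is_zmod : zmod_morphism (@ps_swap R i).
Proof. by move=> f g; apply/pseriesP. Qed.

Fact ps_swap_is_monoid : monoid_morphism (@ps_swap R i).
Proof.
split=> [|f g]; apply/pseriesP => mu; rewrite ps_swapE.
  rewrite !ps_coef1; congr (nat_of_bool _)%:R; apply/eqP/eqP => [mu0|->]; apply/msetP => j.
    by rewrite -(mswapK mu) mswapE mu0 !mset0E.
  by rewrite mswapE !mset0E.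
rewrite !ps_coefM.
rewrite (perm_big [seq mswap nu | nu <- msubs mu]) ?big_map.
  apply: eq_bigr => nu _; rewrite !ps_swapE; congr (_ * g _).
  by apply/msetP => j; rewrite !(mswapE, msetE2).
apply: uniq_perm; rewrite ?map_inj_uniq ?fset_uniq //; first exact: inv_inj mswapK.
move=> nu; rewrite in_msubs -(mswapK nu) mem_map; last exact: inv_inj mswapK.
by rewrite in_msubs mswap_sub.
Qed.
HB.instance Definition _ := GRing.isZmodMorphism.Build _ _ (@ps_swap R i) ps_swap_is_zmod.
HB.instance Definition _ := GRing.isMonoidMorphism.Build _ _ (@ps_swap R i) ps_swap_is_monoid.

Lemma ps_swapD (f h : pseries R) : ps_swap i (f + h) = ps_swap i f + ps_swap i h.
Proof. exact: rmorphD. Qed.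
Lemma ps_swapM (f h : pseries R) : ps_swap i (f * h) = ps_swap i f * ps_swap i h.
Proof. exact: rmorphM. Qed.
Lemma ps_swap0 : ps_swap i (0 : pseries R) = 0. Proof. exact: rmorph0. Qed.
Lemma ps_swap1 : ps_swap i (1 : pseries R) = 1. Proof. exact: rmorph1. Qed.

Lemma ps_swapZ c (f : pseries R) : ps_swap i (c *: f) = c *: ps_swap i f.
Proof. exact/pseriesP. Qed.

Lemma ps_swap_var j : ps_swap i 'x_j = 'x_(swap i j).
Proof.
rewrite -varE; apply/pseriesP => mu; rewrite ps_swapE /=; congr (nat_of_bool _)%:R.
apply/eqP/eqP => [e|->]; apply/msetP => k.
  rewrite -(mswapK mu) mswapE e !msetnE.
  by rewrite (can2_eq (swapK i) (swapK i)).
by rewrite mswapE !msetnE (can2_eq (swapK i) (swapK i)) swapK.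
Qed.

End Swap.

Section Length.
Variable N : nat.
Implicit Types w : natperm.

Definition ell w : nat := (\sum_(a < N) \sum_(b < N) (((a < b) && (w b < w a)) : nat))%N.

Lemma ell_desc w j : (j.+1 < N)%N -> (w j.+1 < w j)%N ->
  ell w = (ell (npmul w (npsw j))).+1.
Proof.
move=> jN dw.
have swN (a : 'I_N) : (swap j a < N)%N.
  by case: a => a aN; rewrite /swap /=; case: eqP => // _; case: eqP => // _; lia.
pose s (a : 'I_N) := Ordinal (swN a).
have sK : involutive s by move=> a; apply: val_inj; rewrite /= swapK.
pose j0 := Ordinal (ltnW jN); pose j1 := Ordinal jN.
rewrite /ell [in RHS](reindex_inj (inv_inj sK)) /=.
under [in RHS]eq_bigr => a _ do rewrite (reindex_inj (inv_inj sK)) /=.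
(* The additional 1 becomes a double sum supported at the inversion (j, j + 1), so that the two
   counts can be compared term by term. *)
have -> : forall x : nat, x.+1 = (x + \sum_(a < N) \sum_(b < N) (((a == j0) && (b == j1)) : nat))%N.
  move=> x; rewrite (bigD1 j0) //= (bigD1 j1) //= !eqxx big1 ?big1 ?addn0 ?addn1 //.
    by move=> a /negPf ->; rewrite big1.
  by move=> b /negPf ->; rewrite andbF.
rewrite -big_split /=; apply: eq_bigr => a _; rewrite -big_split /=; apply: eq_bigr => b _.
rewrite !swapK -!val_eqE /=.
case: a b => a aN [b bN] /=; rewrite /swap.
have e1 : (j.+1 == j) = false by lia.
have [[-> ->]|nab] : (a = j /\ b = j.+1) \/ ~ (a = j /\ b = j.+1) by lia.
  by rewrite !eqxx e1 /= dw ltnSn ltnNge leqnSn.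
have -> : (a == j) && (b == j.+1) = false by apply/negP => /andP[/eqP ? /eqP ?]; apply: nab.
rewrite addn0; have [[-> ->]|nba] : (a = j.+1 /\ b = j) \/ ~ (a = j.+1 /\ b = j) by lia.
  rewrite !eqxx e1 /=.
  have -> : (w j < w j.+1)%N = false by lia. by rewrite !andbF.
congr (nat_of_bool (_ && _)).
by repeat (case: eqP => [?|?]; subst => //=); lia.
Qed.

Lemma ell_sw w j : (j.+1 < N)%N -> (ell w <= (ell (npmul w (npsw j))).+1)%N.
Proof.
move=> jN; case: (ltngtP (w j.+1) (w j)) => [dw|aw|/natperm_inj]; last by lia.
  by rewrite (ell_desc jN dw).
rewrite (@ell_desc (npmul w (npsw j)) j) //.
  by rewrite -npmulA npsw2 npmul1; lia.
rewrite /= /swap !eqxx; have -> : (j.+1 == j) = false by lia.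
by [].
Qed.

Definition word (s : seq nat) : natperm := foldr (fun j w => npmul (npsw j) w) np1 s.

Lemma wordE s (x : nat) : word s x = foldr swap x s.
Proof. by elim: s => //= j s ->. Qed.

Definition letters (s : seq nat) := all (fun i => i.+1 < N)%N s.

Lemma swap_lt j x : (j.+1 < N)%N -> (swap j x < N)%N = (x < N)%N.
Proof. by rewrite /swap; case: eqP => [->|]; [lia|]; case: eqP => [->|]; lia. Qed.

Lemma word_lt s (x : nat) : letters s -> (word s x < N)%N = (x < N)%N.
Proof. by elim: s => //= j s IH /andP[jN /IH <-]; rewrite swap_lt. Qed.

Lemma word_inv_lt s (x : nat) : letters s -> (pback (word s) x < N)%N = (x < N)%N.
Proof. by move=> sN; rewrite -(word_lt _ sN) pbackK. Qed.

Definition transp (a b x : nat) : nat := if x == a then b else if x == b then a else x.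

(** Exchange condition. Since the values a < b occur in reversed order, some letter of t exchanges
    exactly these two as the pair is followed through the word. Deleting this letter multiplies on
    the left by the transposition of a and b. *)
Lemma exchange t a b : (a < b)%N -> (pback (word t) b < pback (word t) a)%N -> letters t ->
  exists t', [/\ (size t' < size t)%N, letters t' & forall x, word t' x = transp a b (word t x)].
Proof.
elim: t a b => [|j t IH] a b ab /=; first by lia.
move=> inv_ab /andP[jN tN].
have [[aj bj]|neq] : (a = j /\ b = j.+1) \/ ~ (a = j /\ b = j.+1) by lia.
  exists t; split=> // x; rewrite aj bj /transp /swap.
  by repeat (case: eqP => //=); lia.
have [] := IH (swap j a) (swap j b) _ inv_ab tN.
  move: ab neq; rewrite /swap; repeat (case: eqP => //=); lia.
move=> t' [st t'N tE]; exists (j :: t'); split=> //=; first by rewrite jN.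
move=> x; rewrite tE /transp; rewrite !(can2_eq (swapK j) (swapK j)).
case: eqP => [_|_]; first by rewrite swapK.
by case: eqP => [_|_] //; rewrite swapK.
Qed.

Definition reduced t := letters t /\
  forall t', letters t' -> word t' = word t -> (size t <= size t')%N.

Lemma reduced_cons j t : reduced (j :: t) ->
  [/\ reduced t, (j.+1 < N)%N & (pback (word t) j < pback (word t) j.+1)%N].
Proof.
case=> /= /andP[jN tN] H; split=> //.
  split=> // t' t'N tE; have := H (j :: t'); rewrite /= jN t'N tE ltnS; exact.
case: (ltngtP (pback (word t) j) (pback (word t) j.+1)) => // [lt|eq].
  have [t' [st t'N tE]] := exchange (ltnSn j) lt tN.
  have := H t' t'N; rewrite leqNgt ltnS (ltnW st) => H'.
  suff: false by []; apply: H'; apply: natpermP => x; rewrite tE /= /transp /swap.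
  by [].
by have := can_inj (pbackK (word t)) eq; lia.
Qed.

(** Bubble sort: removing a descent lowers the number of inversions, and a permutation of 0, ..., N
    - 1 without descents is the identity. *)
Lemma word_exists w : (forall i, (N <= i)%N -> w i = i) ->
  exists2 s, letters s & word s = w.
Proof.
have [k] := ubnP (ell w); elim: k w => // k IH w wk wN.
have wlt i : (i < N)%N -> (w i < N)%N.
  by move=> iN; rewrite ltnNge; apply/negP => /[dup] /wN /natperm_inj; lia.
case: (boolP [exists j : 'I_N, (j.+1 < N)%N && (w j.+1 < w j)%N]) => [/existsP[j /andP[jN dw]]|].
  have [||s sN sE] := IH (npmul w (npsw j)).
  - by move: wk; rewrite (ell_desc jN dw).
  - move=> i Ni /=; rewrite /swap; have -> : (i == j) = false by lia.
    have -> : (i == j.+1) = false by lia.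
    exact: wN.
  exists (rcons s j); first by rewrite /letters all_rcons jN.
  suff -> : word (rcons s j) = npmul (word s) (npsw j) by rewrite sE -npmulA npsw2 npmul1.
  by apply: natpermP => x; rewrite /= !wordE foldr_rcons.
rewrite negb_exists => /forallP nd.
have inc j : (j.+1 < N)%N -> (w j < w j.+1)%N.
  move=> jN; have := nd (Ordinal (ltnW jN)); rewrite /= jN /= -leqNgt leq_eqVlt.
  by case/orP => // /eqP /natperm_inj; lia.
exists [::] => //; apply: natpermP => i /=.
case: (leqP N i) => [/wN //|iN]; apply/eqP; rewrite eqn_leq; apply/andP; split.
  elim: i iN => // i IHi iN; apply: leq_ltn_trans (inc _ iN); apply: IHi; lia.
have [d] := ubnP (N - i); elim: d i iN => // d IHd i iN di.
case: (ltnP i.+1 N) => [iN1|]; last by have := wlt i iN; lia.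
by have := inc _ iN1; have := IHd i.+1 iN1; lia.
Qed.

End Length.

(** * Grothendieck polynomials as coefficients of a product *)

Section NatpermOfPerm.
Variable N : nat.
Implicit Types v w : 'S_N.

Definition ext v (k : nat) : nat := if insub k is Some i then v i : 'I_N else k.

Lemma extE v (i : 'I_N) : ext v i = v i.
Proof. by rewrite /ext valK. Qed.

Lemma ext_out v k : (N <= k)%N -> ext v k = k.
Proof. by move=> Nk; rewrite /ext insubF // ltnNge Nk. Qed.

Lemma extK v : cancel (ext v) (ext v^-1%g).
Proof.
move=> k; case: (ltnP k N) => [kN|Nk]; last by rewrite !ext_out.
by rewrite (extE v (Ordinal kN)) extE permK.
Qed.

Lemma extKV v : cancel (ext v^-1%g) (ext v).
Proof. by move=> k; rewrite -{1}(invgK v) extK. Qed.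

Definition npof v : natperm := NatPerm (extK v) (extKV v).

Lemma npof_mul v w : npof (v * w)%g = npmul (npof w) (npof v).
Proof.
apply: natpermP => k /=; case: (ltnP k N) => [kN|Nk]; last by rewrite !ext_out.
by rewrite (extE _ (Ordinal kN)) (extE v (Ordinal kN)) extE permM.
Qed.

Lemma npof_inv v : npof v^-1%g = npinv (npof v).
Proof. exact: natpermP. Qed.

Definition w0 : natperm := npof (longest N).

Lemma w0E k : (k < N)%N -> w0 k = (N - k.+1)%N.
Proof. by move=> kN; rewrite /= (extE _ (Ordinal kN)) permE. Qed.

Lemma w0_out k : (N <= k)%N -> w0 k = k.
Proof. exact: ext_out. Qed.

Lemma w02 : npmul w0 w0 = np1.
Proof.
apply: natpermP => k; rewrite -[LHS]/(w0 (w0 k)) -[RHS]/k; case: (ltnP k N) => [kN|Nk].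
  by rewrite (w0E kN) w0E; lia.
by rewrite !w0_out.
Qed.

Lemma npinv_w0 : npinv w0 = w0.
Proof. by rewrite -[LHS]npmul1 -w02 npmulA npVmul np1mul. Qed.

End NatpermOfPerm.

Definition T1 (K : comNzRingType) : natperm -> K :=
  fun w => if `[< w = np1 >] then 1 else 0.

Lemma isobaric_aux (A : comNzRingType) (c x y S T G : A) :
  S + x * (G + c * S) = T + y * (G + c * T) ->
  G * (x - y) = (1 + c * y) * T - (1 + c * x) * S.
Proof.
move=> /eqP; rewrite -subr_eq0 => /eqP H.
by apply/eqP; rewrite -subr_eq0 -H; apply/eqP; ring.
Qed.

Section FominKirillov.
Variables (R : comNzRingType) (gamma : R) (N : nat).
Local Notation "''x_' i" := (var R i) (at level 8, i at level 2).
Local Notation K := (pseries R).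
Local Notation g := (gamma%:A : K).
Implicit Types (F : natperm -> K) (w : natperm).

(* stage N is the Fomin-Kirillov product; its coefficient at w is the          *)
(* Grothendieck polynomial of w (grothendieckE).                               *)
Fixpoint stage k : natperm -> K :=
  if k is k'.+1 then Aop g (iota k' (N - k'.+1)) 'x_k' (stage k') else T1 K.

Definition sw i F : natperm -> K := fun w => ps_swap i (F w).

Lemma sw_uop i j F : sw i (uop g j F) = uop g j (sw i F).
Proof.
apply/funext => w; rewrite /sw /uop; case: ifP => _; last by rewrite ps_swap0.
by rewrite ps_swapD ps_swapM ps_swapZ ps_swap1.
Qed.

Lemma sw_top i j x F : sw i (top g x j F) = top g (ps_swap i x) j (sw i F).
Proof.
by apply/funext => w; rewrite /top -sw_uop /sw ps_swapD ps_swapM.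
Qed.

Lemma sw_Aop i js x F : sw i (Aop g js x F) = Aop g js (ps_swap i x) (sw i F).
Proof. by elim: js => [//|j js IH]; rewrite !Aop_cons sw_top IH. Qed.

Lemma sw_stage i k : (k <= i)%N -> sw i (stage k) = stage k.
Proof.
elim: k => [_|k IH ki].
  by apply/funext => w; rewrite /sw /= /T1; case: ifP; rewrite ?ps_swap1 ?ps_swap0.
have e := swap_id_lt ki.
by rewrite -[stage k.+1]/(Aop _ _ _ _) sw_Aop (IH (ltnW ki)) ps_swap_var e.
Qed.

(** For k = i + 2 the additional factor 1 + x_(i+1) u_i completes the product in x_(i+1) to the same
    range of generators as the product in x_i, and [AopC] applies. All later factors involve only
    u_j with j > i + 1 and commute with u_i. *)
Lemma top_stage_sym i k : (i.+1 < k <= N)%N ->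
  sw i (top g 'x_(i.+1) i (stage k)) = top g 'x_(i.+1) i (stage k).
Proof.
elim: k => [|k IH /andP[ik kN]]; first (case/andP; discriminate).
case: (ltnP i.+1 k) => [ik1|ki1].
  have far : all (fun j => i.+1 < j)%N (iota k (N - k.+1)).
    by apply/allP => j; rewrite mem_iota; lia.
  rewrite -[stage k.+1]/(Aop _ _ _ _) -(Aop_far _ _ _ _ far).
  have {}IH := IH (introT andP (conj ik1 (ltnW kN))).
  by rewrite sw_Aop IH ps_swap_var (swap_id ik1).
have ek : k = i.+1 by lia.
rewrite ek -[stage i.+2]/(Aop _ _ _ (Aop _ _ _ _)).
have eN : (N - i.+1 = (N - i.+2).+1)%N by lia.
rewrite eN -AopS sw_Aop sw_Aop (sw_stage (leqnn i)) !ps_swap_var swapl swapr.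
exact: AopC.
Qed.

(** Reading [top_stage_sym] at the ascent w s_i shows that the coefficient there is symmetric in x_i
    and x_(i+1); reading it at w then expresses this coefficient by the divided difference. *)
Lemma isobaric_stage w i : (i.+1 < N)%N -> (w i.+1 < w i)%N ->
  isobaric gamma i (stage N w) = stage N (npmul w (npsw i)).
Proof.
move=> iN dw; have H := top_stage_sym (k := N) (i := i); rewrite iN leqnn in H.
have {}H := H isT.
have aw : (npmul w (npsw i) i < npmul w (npsw i) i.+1)%N.
  rewrite /= /swap !eqxx; have -> : (i.+1 == i) = false by lia.
  by [].
have H1 := congr1 (fun F => F (npmul w (npsw i))) H.
have {H}H2 := congr1 (fun F => F w) H.
move: H1 H2; rewrite /sw /top /uop dw ltnNge (ltnW aw) /= !mulr0 !addr0 => H1.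
rewrite !(ps_swapD, ps_swapM) H1 ps_swapZ ps_swap1 => H2.
rewrite /isobaric varE; apply: ps_quoP; first by apply: regular_varB; lia.
move: H2; rewrite !(ps_swapD, ps_swapM, ps_swap1) ps_swapZ !ps_swap_var swapr.
rewrite -[gamma *: 'x_i.+1]mulr_algl -[gamma *: 'x_i]mulr_algl.
exact: isobaric_aux.
Qed.

(** Each new letter of a reduced word is an ascent of the inverse of the rest ([reduced_cons]);
    composing with w0 makes it the descent that [isobaric_stage] requires. *)
Lemma isobaric_word t : reduced N t ->
  foldr (isobaric gamma) (stage N (w0 N)) t = stage N (npmul (w0 N) (npinv (word t))).
Proof.
elim: t => [_|j t IH] /=.
  by have -> : npmul (w0 N) (npinv np1) = w0 N by exact: natpermP.
move=> /reduced_cons[rt jN lt_j]; rewrite IH // isobaric_stage //.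
  by congr stage; rewrite npinvM npinv_sw npmulA.
have lt1 : (pback (word t) j.+1 < N)%N by rewrite word_inv_lt //; case: rt.
have lt0 := ltn_trans lt_j lt1.
rewrite -[X in (X < _)%N]/(w0 N (pback (word t) j.+1)).
by rewrite -[X in (_ < X)%N]/(w0 N (pback (word t) j)) !w0E //; lia.
Qed.

Lemma uop_vanish F j L x : (j.+1 < N)%N ->
  (forall w, (L < ell N w)%N -> F w = 0) ->
  forall w, (L.+1 < ell N w)%N -> top g x j F w = 0.
Proof.
move=> jN H w Lw; rewrite /top /uop H; last exact: ltn_trans Lw.
case: ifP => _; last by rewrite mulr0 addr0.
rewrite H; first by rewrite !(mulr0, addr0).
by have := ell_sw w jN; lia.
Qed.

Lemma Aop_vanish F js L x : all (fun j => j.+1 < N)%N js ->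
  (forall w, (L < ell N w)%N -> F w = 0) ->
  forall w, (L + size js < ell N w)%N -> Aop g js x F w = 0.
Proof.
move=> + H; elim: js => [|j js IH] /=; first by rewrite addn0.
move=> /andP[jN jsN]; rewrite addnS; by apply: uop_vanish jN (IH jsN).
Qed.

Fixpoint stage_len k : nat := if k is k'.+1 then (stage_len k' + (N - k'.+1))%N else 0%N.

Lemma letters_iota k : all (fun j => j.+1 < N)%N (iota k (N - k.+1)).
Proof. by apply/allP => j; rewrite mem_iota; lia. Qed.

Lemma stage_vanish k w : (stage_len k < ell N w)%N -> stage k w = 0.
Proof.
elim: k w => [|k IH] w /=.
  rewrite /T1; case: asboolP => [->|//]; rewrite /ell big1 // => a _.
  by rewrite big1 // => b _ /=; case: ltngtP.
have := Aop_vanish (F := stage k) (L := stage_len k) 'x_k (letters_iota k) IH.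
rewrite size_iota; exact.
Qed.

(* The longest permutation after some of its descents are removed, in the      *)
(* order of the factors of stage N. Counting lengths, no other choice of       *)
(* factors contributes to the coefficient at the longest permutation.          *)
Definition zigzag k j a : nat :=
  if (N <= a)%N then a else if (a < k)%N then (N - a.+1)%N
  else if (a < j)%N then (a - k)%N else if a == j then (N - k.+1)%N else (a - k.+1)%N.

Lemma Aop_zigzag k j c F L w x : (k <= j)%N -> (j + c = N.-1)%N -> (0 < N)%N ->
  (forall u, (L < ell N u)%N -> F u = 0) -> (L + c <= ell N w)%N ->
  w =1 zigzag k j ->
  exists2 w' : natperm, w' =1 zigzag k N.-1 & Aop g (iota j c) x F w = x ^+ c * F w'.
Proof.
move=> + + N0 Fv; elim: c j w => [|c IH] j w kj jc lw wE.
  by exists w; [move=> a; rewrite wE -jc addn0 | rewrite mul1r].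
have jN : (j.+1 < N)%N by lia.
have dw : (w j.+1 < w j)%N by rewrite !wE /zigzag; repeat (case: ifP => //=); lia.
have [||||w' w'E e] := IH j.+1 (npmul w (npsw j)).
- lia.
- lia.
- by move: lw; rewrite (ell_desc jN dw); lia.
- move=> a; rewrite /= wE /zigzag /swap.
  by repeat (case: ifP => //=); lia.
exists w' => //; rewrite AopS /top /uop dw.
(* The remaining c factors raise the length by at most c, too little to reach w. Hence only the
   passage from w s_j to w survives. *)
rewrite (@Aop_vanish F _ L) //; first last.
- by rewrite size_iota; lia.
- by apply/allP => i; rewrite mem_iota; lia.
by rewrite mulr0 addr0 add0r e mulrA -exprS.
Qed.

Lemma sum_gtn a n : (\sum_(b < n) ((a < b) : nat) = n - a.+1)%N.
Proof. by elim: n => [|n IH]; [rewrite big_ord0 | rewrite big_ord_recr /= IH; lia]. Qed.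

Lemma ell_zigzag k w : (k <= N)%N -> w =1 zigzag k N -> (stage_len k <= ell N w)%N.
Proof.
move=> kN wE.
have -> : stage_len k = (\sum_(a < N | a < k) (N - a.+1))%N.
  rewrite -(big_ord_widen N (fun a => N - a.+1)%N kN).
  by elim: k {kN wE} => [|k IH]; rewrite ?big_ord0 // big_ord_recr /= IH.
rewrite big_mkcond /ell; apply: leq_sum => a _; case: ifP => // ak.
rewrite -sum_gtn; apply: leq_sum => b _; case: ltnP => //= ab.
rewrite !wE /zigzag; case: a b ak ab => a aN [b bN] /=.
by repeat (case: ifP => //=); lia.
Qed.

(** For k = N the zigzag is the longest element, which yields the monomial at which the recursion
    for Grothendieck polynomials starts. *)
Lemma stage_zigzag k w : (k <= N)%N -> w =1 zigzag k N ->
  stage k w = \prod_(i < k) 'x_i ^+ (N - i.+1).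
Proof.
elim: k w => [|k IH] w kN wE.
  rewrite big_ord0 /= /T1; case: asboolP => // -[]; apply: natpermP => a.
  by rewrite wE /zigzag /= subn0; repeat (case: ifP => //=); lia.
have [||||||w' w'E e] := @Aop_zigzag k k (N - k.+1) (stage k) (stage_len k) w 'x_k.
- by [].
- lia.
- lia.
- exact: stage_vanish.
- exact: (ell_zigzag kN wE).
- by move=> a; rewrite wE /zigzag; repeat (case: ifP => //=); lia.
rewrite [LHS]e big_ord_recr /= mulrC; congr (_ * _); apply: IH; first exact: ltnW.
by move=> a; rewrite w'E /zigzag; repeat (case: ifP => //=); lia.
Qed.

Theorem grothendieckE (v : 'S_N) : grothendieck gamma v = stage N (npof v).
Proof.
rewrite /grothendieck /isobaric_perm varE.
have wordP (u : 'S_N) s : is_word u s <-> letters N s /\ word s = npof u.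
  split=> [[sN sE]|[sN sE]]; split=> //.
    apply: natpermP => k; rewrite wordE; case: (ltnP k N) => [kN|Nk].
      by rewrite (sE (Ordinal kN)) /= (extE u (Ordinal kN)).
    rewrite /= ext_out //; elim: s sN {sE} => //= j s IH /andP[jN /IH ->].
    by rewrite /swap; repeat (case: eqP => //=); lia.
  by move=> x; rewrite -wordE sE /= extE.
have -> : \prod_(i < N) 'x_i ^+ (N - i.+1) = stage N (w0 N).
  rewrite stage_zigzag // => a; rewrite /zigzag; case: (leqP N a) => [Na|aN].
    by rewrite w0_out.
  by rewrite w0E.
set u := (longest N * v^-1)%g.
have [rs rsE] : reduced N (reduced_word u) /\ word (reduced_word u) = npof u.
  rewrite /reduced_word; case: xgetP => [s _ [/wordP[sN sE] Hs]|] /=.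
    by split=> //; split=> // t tN tE; apply: Hs; apply/wordP; rewrite tE sE.
  (* The default of [xget] is ruled out: some word exists, and one of least length is reduced. *)
  have [t tN tE] := @word_exists N (npof u) (fun i => @ext_out N u i).
  have ex : exists k, `[< exists2 s, is_word u s & size s = k >].
    by exists (size t); apply/asboolP; exists t => //; apply/wordP.
  case: (ex_minnP ex) => k /asboolP[s sw sk] kmin /(_ s) [].
  split=> // t' t'w; rewrite sk; apply: kmin; apply/asboolP; by exists t'.
(* In the usual order of composition u is v^-1 w0, so that w0 u^-1 = w0 w0 v = v. *)
rewrite isobaric_word // rsE /u npof_mul npof_inv npinvM npinvK npinv_w0.
by rewrite npmulA w02 np1mul.
Qed.

End FominKirillov.

(** * Coefficient extraction and the stable limit *)

Section Hop.
Variables (R : comNzRingType) (g : R).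
Implicit Types (F G : natperm -> R).

(* The coefficient of x ^ k in the product of the 1 + x u_j, j in js. *)
Fixpoint hop (js : seq nat) (k : nat) F : natperm -> R :=
  match js with
  | [::] => if k is 0%N then F else fun=> 0
  | j :: js' => fun w =>
      hop js' k F w + (if k is k'.+1 then uop g j (hop js' k' F) w else 0)
  end.

Lemma hopD js k F G : hop js k (fun w => F w + G w) = fun w => hop js k F w + hop js k G w.
Proof.
elim: js k => [|j js IH] [|k] //=; apply/funext => w; rewrite ?IH ?uopD; ring.
Qed.

Lemma hopZ js k c F : hop js k (fun w => c * F w) = fun w => c * hop js k F w.
Proof.
elim: js k => [|j js IH] [|k] //=; apply/funext => w; rewrite ?IH ?uopZ; ring.
Qed.

Lemma hop0f js k : hop js k (fun=> 0) = fun=> 0.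
Proof.
have -> : (fun=> 0) = (fun w : natperm => 0 * (fun=> 0) w) :> (natperm -> R).
  by apply/funext => w; rewrite mul0r.
by rewrite hopZ; apply/funext => w; rewrite !mul0r.
Qed.

Lemma hop0 js F : hop js 0 F = F.
Proof. by elim: js => //= j js ->; apply/funext => w; rewrite addr0. Qed.

Lemma hop_big js k F : (size js < k)%N -> hop js k F = fun=> 0.
Proof.
elim: js k => [|j js IH] [|k] //= sk; apply/funext => w; rewrite !IH //; last exact: ltnW.
have -> : (fun=> 0) = (fun w : natperm => 0 * (fun=> 0) w) :> (natperm -> R).
  by apply/funext => v; rewrite mul0r.
by rewrite uopZ !mul0r addr0.
Qed.

(** The coefficient of \prod_i x_i ^ (e i) in the product of m factors A(x_i), applied to the
    unit. *)
Fixpoint hprod js (e : nat -> nat) (m : nat) : natperm -> R :=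
  if m is m'.+1 then hop js (e m') (hprod js e m') else T1 R.

Lemma eq_hprod js e e' m : (forall i, (i < m)%N -> e i = e' i) -> hprod js e m = hprod js e' m.
Proof.
elim: m => //= m IH ee; rewrite ee // IH // => i im; apply: ee; exact: ltnW.
Qed.

End Hop.

Definition mdrop (i : nat) (mu : monomial) : monomial := (mu `\` msetn (mu i) i)%mset.

Lemma mdropE i mu j : mdrop i mu j = if j == i then 0%N else mu j.
Proof.
rewrite /mdrop msetE2 msetnE; case: eqP => [->|_]; first by rewrite subnn.
by rewrite subn0.
Qed.

Section Slice.
Variables (R : comNzRingType) (gamma : R).
Local Notation "''x_' i" := (var R i) (at level 8, i at level 2).
Local Notation K := (pseries R).
Local Notation g := (gamma%:A : K).
Implicit Types (F : natperm -> K) (w : natperm).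

Definition slice F (mu : monomial) : natperm -> R := fun w => F w mu.

Lemma slice_uop j F mu : slice (uop g j F) mu = uop gamma j (slice F mu).
Proof.
apply/funext => w; rewrite /slice /uop; case: ifP => // _.
by rewrite ps_coefD mulr_algl ps_coefZ.
Qed.

Lemma slice_top i j F mu : slice (top g 'x_i j F) mu = fun w =>
  slice F mu w + (if i \in mu then uop gamma j (slice F (mu `\ i)%mset) w else 0).
Proof.
by apply/funext => w; rewrite /slice /top ps_coefD ps_coefXM -slice_uop.
Qed.

Lemma slice_AopN i js F mu : i \notin mu -> slice (Aop g js 'x_i F) mu = slice F mu.
Proof.
move=> /negPf imu; elim: js => //= j js IH; rewrite slice_top imu IH.
by apply/funext => w; rewrite addr0.
Qed.

Lemma slice_Aop i js F mu : (forall nu, i \in nu -> slice F nu = fun=> 0) ->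
  slice (Aop g js 'x_i F) mu = hop gamma js (mu i) (slice F (mdrop i mu)).
Proof.
move=> F0; elim: js mu => [|j js IH] mu /=.
  case: (posnP (mu i)) => [mui|mui].
    rewrite mui; congr slice; apply/msetP => k; rewrite mdropE; case: eqP => [->|//].
    by rewrite mui.
  by rewrite F0 -?mset_gt0 // -(prednK mui).
rewrite slice_top; apply/funext => w; rewrite IH; congr (_ + _).
rewrite in_mset; case muk: (mu i) => [//|k] /=; rewrite IH.
have -> : (mu `\ i)%mset i = k by rewrite msetE2 msetnxx muk subn1.
congr (uop _ _ (hop _ _ _ (slice _ _)) _); apply/msetP => l; rewrite !mdropE.
by case: eqP => // neq; rewrite msetE2 msetnE; case: eqP => // _; rewrite subn0.
Qed.

(** What [stage] becomes on permutations 1^m x w: every variable carries the same full product of d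
    = n - 1 factors, whence the symmetry of the limit. *)
Fixpoint fullstage d k : natperm -> K :=
  if k is k'.+1 then Aop g (iota 0 d) 'x_k' (fullstage d k') else T1 K.

Lemma slice_T1 mu : slice (T1 K) mu = if mu == mset0 then T1 R else fun=> 0.
Proof.
apply/funext => w; rewrite /slice /T1; case: asboolP => [ww|ww].
  rewrite ps_coef1; case: eqP => _ //=; case: asboolP => //.
by case: eqP => //= _; case: asboolP.
Qed.

Lemma slice_fullstage d m mu :
  slice (fullstage d m) mu = if below m mu then hprod gamma (iota 0 d) mu m else fun=> 0.
Proof.
elim: m mu => [|m IH] mu /=.
  rewrite slice_T1; case: eqP => [->|neq].
    by case: belowP => // -[] i; rewrite in_mset0.
  case: belowP => // b0; case: neq; apply/msetP => i; rewrite mset0E; apply/mset_eq0P.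
  by apply/negP => /b0.
rewrite slice_Aop => [|nu mnu]; last first.
  by rewrite IH; case: belowP => // /(_ _ mnu); rewrite ltnn.
rewrite IH; have -> : below m (mdrop m mu) = below m.+1 mu.
  apply/below_leP/below_leP => H i mi; have := H i.
    by rewrite mdropE; case: eqP => [?|_ -> //]; [subst; lia | exact: ltnW].
  by rewrite mdropE; case: eqP => // neq; apply; lia.
case: ifP => _; last by rewrite hop0f.
by congr hop; apply: eq_hprod => i im; rewrite mdropE; case: eqP => // ei; subst; lia.
Qed.

(** Compare the coefficients of x_i^a x_j^b in [AopC] for the two distinct variables x_0 and x_1,
    starting from a family of constants. *)
Lemma hopC d k l (F : natperm -> R) :
  hop gamma (iota 0 d) k (hop gamma (iota 0 d) l F)
  = hop gamma (iota 0 d) l (hop gamma (iota 0 d) k F).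
Proof.
pose FK : natperm -> K := fun w => (F w)%:A.
have slice_FK mu : slice FK mu = if mu == mset0 then F else fun=> 0.
  apply/funext => w; rewrite /slice /FK ps_coefZ ps_coef1.
  by case: eqP => _; rewrite ?mulr1 ?mulr0.
pose mu (i j : nat) a b : monomial := (msetn a i `+` msetn b j)%mset.
suff H i j a b : i != j ->
    slice (Aop g (iota 0 d) 'x_j (Aop g (iota 0 d) 'x_i FK)) (mu i j a b) =
    hop gamma (iota 0 d) b (hop gamma (iota 0 d) a F).
  have H1 := @H 0%N 1%N l k isT; rewrite -H1.
  have H2 := @H 1%N 0%N k l isT; rewrite -H2 AopC; congr slice.
  by rewrite /mu msetDC.
move=> ij; have F0 nu k0 : k0 \in nu -> slice FK nu = fun=> 0.
  move=> knu; rewrite slice_FK; case: eqP => // nu0.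
  by move: knu; rewrite nu0 in_mset0.
rewrite slice_Aop => [|nu jnu]; last first.
  rewrite slice_Aop => [|nu' inu']; last exact: F0 inu'.
  rewrite (F0 _ j) ?hop0f // -mset_gt0 mdropE eq_sym (negPf ij).
  by rewrite mset_gt0.
rewrite slice_Aop => [|nu inu]; last exact: F0 inu.
rewrite slice_FK mdropE (negPf ij) !msetE2 !msetnE !eqxx (negPf ij) eq_sym (negPf ij) addn0 add0n.
case: eqP => // -[]; apply/msetP => k0; rewrite !mdropE !msetE2 !msetnE mset0E.
by repeat case: eqP => //.
Qed.

End Slice.

Section Shift.
Variables (m n : nat).

Definition shf (w : nat -> nat) (k : nat) : nat := if (k < m)%N then k else (m + w (k - m))%N.

Lemma shfK (v w : nat -> nat) : cancel v w -> cancel (shf v) (shf w).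
Proof.
move=> vK k; rewrite /shf; case: (ltnP k m) => [->//|mk].
by rewrite ltnNge leq_addr /= addKn vK subnKC.
Qed.

Definition npsh (w : natperm) : natperm := NatPerm (shfK (@pfwdK w)) (shfK (@pbackK w)).

Lemma npof_shift (w : 'S_n) : npof (shift_perm m w) = npsh (npof w).
Proof.
apply: natpermP => k /=; rewrite /shf.
case: (ltnP k (m + n)) => [kmn|mnk]; last first.
  by rewrite ext_out // ltnNge (leq_trans (leq_addr _ _) mnk) /= ext_out; lia.
rewrite (extE _ (Ordinal kmn)) permE /shift_fun; case: splitP => j /= kj.
  by rewrite kj ltn_ord.
by rewrite kj ltnNge leq_addr /= addKn extE.
Qed.

Section Restrict.
Variables (K : comNzRingType) (g : K).
Implicit Types (F : natperm -> K) (w : natperm).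

Definition restr F : natperm -> K := fun w => F (npsh w).

Lemma restr_uop j F :
  restr (uop g j F) = if (j < m)%N then fun=> 0 else uop g (j - m) (restr F).
Proof.
apply/funext => w; rewrite /restr /uop /= /shf; case: (ltnP j m) => jm.
  by case: ifP => // H; exfalso; move: H; repeat case: ifP => ?; lia.
have jm1 : (j.+1 < m)%N = false by lia.
rewrite jm1 subSn // ltn_add2l; case: ifP => // _.
congr (F _ + _); apply: natpermP => k; rewrite /= /shf.
case: (ltnP k m) => km; first by rewrite swap_id_lt ?km //; lia.
have [e ek] : (swap j k - m = swap (j - m) (k - m))%N /\ (swap j k < m)%N = false.
  by rewrite /swap; repeat (case: eqP => ? //=); lia.
by rewrite ek e.
Qed.

Lemma restr_top x j F :
  restr (top g x j F) = if (j < m)%N then restr F else top g x (j - m) (restr F).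
Proof.
have -> : restr (top g x j F) = fun w => restr F w + x * restr (uop g j F) w by [].
rewrite restr_uop; case: ifP => // _; apply/funext => w; rewrite mulr0 addr0 //.
Qed.

(** Since 1^m x w ascends at every j < m, the generators u_j with j < m contribute nothing; the
    other n - 1 act on w as u_(j-m). *)
Lemma restr_Aop k x F : (0 < n)%N -> (k < m)%N ->
  restr (Aop g (iota k (m + n - k.+1)) x F) = Aop g (iota 0 n.-1) x (restr F).
Proof.
move=> n0 km; have -> : (m + n - k.+1 = (m - k) + n.-1)%N by lia.
rewrite iotaD subnKC ?(ltnW km) // /Aop foldr_cat -/(Aop _ _ _ _) -/(Aop _ _ _ _).
have -> : forall G js, all (fun j => j < m)%N js -> restr (Aop g js x G) = restr G.
  by move=> G; elim=> //= j js IH /andP[jm /IH]; rewrite restr_top jm.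
  have -> : iota m n.-1 = [seq (m + i)%N | i <- iota 0 n.-1] by rewrite -iotaDl addn0.
  elim: (iota 0 n.-1) => //= j js IH.
  by rewrite restr_top ltnNge leq_addr /= addKn IH.
by apply/allP => j; rewrite mem_iota; lia.
Qed.

Lemma restr_T1 : restr (T1 K) = T1 K.
Proof.
apply/funext => w; rewrite /restr /T1; congr (if _ then _ else _).
apply/asboolP/asboolP => [H|->]; apply: natpermP => k /=; last first.
  by rewrite /shf; case: ltnP => // /subnKC.
have := congr1 (fun v : natperm => v (m + k)%N) H.
by rewrite /= /shf ltnNge leq_addr /= addKn => /addnI.
Qed.

End Restrict.

Lemma restr_stage (R : comNzRingType) (gamma : R) k : (0 < n)%N -> (k <= m)%N ->
  restr (stage gamma (m + n) k) = fullstage gamma n.-1 k.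
Proof.
move=> n0; elim: k => [_|k IH km] /=; first exact: restr_T1.
by rewrite restr_Aop // IH // ltnW.
Qed.

End Shift.

Section Stable.
Variables (R : comNzRingType) (gamma : R) (n : nat).
Hypothesis n_gt0 : (0 < n)%N.

Lemma hprod_below (mu : monomial) m m' : (m <= m')%N -> below m mu ->
  hprod gamma (iota 0 n.-1) mu m' = hprod gamma (iota 0 n.-1) mu m.
Proof.
move=> + /below_leP bmu; elim: m' => [|m' IH]; first by rewrite leqn0 => /eqP ->.
rewrite leq_eqVlt => /orP[/eqP -> //|]; rewrite ltnS => mm' /=.
by rewrite bmu // hop0 IH.
Qed.

(** The first M factors of [stage] restrict to [fullstage]. Later factors involve variables absent
    from mu and contribute only their constant term 1. *)
Theorem stable_grothendieckE (w : 'S_n) (mu : monomial) m : below m mu ->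
  stable_grothendieck gamma w mu = hprod gamma (iota 0 n.-1) mu m (npof w).
Proof.
move=> bmu; apply: (@ps_lim_eq _ _ _ _ m) => M mM.
rewrite grothendieckE npof_shift -(hprod_below mM bmu).
have bMmu := below_le mM bmu.
have := slice_fullstage gamma n.-1 M mu; rewrite bMmu => <-.
rewrite -(restr_stage gamma n_gt0 (leqnn M)) -/(slice _ _ _).
suff H k : (M <= k)%N -> slice (stage gamma (M + n) k) mu = slice (stage gamma (M + n) M) mu.
  by rewrite -[LHS]/(slice (stage gamma (M + n) (M + n)) mu (npsh M (npof w))) H ?leq_addr.
elim: k => [|k IH]; first by rewrite leqn0 => /eqP ->.
rewrite leq_eqVlt => /orP[/eqP <- //|]; rewrite ltnS => Mk.
rewrite [stage _ _ k.+1]/= slice_AopN ?IH //.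
by rewrite -mset_eq0 (below_leP _ _ bMmu).
Qed.

End Stable.

(** * The commutative ring of the h_k *)

Section MapSeries.
Variables (A B : comNzRingType).

Definition map_ps (f : A -> B) (F : pseries A) : pseries B := PSeries (fun mu => f (F mu)).

Lemma map_psE f F mu : map_ps f F mu = f (F mu). Proof. by []. Qed.

Section Additive.
Variable f : {additive A -> B}.
Fact map_ps_is_zmod : zmod_morphism (map_ps f).
Proof. by move=> F G; apply/pseriesP => mu; rewrite map_psE raddfB. Qed.
HB.instance Definition _ := GRing.isZmodMorphism.Build _ _ (map_ps f) map_ps_is_zmod.

Lemma map_ps_sum I (r : seq I) (P : pred I) (F : I -> pseries A) :
  map_ps f (\sum_(i <- r | P i) F i) = \sum_(i <- r | P i) map_ps f (F i).
Proof. exact: raddf_sum. Qed.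

Lemma trunc_map_ps m F : trunc m (map_ps f F) = map_ps f (trunc m F).
Proof. by apply/pseriesP => mu /=; case: ifP; rewrite ?raddf0. Qed.
End Additive.

Section Morphism.
Variable f : {rmorphism A -> B}.
Fact map_ps_is_monoid : monoid_morphism (map_ps f).
Proof.
split=> [|F G]; apply/pseriesP => mu; rewrite map_psE ?ps_coef1 ?rmorph_nat //.
by rewrite !ps_coefM rmorph_sum; apply: eq_bigr => nu _; rewrite rmorphM.
Qed.
HB.instance Definition _ := GRing.isMonoidMorphism.Build _ _ (map_ps f) map_ps_is_monoid.

Lemma map_psD F G : map_ps f (F + G) = map_ps f F + map_ps f G.
Proof. exact: rmorphD. Qed.
Lemma map_psB F G : map_ps f (F - G) = map_ps f F - map_ps f G.
Proof. exact: rmorphB. Qed.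
Lemma map_psN F : map_ps f (- F) = - map_ps f F.
Proof. exact: rmorphN. Qed.
Lemma map_psM F G : map_ps f (F * G) = map_ps f F * map_ps f G.
Proof. exact: rmorphM. Qed.
Lemma map_psX F k : map_ps f (F ^+ k) = map_ps f F ^+ k.
Proof. exact: rmorphXn. Qed.
Lemma map_ps1 : map_ps f 1 = 1.
Proof. exact: rmorph1. Qed.
Lemma map_ps_prod I (r : seq I) (P : pred I) (F : I -> pseries A) :
  map_ps f (\prod_(i <- r | P i) F i) = \prod_(i <- r | P i) map_ps f (F i).
Proof. exact: rmorph_prod. Qed.

Lemma map_psZ c F : map_ps f (c *: F) = f c *: map_ps f F.
Proof. by apply/pseriesP => mu; rewrite /= rmorphM. Qed.

Lemma map_ps_det k (M : 'I_k -> 'I_k -> pseries A) :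
  map_ps f (\det (\matrix_(i, j) M i j)) = \det (\matrix_(i, j) map_ps f (M i j)).
Proof.
transitivity (\det (map_mx (map_ps f) (\matrix_(i, j) M i j))).
  by rewrite det_map_mx.
by congr (\det _); apply/matrixP => i j; rewrite !mxE.
Qed.

Lemma map_ps_var i : map_ps f (var A i) = var B i.
Proof. by rewrite -!varE; apply/pseriesP => mu; rewrite /= rmorph_nat. Qed.

Lemma map_ps_geom a i : map_ps f (geom a i) = geom (f a) i.
Proof.
rewrite /geom !unlock; apply/pseriesP => mu /=.
by case: ifP; rewrite ?rmorphXn ?rmorph0.
Qed.

Lemma map_ps_vandermonde m : map_ps f (vandermonde A m) = vandermonde B m.
Proof.
rewrite !vandermonde_var map_ps_prod; apply: eq_bigr => i _.
by rewrite map_ps_prod; apply: eq_bigr => j _; rewrite map_psB !map_ps_var.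
Qed.

Lemma map_ps_Gnum a b m la : map_ps f (Gnum a b m la) = Gnum (f a) (f b) m la.
Proof.
rewrite /Gnum map_ps_det; congr (\det _); apply/matrixP => i j; rewrite !mxE.
by rewrite !map_psM !map_psX map_psD map_ps1 map_psZ map_ps_var map_ps_geom.
Qed.

End Morphism.
End MapSeries.

(** Used for f = [scal] and phi = [entry w]: [entry] is not multiplicative, but scalar series such
    as the Vandermonde product pass through it. *)
Lemma map_ps_linear (A B : comNzRingType) (f : {rmorphism A -> B}) (phi : {additive B -> A}) (F : pseries A) (G : pseries B) :
  (forall a c, phi (f a * c) = a * phi c) ->
  map_ps phi (map_ps f F * G) = F * map_ps phi G.
Proof.
move=> phiZ; apply/pseriesP => mu; rewrite map_psE !ps_coefM raddf_sum.
by apply: eq_bigr => nu _; rewrite /= phiZ.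
Qed.

Lemma series_quo (A : comNzRingType) (h c : nat -> A) : h 0%N = 1 ->
  exists b : nat -> A, forall k, \sum_(j < k.+1) b j * h (k - j)%N = c k.
Proof.
move=> h0.
pose nxt (s : seq A) := c (size s) - \sum_(j < size s) s`_j * h (size s - j)%N.
pose bs := fix bs n := if n is n'.+1 then rcons (bs n') (nxt (bs n')) else [::].
have sz n : size (bs n) = n by elim: n => //= n IH; rewrite size_rcons IH.
have st n k : (k < n)%N -> (bs n)`_k = (bs k.+1)`_k.
  elim: n => // n IH; rewrite ltnS leq_eqVlt => /orP[/eqP -> //|kn].
  by rewrite -IH //= nth_rcons sz kn.
pose b k := (bs k.+1)`_k.
have bE k : b k = c k - \sum_(j < k) b j * h (k - j)%N.
  rewrite {1}/b [bs _]/= nth_rcons sz ltnn eqxx /nxt sz; congr (_ - _).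
  by apply: eq_bigr => j _; rewrite (st k).
by exists b => k; rewrite big_ord_recr /= subnn h0 mulr1 -/(b k) (bE k) addrC subrK.
Qed.

Definition operator (R : comNzRingType) := (natperm -> R) -> natperm -> R.

Definition op_linear (R : comNzRingType) (f : operator R) :=
  (forall F G, f (fun w => F w + G w) = fun w => f F w + f G w) /\
  (forall c F, f (fun w => c * F w) = fun w => c * f F w).

(* The bicommutant of the operators hop g (iota 0 d) k, k : nat.              *)
Definition in_bicommutant (R : comNzRingType) (g : R) (d : nat) (f : operator R) :=
  op_linear f /\
  forall h, op_linear h ->
    (forall k F, h (hop g (iota 0 d) k F) = hop g (iota 0 d) k (h F)) ->
    forall F, f (h F) = h (f F).

(** Determinants need a commutative ring. The bicommutant of a commuting family is one, without any
    presentation by generators and relations, and it is large enough to contain the coefficients of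
    the reversed product. *)
Record bicom (R : comNzRingType) (g : R) (d : nat) :=
  Bicom { bicom_op :> (natperm -> R) -> natperm -> R; bicomP : in_bicommutant g d bicom_op }.

HB.instance Definition _ R g d := gen_eqMixin (@bicom R g d).
HB.instance Definition _ R g d := gen_choiceMixin (@bicom R g d).

Section Bicommutant.
Variables (R : comNzRingType) (g : R) (d : nat).
Local Notation C := (@bicom R g d).
Local Notation H := (hop g (iota 0 d)).
Implicit Types (a b c : C) (F : natperm -> R) (w : natperm).

Lemma bicom_eq a b : (forall F w, a F w = b F w) -> a = b.
Proof.
case: a b => [a aP] [b bP] /= ab.
have e : a = b by apply/funext => F; apply/funext => w; exact: ab.
by subst b; congr Bicom; exact: Prop_irrelevance.
Qed.

Lemma bicom_lin a : op_linear a. Proof. by case: (bicomP a). Qed.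
Lemma bicomD a F G : a (fun w => F w + G w) = fun w => a F w + a G w.
Proof. by case: (bicom_lin a). Qed.
Lemma bicomZ a (x : R) F : a (fun w => x * F w) = fun w => x * a F w.
Proof. by case: (bicom_lin a). Qed.

Lemma bicom_H a k F : a (H k F) = H k (a F).
Proof.
case: (bicomP a) => _; apply=> [|l G]; last by rewrite hopC.
by split=> *; [exact: hopD | exact: hopZ].
Qed.

Fact zero_in : in_bicommutant g d (fun _ _ => 0).
Proof.
split=> [|h [_ hZ] _ F]; first by split=> *; apply/funext => w; rewrite ?addr0 ?mulr0.
have -> : (fun=> 0) = (fun w : natperm => 0 * (fun=> 0) w) :> (natperm -> R).
  by apply/funext => w; rewrite mul0r.
by rewrite hZ; apply/funext => w; rewrite !mul0r.
Qed.
Definition bc_zero : C := Bicom zero_in.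

Fact opp_in a : in_bicommutant g d (fun F w => - a F w).
Proof.
split=> [|h hl hH F]; first split=> *; rewrite ?bicomD ?bicomZ; try by apply/funext => w; ring.
case: (bicomP a) => _ /(_ h hl hH F) ->; case: hl => _ hZ.
have -> : (fun w => - a F w) = (fun w => -1 * a F w) by apply/funext => w; ring.
by rewrite hZ; apply/funext => w; ring.
Qed.
Definition bc_opp a : C := Bicom (opp_in a).

Fact add_in a b : in_bicommutant g d (fun F w => a F w + b F w).
Proof.
split=> [|h hl hH F]; first by split=> *; rewrite ?bicomD ?bicomZ; apply/funext => w; ring.
case: (bicomP a) => _ /(_ h hl hH F) ->; case: (bicomP b) => _ /(_ h hl hH F) ->.
by case: hl => hD _; rewrite hD.
Qed.
Definition bc_add a b : C := Bicom (add_in a b).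

Fact one_in : in_bicommutant g d id.
Proof. by []. Qed.
Definition bc_one : C := Bicom one_in.

Fact mul_in a b : in_bicommutant g d (fun F => a (b F)).
Proof.
split=> [|h hl hH F]; first by split=> *; rewrite ?bicomD ?bicomZ.
by case: (bicomP b) => _ /(_ h hl hH F) ->; case: (bicomP a) => _ /(_ h hl hH (b F)) ->.
Qed.
Definition bc_mul a b : C := Bicom (mul_in a b).

Fact bc_addA : associative bc_add.
Proof. by move=> a b c; apply: bicom_eq => F w /=; rewrite addrA. Qed.
Fact bc_addC : commutative bc_add.
Proof. by move=> a b; apply: bicom_eq => F w /=; rewrite addrC. Qed.
Fact bc_add0 : left_id bc_zero bc_add.
Proof. by move=> a; apply: bicom_eq => F w /=; rewrite add0r. Qed.
Fact bc_addN : left_inverse bc_zero bc_opp bc_add.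
Proof. by move=> a; apply: bicom_eq => F w /=; rewrite addNr. Qed.
HB.instance Definition _ := GRing.isZmodule.Build C bc_addA bc_addC bc_add0 bc_addN.

Fact bc_mulA : associative bc_mul.
Proof. by move=> a b c; exact: bicom_eq. Qed.
(** By [bicom_H], b itself commutes with all [hop g (iota 0 d) k], so it is among the operators with
    which a must commute. *)
Fact bc_mulC : commutative bc_mul.
Proof.
move=> a b; apply: bicom_eq => F w /=.
case: (bicomP a) => _ /(_ b (bicom_lin b)) -> // k G; exact: bicom_H.
Qed.
Fact bc_mul1 : left_id bc_one bc_mul.
Proof. by move=> a; exact: bicom_eq. Qed.
Fact bc_mulDl : left_distributive bc_mul bc_add.
Proof. by move=> a b c; exact: bicom_eq. Qed.
Fact bc_one_neq0 : bc_one != bc_zero.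
Proof.
apply/eqP => /(congr1 (fun c : C => c (fun=> 1) np1)) /= /eqP.
by rewrite oner_eq0.
Qed.
HB.instance Definition _ := GRing.Zmodule_isComNzRing.Build C
  bc_mulA bc_mulC bc_mul1 bc_mulDl bc_one_neq0.

Lemma bc0E F w : (0 : C) F w = 0. Proof. by []. Qed.
Lemma bc1E F : (1 : C) F = F. Proof. by []. Qed.
Lemma bcDE a b F w : (a + b) F w = a F w + b F w. Proof. by []. Qed.
Lemma bcNE a F w : (- a) F w = - a F w. Proof. by []. Qed.
Lemma bcME a b F : (a * b) F = a (b F). Proof. by []. Qed.
Lemma bc_sumE I (r : seq I) (P : pred I) (f : I -> C) F w :
  (\sum_(i <- r | P i) f i) F w = \sum_(i <- r | P i) f i F w.
Proof. by elim/big_rec2: _ => //= i a b _ <-. Qed.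

Fact scal_in (x : R) : in_bicommutant g d (fun F w => x * F w).
Proof.
split=> [|h [_ hZ] _ F]; first by split=> *; apply/funext => w; ring.
by rewrite hZ.
Qed.
Definition scal (x : R) : C := Bicom (scal_in x).
Lemma scalE x F w : scal x F w = x * F w. Proof. by []. Qed.

Fact scal_is_zmod : zmod_morphism scal.
Proof. by move=> x y; apply: bicom_eq => F w; rewrite scalE bcDE bcNE !scalE mulrBl. Qed.
Fact scal_is_monoid : monoid_morphism scal.
Proof.
split=> [|x y]; apply: bicom_eq => F w; rewrite scalE ?mul1r //.
by rewrite bcME !scalE mulrA.
Qed.
HB.instance Definition _ := GRing.isZmodMorphism.Build _ _ scal scal_is_zmod.
HB.instance Definition _ := GRing.isMonoidMorphism.Build _ _ scal scal_is_monoid.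

(** The coefficient at w of an operator applied to the unit. *)
Definition entry w (c : C) : R := c (T1 R) w.
Fact entry_is_zmod w : zmod_morphism (entry w).
Proof. by move=> a b; rewrite /entry bcDE bcNE. Qed.
HB.instance Definition _ w := GRing.isZmodMorphism.Build _ _ (entry w) (entry_is_zmod w).

Lemma entry0 w : entry w 0 = 0. Proof. by []. Qed.

Lemma entry_scal w x c : entry w (scal x * c) = x * entry w c.
Proof. by rewrite /entry bcME scalE. Qed.

Fact hC_in k : in_bicommutant g d (H k).
Proof.
split=> [|h _ hH F]; last by rewrite hH.
by split=> *; [exact: hopD | exact: hopZ].
Qed.
Definition hC k : C := Bicom (hC_in k).

Lemma hCE k F : hC k F = H k F. Proof. by []. Qed.

Lemma hC0 : hC 0 = 1.
Proof. by apply: bicom_eq => F w; rewrite hCE hop0. Qed.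

Lemma hC_big k : (d < k)%N -> hC k = 0.
Proof. by move=> dk; apply: bicom_eq => F w; rewrite hCE hop_big ?size_iota. Qed.

Lemma entry_prod w (e : nat -> nat) m :
  entry w (\prod_(i < m) hC (e i)) = hprod g (iota 0 d) e m w.
Proof.
rewrite /entry; have -> : (\prod_(i < m) hC (e i)) (T1 R) = hprod g (iota 0 d) e m; last by [].
elim: m => [|m IH]; first by rewrite big_ord0.
have -> : \prod_(i < m.+1) hC (e i) = hC (e m) * \prod_(i < m) hC (e i).
  exact: etrans (big_ord_recr _ _) (mulrC _ _).
by rewrite bcME IH.
Qed.

(* If b is a right quotient, in operators, of two series over the commutative *)
(* ring, then its coefficients belong to that ring.                           *)
Lemma bicommutant_quo (f : nat -> operator R) (h c : nat -> C) : h 0%N = 1 ->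
  (forall k F w, \sum_(j < k.+1) f j (h (k - j)%N F) w = c k F w) ->
  exists b : nat -> C, forall k F w, b k F w = f k F w.
Proof.
move=> h0 fc; have [b bc] := series_quo c h0.
exists b => k; have [n] := ubnP k; elim: n k => // n IH k kn F w.
have := fc k F w; rewrite -bc bc_sumE !big_ord_recr /= !subnn h0 !bc1E.
rewrite (eq_bigr (fun j : 'I_k => (b j * h (k - j)%N) F w)) => [/addrI -> //|j _].
by rewrite [RHS](IH j) //; have := ltn_ord j; lia.
Qed.

End Bicommutant.

Lemma op_linear_sum (K : comNzRingType) (f : operator K) (n : nat) (c : nat -> K)
    (G : nat -> natperm -> K) : op_linear f ->
  f (fun w => \sum_(m < n) c m * G m w) = fun w => \sum_(m < n) c m * f (G m) w.
Proof.
case=> fD fZ; elim: n => [|n IH].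
  have -> : (fun w => \sum_(m < 0) c m * G m w) = (fun w => 0 * (fun=> 0) w).
    by apply/funext => v; rewrite big_ord0 mul0r.
  by rewrite fZ; apply/funext => v; rewrite big_ord0 mul0r.
have -> : (fun w => \sum_(m < n.+1) c m * G m w) =
    fun w => \sum_(m < n) c m * G m w + c n * G n w.
  by apply/funext => v; rewrite big_ord_recr.
by rewrite fD fZ IH; apply/funext => v; rewrite big_ord_recr.
Qed.

Lemma hop_linear (K : comNzRingType) (g : K) js k : op_linear (hop g js k).
Proof. by split=> *; [exact: hopD | exact: hopZ]. Qed.

Lemma uop_linear (K : comNzRingType) (g : K) j : op_linear (uop g j).
Proof. by split=> *; [exact: uopD | exact: uopZ]. Qed.

(** * The inverse of the product and the reversed product *)

Section Inverse.
Variables (K : comNzRingType) (g y z : K).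
Hypothesis yz : y - z - g * y * z = 0.
Implicit Types (F : natperm -> K).

(** As u^2 = g u, the product (1 - z u)(1 + y u) equals 1 + (y - z - g y z) u. *)
Lemma top_cancel j F : top g (- z) j (top g y j F) = F.
Proof.
apply/funext => w; rewrite /top uopD uopZ uopK.
rewrite -[RHS]addr0 -[X in _ = _ + X](mul0r (uop g j F w)) -yz; ring.
Qed.

Lemma Aop_cancel js F : Aop g (rev js) (- z) (Aop g js y F) = F.
Proof.
elim: js => [//|j js IH]; rewrite rev_cons Aop_cons /Aop foldr_rcons top_cancel.
exact: IH.
Qed.

Lemma Aop_sum js (x : K) F w :
  Aop g js x F w = \sum_(l < (size js).+1) x ^+ l * hop g js l F w.
Proof.
elim: js w => [|j js IH] w; first by rewrite big_ord1 mul1r.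
rewrite Aop_cons /top; have -> : Aop g js x F = fun w =>
    \sum_(l < (size js).+1) x ^+ l * hop g js l F w by apply/funext => v; exact: IH.
rewrite (op_linear_sum _ (fun l => x ^+ l) (fun l => hop g js l F) (uop_linear g j)).
rewrite mulr_sumr /=.
under [RHS]eq_bigr => l _ do rewrite mulrDr.
rewrite big_split /=; congr (_ + _).
  by rewrite [RHS]big_ord_recr /= hop_big // mulr0 addr0.
rewrite [RHS]big_ord_recl /= mulr0 add0r; apply: eq_bigr => l _.
by rewrite /= exprS mulrA.
Qed.

End Inverse.

Lemma hop_const (R : comNzRingType) (g : R) js l (F : natperm -> R) :
  hop (g%:A : pseries R) js l (fun w => (F w)%:A) = fun w => (hop g js l F w)%:A.
Proof.
have uopA (G : natperm -> R) j :
    uop (g%:A : pseries R) j (fun w => (G w)%:A) = fun w => (uop g j G w)%:A.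
  apply/funext => w; rewrite /uop; case: ifP => _; last by rewrite scale0r.
  by rewrite scalerDl mulr_algl scalerA.
have hopS (L : comNzRingType) (x : L) (G : natperm -> L) j js' l' :
    hop x (j :: js') l'.+1 G = fun w => hop x js' l'.+1 G w + uop x j (hop x js' l' G) w.
  by [].
elim: js l => [|j js IH] [|l]; rewrite ?hop0 //; apply/funext => w.
  by rewrite scale0r.
by rewrite !hopS !IH uopA scalerDl.
Qed.

Section Univariate.
Variable A : comNzRingType.
Implicit Types S T : pseries A.

Lemma msetn_sub (i k : nat) (mu : monomial) :
  (mu `<=` msetn k i)%mset = (mu == msetn (mu i) i) && (mu i <= k)%N.
Proof.
apply/msubsetP/andP => [H|[/eqP mui lek] j].
  split; last by have := H i; rewrite msetnxx.
  apply/eqP/msetP => j; rewrite msetnE; case: eqP => [-> //|/eqP/negPf ji].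
  by have := H j; rewrite msetnE ji leqn0 => /eqP.
by rewrite mui !msetnE; case: eqP.
Qed.

Lemma ps_coefM_msetn S T i k :
  (S * T) (msetn k i) = \sum_(j < k.+1) S (msetn j i) * T (msetn (k - j)%N i).
Proof.
rewrite ps_coefM (perm_big [seq msetn (j : 'I_k.+1) i | j <- index_enum 'I_k.+1]).
  rewrite big_map; apply: eq_bigr => j _; congr (_ * T _); apply/msetP => l.
  by rewrite msetE2 !msetnE; case: eqP.
apply: uniq_perm; first exact: fset_uniq.
  rewrite map_inj_uniq ?index_enum_uniq // => j j' /(congr1 (fun mu : monomial => mu i)).
  by rewrite !msetnxx => /val_inj.
move=> mu; rewrite in_msubs msetn_sub; apply/andP/mapP => [[/eqP mui lek]|[j _ ->]].
  by exists (Ordinal (n := k.+1) lek); rewrite ?mem_index_enum.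
by rewrite msetnxx eqxx; split=> //; rewrite -ltnS ltn_ord.
Qed.

Lemma ps_coefM0 S T : (S * T) mset0 = S mset0 * T mset0.
Proof. by rewrite -(msetn0 0%N) ps_coefM_msetn big_ord1 subn0. Qed.

Lemma ps_coefX0 S l : (S ^+ l) mset0 = S mset0 ^+ l.
Proof.
elim: l => [|l IH]; first by rewrite !expr0 ps_coef1 eqxx.
by rewrite !exprS ps_coefM0 IH.
Qed.

Lemma var_coef0 i : var A i mset0 = 0.
Proof.
rewrite -varE /=; case: eqP => // /msetP /(_ i).
by rewrite mset0E msetnxx.
Qed.

Lemma varX_coef i l k : (var A i ^+ l) (msetn k i) = (k == l)%:R.
Proof.
elim: l k => [|l IH] k.
  rewrite expr0 ps_coef1; congr (nat_of_bool _)%:R; apply/eqP/eqP => [|->].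
    by move/msetP/(_ i); rewrite msetnxx mset0E.
  exact: msetn0.
rewrite exprS ps_coefXM; case: k => [|k]; first by rewrite in_msetn.
rewrite in_msetn eqxx /=; have -> : (msetn k.+1 i `\ i)%mset = msetn k i; last exact: IH.
by apply/msetP => j; rewrite msetE2 !msetnE; case: eqP => // _; rewrite subn1.
Qed.

Lemma varNX_coef i l k : ((- var A i) ^+ l) (msetn k i) = (-1) ^+ l * (k == l)%:R.
Proof. by rewrite -scaleN1r exprZn ps_coefZ varX_coef. Qed.

End Univariate.

Section Key.
Variables (R : comNzRingType) (g : R) (d : nat).
Local Notation js := (iota 0 d).
Local Notation K := (pseries R).
Implicit Types (F : natperm -> R) (y z : K).

(** [Aop_cancel] with both products expanded in powers of -z and y, applied to a family of
    constants. *)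
Lemma key_operator y z F w : y - z - g%:A * y * z = 0 ->
  \sum_(l < d.+1) \sum_(m < d.+1)
    hop g (rev js) l (hop g js m F) w *: ((- z) ^+ l * y ^+ m) = (F w)%:A.
Proof.
move=> yz; have := congr1 (fun G => G w) (Aop_cancel yz js (fun w => (F w)%:A)).
rewrite Aop_sum size_rev size_iota => <-; apply: eq_bigr => l _.
have -> : Aop (g%:A : K) js y (fun w => (F w)%:A) = fun w =>
    \sum_(m < d.+1) y ^+ m * (hop g js m F w)%:A.
  apply/funext => v; rewrite Aop_sum size_iota; apply: eq_bigr => m _.
  by rewrite hop_const.
rewrite (op_linear_sum _ (fun m => y ^+ m) (fun m v => (hop g js m F v)%:A) (hop_linear _ _ _)).
rewrite mulr_sumr; apply: eq_bigr => m _.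
by rewrite hop_const mulrA mulr_algr.
Qed.

(** For y = x/(1 - a x) and z = x/(1 + b x) one has 1/z - 1/y = a + b; the proof clears the
    denominators instead of inverting x. *)
Lemma geom_rel (a b : R) i : a + b = g ->
  let y := var R i * geom a i in let z := var R i * geom (- b) i in
  y - z - g%:A * y * z = 0.
Proof.
move=> abg y z; apply: (@regular_1BX _ a i); apply: (@regular_1BX _ (- b) i).
have ya : (1 - a *: var R i) * y = var R i by rewrite mulrC -mulrA geomK mulr1.
have zb : (1 - (- b) *: var R i) * z = var R i by rewrite mulrC -mulrA geomK mulr1.
transitivity ((1 - (- b) *: var R i) * ((1 - a *: var R i) * y)
  - (1 - a *: var R i) * ((1 - (- b) *: var R i) * z)
  - g%:A * ((1 - a *: var R i) * y) * ((1 - (- b) *: var R i) * z)).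
  by ring.
rewrite ya zb -abg -[a *: _]mulr_algl -[(- b) *: _]mulr_algl scalerDl scaleNr.
by ring.
Qed.

(* The coefficients of the reversed product, inverse of the product at -z, are *)
(* those of a quotient of series over the commutative ring.                    *)
Fact hbC_in k : in_bicommutant g d (hop g (rev js) k).
Proof.
(* The case a = g, b = 0, chosen because z is then the variable itself: its powers separate the
   coefficients of the reversed product. *)
pose y : K := var R 0 * geom g 0; pose z : K := var R 0.
have yz : y - z - g%:A * y * z = 0.
  have := @geom_rel g 0 0%N (addr0 g); rewrite /= -/y oppr0.
  have -> : geom (0 : R) 0 = 1 by have := geomK (0 : R) 0; rewrite scale0r subr0 mulr1.
  by rewrite mulr1.
have y0 : y mset0 = 0 by rewrite ps_coefM0 var_coef0 mul0r.
have zX l j : ((- z) ^+ l) (msetn j 0%N) = (-1) ^+ l * (j == l)%:R by exact: varNX_coef.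
clearbody y z.
pose h (k : nat) : bicom g d := \sum_(m < d.+1) scal g d ((y ^+ m) (msetn k 0)) * hC g d m.
have h0 : h 0%N = 1.
  rewrite /h big_ord_recl big1 => [|m _]; last first.
    by rewrite msetn0 ps_coefX0 y0 expr0n /= rmorph0 mul0r.
  by rewrite addr0 expr0 msetn0 ps_coef1 eqxx rmorph1 hC0 mul1r.
have [|b bE] := @bicommutant_quo _ g d
    (fun k F w => (-1) ^+ k * hop g (rev js) k F w) h (fun k => (k == 0%N)%:R) h0.
  move=> n F w; have /pseriesP/(_ (msetn n 0%N)) key := key_operator F w yz.
  rewrite ps_coef_sum in key.
  transitivity (F w * (n == 0%N)%:R); last first.
    by case: (n == 0%N); rewrite ?mulr1 ?mulr0.
  transitivity (((F w)%:A : K) (msetn n 0%N)); last first.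
    rewrite ps_coefZ ps_coef1; congr (_ * (nat_of_bool _)%:R).
    by apply/eqP/eqP => [/msetP/(_ 0%N)|->]; rewrite ?msetnxx ?mset0E ?msetn0.
  rewrite -key.
  transitivity (\sum_(j < n.+1) \sum_(l < d.+1) (j == l :> nat)%:R * ((-1) ^+ j * (\sum_(m < d.+1)
      (y ^+ m) (msetn (n - j)%N 0) * hop g (rev js) l (hop g js m F) w))).
    apply: eq_bigr => j _.
    have -> : (h (n - j)%N : operator R) F = fun v =>
        \sum_(m < d.+1) (y ^+ m) (msetn (n - j)%N 0) * hop g js m F v.
      by apply/funext => v; rewrite /h bc_sumE.
    rewrite (op_linear_sum _ (fun m => (y ^+ m) (msetn (n - j)%N 0)) (fun m => hop g js m F) (hop_linear _ _ _)).
    case: (ltnP j d.+1) => [jd|dj].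
      rewrite [RHS](bigD1 (Ordinal jd)) //= eqxx mul1r [X in _ + X]big1 ?addr0 // => l.
      by rewrite -val_eqE /= eq_sym => /negPf ->; rewrite mul0r.
    rewrite [RHS]big1 => [|l _]; last first.
      have -> : (j == l :> nat) = false by have := ltn_ord l; lia.
      by rewrite mul0r.
    rewrite big1 ?mulr0 // => m _.
    by rewrite hop_big ?mulr0 // size_rev size_iota.
  rewrite exchange_big; apply: eq_bigr => l _ /=.
  rewrite ps_coef_sum.
  under eq_bigr => j _ do rewrite mulrA mulr_sumr.
  rewrite exchange_big; apply: eq_bigr => m _.
  rewrite ps_coefZ ps_coefM_msetn mulr_sumr; apply: eq_bigr => j _.
  rewrite zX.
  by case: eqP => [->|_]; rewrite ?mul0r ?mulr0 ?mul0r ?mulr0 //; ring.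
have -> : hop g (rev js) k = scal g d ((-1) ^+ k) * b k :> operator R.
  apply/funext => F; apply/funext => w.
  by rewrite bcME scalE bE mulrA -exprMn mulrNN mulr1 expr1n mul1r.
exact: bicomP.
Qed.

Definition hbC k : bicom g d := Bicom (hbC_in k).

Lemma hbCE k F : hbC k F = hop g (rev js) k F. Proof. by []. Qed.

Lemma hbC0 : hbC 0 = 1.
Proof. by apply: bicom_eq => F w; rewrite hbCE hop0. Qed.

Definition Aser (y : pseries (bicom g d)) := \sum_(m < d.+1) hC g d m *: y ^+ m.
Definition Abar (y : pseries (bicom g d)) := \sum_(m < d.+1) hbC m *: y ^+ m.

(** [key_operator] read as an identity of series over the commutative ring. *)
Lemma AserAbar y z : y - z - g%:A * y * z = 0 ->
  Aser (map_ps (scal g d) y) * Abar (- map_ps (scal g d) z) = 1.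
Proof.
move=> yz; apply/pseriesP => mu; apply: bicom_eq => F w.
have /pseriesP/(_ mu) key := key_operator F w yz.
transitivity (((F w)%:A : K) mu); last first.
  rewrite ps_coefZ !ps_coef1; case: eqP => _.
    by rewrite -[nat_of_bool true]/1%N mulr1 bc1E.
  by rewrite -[nat_of_bool false]/0%N mulr0 bc0E.
rewrite -key /Aser /Abar mulrC mulr_suml !ps_coef_sum bc_sumE; apply: eq_bigr => l _.
rewrite mulr_sumr !ps_coef_sum bc_sumE; apply: eq_bigr => m _.
rewrite -map_psN -!map_psX -scalerAl -scalerAr scalerA -map_psM !ps_coefZ map_psE.
by rewrite mulrC bcME scalE bcME hbCE hCE mulrC.
Qed.

End Key.

Definition mset_of (m : nat) (e : 'I_m -> nat) : monomial :=
  \big[@msetD nat/mset0]_(i < m) msetn (e i) (i : nat).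

Lemma mset_ofE m (e : 'I_m -> nat) j :
  mset_of e j = if insub j is Some i then e i else 0%N.
Proof.
rewrite /mset_of; have -> : (\big[@msetD nat/mset0]_(i < m) msetn (e i) (i : nat)) j =
    (\sum_(i < m) msetn (e i) (i : nat) j)%N.
  by elim/big_rec2: _ => [|i x y _ <-]; rewrite ?mset0E ?msetE2.
case: insubP => [i _ ij|jm].
  rewrite (bigD1 i) //= msetnE ij eqxx big1 ?addn0 // => k ki.
  by rewrite msetnE -ij (inj_eq val_inj) eq_sym (negPf ki).
by rewrite big1 // => i _; rewrite msetnE; case: eqP => // ji; move: jm; rewrite ji ltn_ord.
Qed.

Lemma prod_enum_mset (A : comNzRingType) (F : nat -> A) m (mu : monomial) : below m mu ->
  \prod_(i <- enum_mset mu) F i = \prod_(i < m) F i ^+ mu i.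
Proof.
move=> bmu.
have -> : \prod_(i < m) F i ^+ mu i = \prod_(i < m) \prod_(j <- enum_mset mu | j == i) F i.
  apply: eq_bigr => i _; rewrite big_const_seq -Monoid.iteropE -count_mem_mset //.
rewrite (exchange_big_dep predT) //=; rewrite big_seq [RHS]big_seq.
apply: eq_bigr => j jmu; have jm := belowP _ _ bmu j jmu.
rewrite (bigD1 (Ordinal jm)) //= big1 ?mulr1 // => i /andP[/eqP ji /negP[]].
by apply/eqP/val_inj.
Qed.

(** * The substitution of x_i / (1 - a x_i) *)

Section Substitution.
Variables (R : comNzRingType) (a b : R) (n : nat).
Hypothesis n_gt0 : (0 < n)%N.
Local Notation d := n.-1.
Local Notation g := (a + b).
Local Notation "''x_' i" := (var R i) (at level 8, i at level 2).

Definition yvar (c : R) i : pseries R := 'x_i * geom c i.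

Lemma coef_prod_varM (s : seq nat) (G : pseries R) nu :
  ((\prod_(i <- s) 'x_i) * G) nu != 0 -> (seq_mset s `<=` nu)%mset.
Proof.
elim: s nu => [|i s IH] nu.
  by move=> _; apply/msubsetP => j; rewrite mset_seqE.
rewrite big_cons -mulrA ps_coefXM; case: ifP => [inu|]; last by rewrite eqxx.
move=> /IH sub; rewrite mset_cons -(msetB1K inu); exact: msetDS.
Qed.

Lemma trunc_yvar m c i : (i < m)%N -> trunc m (yvar c i) = yvar c i.
Proof. by move=> im; rewrite truncM trunc_var im trunc_geom. Qed.

(** Both sides are expanded over exponent functions bounded by d. Other monomials contribute nothing
    to the coefficient of nu: either they do not divide nu, since y_i is divisible by x_i, or they
    have an exponent above d and [hC_big] applies. *)
Theorem trunc_Gperm (w : 'S_n) m :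
  trunc m (Gperm a b w) =
  map_ps (entry (npof w)) (\prod_(i < m) Aser (map_ps (scal g d) (yvar a i))).
Proof.
set P := \prod_(i < m) _.
have truncP : trunc m P = P.
  rewrite trunc_prod; apply: eq_bigr => i _; rewrite trunc_sum; apply: eq_bigr => k _.
  by rewrite truncZ truncX trunc_map_ps trunc_yvar.
have -> : map_ps (entry (npof w)) P = trunc m (map_ps (entry (npof w)) P).
  by rewrite trunc_map_ps truncP.
apply/pseriesP => nu.
rewrite -[LHS]/(if below m nu then Gperm a b w nu else 0).
rewrite -[RHS]/(if below m nu then map_ps (entry (npof w)) P nu else 0).
case: ifP => // bnu.
have vE i : ps_quo (ps_var R i) (1 - a *: ps_var R i) = yvar a i.
  rewrite varE; apply: ps_quoP; first exact: regular_1BX.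
  by rewrite /yvar -mulrA geomK mulr1.
transitivity (\sum_(mu \in [set: monomial]%classic) stable_grothendieck g w mu *
  (\prod_(i <- enum_mset mu) ps_quo (ps_var R i) (1 - a *: ps_var R i)) nu).
  by [].
under eq_fsbigr => mu _ do under eq_bigr => i _ do rewrite vE.
have subnu mu : (\prod_(i <- enum_mset mu) yvar a i) nu != 0 -> (mu `<=` nu)%mset.
  by rewrite big_split => /coef_prod_varM; rewrite seq_mset_id.
have stE mu : below m mu -> stable_grothendieck g w mu =
    entry (npof w) (\prod_(i < m) hC g d (mu i)).
  by move=> bmu; rewrite (stable_grothendieckE _ n_gt0 _ bmu) entry_prod.
pose ms (s : {ffun 'I_m -> 'I_d.+1}) : monomial := mset_of (fun i => s i : nat).
have msE s (i : 'I_m) : ms s i = s i by rewrite /ms mset_ofE valK.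
have bms s : below m (ms s).
  by apply/below_leP => i mi; rewrite /ms mset_ofE insubF // ltnNge mi.
rewrite (fsbigE [seq ms s | s <- index_enum _]).
- rewrite big_map /P bigA_distr_bigA map_ps_sum ps_coef_sum.
  apply: eq_big => [s|s _]; first by rewrite in_setT.
  rewrite (prod_enum_mset _ (bms s)) (stE _ (bms s)) scaler_prod.
  have -> : \prod_(i < m) hC g d (ms s i) = \prod_(i < m) hC g d (s i).
    by apply: eq_bigr => i _; rewrite msE.
  have -> : \prod_(i < m) yvar a i ^+ ms s i = \prod_(i < m) yvar a i ^+ s i.
    by apply: eq_bigr => i _; rewrite msE.
  rewrite -[X in _ *: X](_ : map_ps (scal g d) (\prod_(i < m) yvar a i ^+ s i) = _); last first.
    by rewrite map_ps_prod; apply: eq_bigr => i _; rewrite map_psX.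
  rewrite map_psE ps_coefZ map_psE.
  by rewrite mulrC -entry_scal mulrC.
- rewrite map_inj_uniq ?index_enum_uniq // => s s' ss'.
  by apply/ffunP => i; apply: val_inj; rewrite /= -!msE ss'.
- by [].
move=> mu _ muN.
case: (eqVneq ((\prod_(i <- enum_mset mu) yvar a i) nu) 0) => [->|/subnu sub].
  by rewrite mulr0.
have bmu := below_sub sub bnu.
case: (boolP [forall i : 'I_m, (mu i <= d)%N]) => [/forallP led|].
  case/negP: muN; apply/mapP; exists [ffun i : 'I_m => inord (mu i)].
    exact: mem_index_enum.
  apply/msetP => j; rewrite /ms mset_ofE; case: insubP => [i _ <-|jm].
    by rewrite ffunE inordK // ltnS.
  by apply: (below_leP _ _ bmu); rewrite leqNgt.
rewrite negb_forall => /existsP[i]; rewrite -ltnNge => di.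
have p0 : \prod_(j < m) hC g d (mu j) = 0 by rewrite (bigD1 i) //= hC_big // mul0r.
by rewrite (stE _ bmu) p0 entry0 mul0r.
Qed.

End Substitution.

(** * Finite expansion in the G_la *)

Lemma sum_swap d i (F : nat -> nat) : (i.+1 < d)%N ->
  (\sum_(j < d) F (swap i j) = \sum_(j < d) F j)%N.
Proof.
move=> id; have sd (j : 'I_d) : (swap i j < d)%N by rewrite swap_lt.
have sK : involutive (fun j : 'I_d => Ordinal (sd j)).
  by move=> j; apply: val_inj; rewrite /= swapK.
by rewrite [RHS](reindex_inj (inv_inj sK)).
Qed.

(** The measure that makes sorting by adjacent exchanges terminate. *)
Lemma sum_swap_lt d i (a : nat -> nat) : (i.+1 < d)%N -> (a i < a i.+1)%N ->
  (\sum_(j < d) j * a (swap i j) < \sum_(j < d) j * a j)%N.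
Proof.
move=> id lt_a; rewrite -(sum_swap (fun j => j * a (swap i j))%N id).
under eq_bigr => j _ do rewrite swapK.
pose j0 := Ordinal (ltnW id); pose j1 := Ordinal id.
have j10 : j1 != j0 by rewrite -val_eqE /=; lia.
rewrite (bigD1 j0) //= (bigD1 j1) //= [X in (_ < X)%N](bigD1 j0) //= [X in (_ < _ + X)%N](bigD1 j1) //=.
rewrite swapl swapr (eq_bigr (fun j : 'I_d => j * a j)%N); last first.
  move=> j /andP[]; rewrite -!val_eqE /= => nj0 nj1.
  by rewrite /swap (negPf nj0) (negPf nj1).
nia.
Qed.

Lemma exists_part d (f : nat -> nat) : (forall j, (j.+1 < d)%N -> (f j.+1 <= f j)%N) ->
  exists la, [/\ is_part la, (size la <= d)%N & forall j, (j < d)%N -> nth 0%N la j = f j].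
Proof.
elim: d => [|d IH] fd; first by exists [::].
case: (posnP (f d)) => [fd0|fd_gt0].
  have [|la [pla szla laE]] := IH; first by move=> j jd; apply: fd; exact: ltnW.
  exists la; split=> [//||j]; first exact: ltnW.
  rewrite ltnS leq_eqVlt => /orP[/eqP ->|/laE //].
  by rewrite nth_default // fd0.
exists (mkseq f d.+1); split=> [||j jd]; rewrite ?size_mkseq ?nth_mkseq //.
apply/andP; split.
  apply/(sortedP 0%N) => j; rewrite size_mkseq => jd.
  by rewrite !nth_mkseq ?(ltnW jd) //; exact: fd.
apply/negP => /mapP[j]; rewrite mem_iota /= add0n => jd f0.
have : (f d <= f j)%N; last by rewrite -f0 leqNgt fd_gt0.
have mono k : (j <= k)%N -> (k <= d)%N -> (f k <= f j)%N.
  elim: k => [|k IHk]; first by rewrite leqn0 => /eqP ->.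
  rewrite leq_eqVlt => /orP[/eqP -> //|jk] kd.
  by apply: leq_trans (fd k kd) (IHk jk (ltnW kd)).
exact: mono.
Qed.

Lemma lift_neqE m (h : 'I_m) (i : 'I_m.-1) : (lift h i == h :> nat) = false.
Proof. by apply/negbTE; rewrite eq_sym (inj_eq val_inj) neq_lift. Qed.

Section Expansion.
Variables (A S : comNzRingType) (ev : {rmorphism A -> S}) (y : nat -> S) (G : A).
Implicit Types (p q : nat -> {poly A}) (P Q : {poly A}) (la : seq nat).

Definition pev P i : S := (map_poly ev P).[y i].

Lemma pevD P Q i : pev (P + Q) i = pev P i + pev Q i.
Proof. by rewrite /pev rmorphD hornerD. Qed.
Lemma pevM P Q i : pev (P * Q) i = pev P i * pev Q i.
Proof. by rewrite /pev rmorphM hornerM. Qed.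
Lemma pevZ c P i : pev (c *: P) i = ev c * pev P i.
Proof. by rewrite /pev linearZ hornerZ. Qed.
Lemma pevXn P k i : pev (P ^+ k) i = pev P i ^+ k.
Proof. by rewrite /pev rmorphXn horner_exp. Qed.
Lemma pevX i : pev 'X i = y i.
Proof. by rewrite /pev map_polyX hornerX. Qed.
Lemma pev1 i : pev 1 i = 1.
Proof. by rewrite /pev rmorph1 hornerC. Qed.
Lemma pev0 i : pev 0 i = 0.
Proof. by rewrite /pev rmorph0 hornerC. Qed.

Definition Gdet m la : S := \det (\matrix_(i < m, j < m)
  (y i ^+ (nth 0%N la j + (m - j.+1)) * (1 + ev G * y i) ^+ j)).

Definition oneGX : {poly A} := 1 + G *: 'X.
Lemma pev_oneGX i : pev oneGX i = 1 + ev G * y i.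
Proof. by rewrite pevD pev1 pevZ pevX. Qed.

Section Width.
Variable d : nat.

(** For la with at most d parts, the matrices of [Gdet] share their columns j >= d. Their first d
    columns are divisible by y_i ^ (m - d), and the quotients are polynomials independent of m. *)
Definition Dmx m p : 'M[S]_m := \matrix_(i, j)
  if (j < d)%N then y i ^+ (m - d) * pev (p j) i
  else y i ^+ (m - j.+1) * (1 + ev G * y i) ^+ j.

(* L must not depend on the number m of variables.                             *)
Definition expandable p := exists L : seq (A * seq nat),
  all (fun x => is_part x.2 && (size x.2 <= d)%N) L /\
  forall m, (d <= m)%N -> \det (Dmx m p) = \sum_(x <- L) ev x.1 * Gdet m x.2.

Definition upd p k Q : nat -> {poly A} := fun j => if j == k then Q else p j.

Lemma eq_expandable p q : (forall j, (j < d)%N -> p j = q j) -> expandable p -> expandable q.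
Proof.
move=> pq [L [LP LE]]; exists L; split=> // m dm; rewrite -LE //; congr (\det _).
by apply/matrixP => i j; rewrite !mxE; case: ifP => // jd; rewrite pq.
Qed.

Lemma expandable_det0 p : (forall m, (d <= m)%N -> \det (Dmx m p) = 0) -> expandable p.
Proof. by move=> D0; exists [::]; split=> // m dm; rewrite big_nil D0. Qed.

Lemma expandable_lin p k c Q1 Q2 : (k < d)%N ->
  expandable (upd p k Q1) -> expandable (upd p k Q2) -> expandable (upd p k (c *: Q1 + Q2)).
Proof.
move=> kd [L1 [LP1 LE1]] [L2 [LP2 LE2]].
exists ([seq (c * x.1, x.2) | x <- L1] ++ L2); split.
  rewrite all_cat LP2 andbT all_map; exact: LP1.
move=> m dm; rewrite big_cat big_map /= -LE2 //.
under eq_bigr => x _ do rewrite rmorphM -mulrA.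
rewrite -mulr_sumr -LE1 // -[X in _ = _ + X]mul1r.
rewrite -det_tr -[\det (Dmx m (upd p k Q1))]det_tr -[\det (Dmx m (upd p k Q2))]det_tr.
apply: (@determinant_multilinear _ _ _ _ _ (Ordinal (leq_trans kd dm))).
- apply/rowP => j; rewrite !mxE /= kd /upd eqxx pevD pevZ; ring.
- apply/matrixP => i j; rewrite !mxE /upd.
  by rewrite (lift_neqE (Ordinal (leq_trans kd dm))).
- apply/matrixP => i j; rewrite !mxE /upd.
  by rewrite (lift_neqE (Ordinal (leq_trans kd dm))).
Qed.

Lemma expandable0 p k : (k < d)%N -> expandable (upd p k 0).
Proof.
move=> kd; apply: expandable_det0 => m dm.
rewrite (expand_det_col _ (Ordinal (leq_trans kd dm))) big1 // => i _.
by rewrite !mxE /= kd /upd eqxx pev0 mulr0 mul0r.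
Qed.

Lemma expandable_alt p i j : (i < d)%N -> (j < d)%N -> i != j -> p i = p j -> expandable p.
Proof.
move=> id jd ij pij; apply: expandable_det0 => m dm; rewrite -det_tr.
apply: (@determinant_alternate _ _ _ (Ordinal (leq_trans id dm)) (Ordinal (leq_trans jd dm))) => //.
by move=> k; rewrite !mxE /= id jd pij.
Qed.

Lemma expandable_opp p q : (forall m, (d <= m)%N -> \det (Dmx m q) = - \det (Dmx m p)) ->
  expandable p -> expandable q.
Proof.
move=> pq [L [LP LE]]; exists [seq (- x.1, x.2) | x <- L]; split.
  rewrite all_map; exact: LP.
move=> m dm; rewrite pq // LE // big_map -sumrN; apply: eq_bigr => x _.
by rewrite rmorphN mulNr.
Qed.

Lemma expandable_swap p i : (i.+1 < d)%N ->
  expandable (fun j => p (swap i j)) -> expandable p.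
Proof.
move=> id; apply: expandable_opp => m dm.
have im : (i.+1 < m)%N by exact: leq_trans dm.
pose s := tperm (Ordinal (ltnW im)) (Ordinal im).
have -> : Dmx m (fun j => p (swap i j)) = col_perm s (Dmx m p).
  apply/matrixP => k j; rewrite !mxE /s.
  case: tpermP => [->|->|/eqP + /eqP]; rewrite /= /swap ?eqxx.
  - by rewrite id (ltnW id).
  - have -> : (i.+1 == i) = false by lia.
    by rewrite id (ltnW id).
  by rewrite -!val_eqE /= => /negPf -> /negPf ->.
rewrite col_permE det_mulmx det_perm odd_permV odd_tperm.
rewrite -val_eqE /=; have -> : (i == i.+1) = false by lia.
by rewrite expr1 mulrN1 opprK.
Qed.

Definition staircase la j : {poly A} := 'X ^+ (nth 0%N la j + (d - j.+1)) * oneGX ^+ j.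

Lemma expandable_part la : is_part la -> (size la <= d)%N -> expandable (staircase la).
Proof.
move=> pla szla; exists [:: (1, la)]; rewrite /= pla szla; split=> // m dm.
rewrite big_seq1 rmorph1 mul1r; congr (\det _); apply/matrixP => i j; rewrite !mxE /staircase.
case: ltnP => jd; last by rewrite nth_default // (leq_trans szla).
rewrite pevM !pevXn pevX pev_oneGX mulrA -exprD; congr (_ ^+ _ * _).
by case: j jd => j /=; lia.
Qed.

(* Each p j is replaced in turn by its expansion into monomials.              *)
Lemma expandable_monomials p :
  (forall b : nat -> nat, (forall j, (j < d)%N -> (p j)`_(b j) != 0) ->
     expandable (fun j => 'X ^+ b j)) -> expandable p.
Proof.
move=> H.
suff mix k : (k <= d)%N -> forall b : nat -> nat,
    (forall j, (k <= j < d)%N -> (p j)`_(b j) != 0) ->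
    expandable (fun j => if (j < k)%N then p j else 'X ^+ b j).
  apply: (@eq_expandable (fun j => if (j < d)%N then p j else 'X ^+ 0)) => [j ->//|].
  by apply: (mix d (leqnn d) (fun=> 0%N)) => j; lia.
elim: k => [|k IH] kd b bP; first exact: H.
pose q := fun j => if (j < k)%N then p j else 'X ^+ b j.
suff main s : expandable (upd q k (\sum_(t < s) (p k)`_t *: 'X ^+ t)).
  apply: (@eq_expandable (upd q k (\sum_(t < size (p k)) (p k)`_t *: 'X ^+ t))); last exact: main.
  move=> j jd; rewrite /upd /q; case: eqP => [->|jk].
    by rewrite ltnSn -[RHS]coefK poly_def.
  by have -> : (j < k.+1)%N = (j < k)%N by lia.
elim: s => [|s IHs]; first by rewrite big_ord0; exact: expandable0.
rewrite big_ord_recr /= addrC.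
case: (eqVneq (p k)`_s 0) => [->|ps]; first by rewrite scale0r add0r.
apply: expandable_lin => //.
apply: (@eq_expandable (fun j => if (j < k)%N then p j else 'X ^+ (if j == k then s else b j))).
  by move=> j jd; rewrite /upd /q; case: eqP => [->|_] //; rewrite ltnn.
apply: IH; first exact: ltnW.
move=> j /andP[kj jd]; case: (eqVneq j k) => [-> //|jk]; apply: bP.
by rewrite jd andbT ltn_neqAle eq_sym jk.
Qed.

Lemma size_oneGX_exp j : (size (oneGX ^+ j) <= j.+1)%N.
Proof.
apply: leq_trans (size_poly_exp_leq _ _) _; rewrite ltnS -[leqRHS]mul1n leq_mul2r -subn1 leq_subLR.
apply/orP; right; apply: leq_trans (size_polyD _ _) _; rewrite geq_max size_poly1 /=.
by apply: leq_trans (size_scale_leq _ _) _; rewrite size_polyX.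
Qed.

Lemma oneGX_exp0 j : (oneGX ^+ j)`_0 = 1.
Proof. by rewrite -horner_coef0 horner_exp hornerD hornerZ hornerX hornerC mulr0 addr0 expr1n. Qed.

(* Once a is sorted, the monomials of staircase la other than 'X ^+ a have     *)
(* larger exponents, still bounded by K.                                       *)
Lemma expandable_Xn (a : nat -> nat) : expandable (fun j => 'X ^+ a j).
Proof.
pose K := \max_(j < d) a j.
have aK j : (j < d)%N -> (a j <= K)%N.
  by move=> jd; exact: (leq_bigmax (F := fun j : 'I_d => a j) (Ordinal jd)).
(* From here on K is just a bound, kept while the exponents grow. The outer measure falls when an
   exponent grows, the inner one when an ascent is sorted away. *)
move: K aK => K.
have [N] := ubnP (\sum_(j < d) (K - a j)); elim: N a => // N IHN a aN.
have [M] := ubnP (\sum_(j < d) j * a j); elim: M a aN => // M IHM a aN aM aK.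
case: (boolP [exists i : 'I_d, (i.+1 < d)%N && (a i < a i.+1)%N]) => [/existsP[i /andP[id lt_a]]|].
  apply: (expandable_swap id); apply: IHM => [||j jd].
  - by rewrite (sum_swap (fun j => K - a j)%N id).
  - by have := sum_swap_lt id lt_a; lia.
  - by apply: aK; rewrite swap_lt.
rewrite negb_exists => /forallP noasc.
case: (boolP [exists i : 'I_d, (i.+1 < d)%N && (a i == a i.+1)]) => [/existsP[i /andP[id /eqP eq_a]]|].
  by apply: (expandable_alt (ltnW id) id) => /=; [lia | rewrite eq_a].
rewrite negb_exists => /forallP noeq.
have dec i : (i.+1 < d)%N -> (a i.+1 < a i)%N.
  move=> id; have := noasc (Ordinal (ltnW id)); have := noeq (Ordinal (ltnW id)).
  by rewrite /= id /=; lia.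
(* Strict decrease leaves room for the factor (1 + G X)^j of degree at most j below the bound K. *)
have aj_le j : (j < d)%N -> (a j + j <= K)%N.
  elim: j => [|j IHj] jd; first by rewrite addn0 aK.
  by apply: leq_trans (IHj (ltnW jd)); have := dec j jd; lia.
have aj_ge j : (j < d)%N -> (d - j.+1 <= a j)%N.
  have [k] := ubnP (d - j); elim: k j => // k IHk j kj jd.
  case: (ltnP j.+1 d) => [j1d|]; last by lia.
  by have := dec j j1d; have := IHk j.+1 _ j1d; lia.
have [|la [pla szla laE]] := @exists_part d (fun j => a j - (d - j.+1))%N.
  by move=> j jd; have := dec j jd; lia.
(* Starting from [staircase la], the columns are replaced by pure powers one at a time. *)
pose q k j : {poly A} := if (j < k)%N then 'X ^+ a j else 'X ^+ a j * oneGX ^+ j.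
suff qP k : (k <= d)%N -> expandable (q k).
  apply: (eq_expandable _ (qP d (leqnn d))) => j jd; by rewrite /q jd.
elim: k => [_|k IHk kd].
  apply: (eq_expandable _ (expandable_part pla szla)) => j jd.
  by rewrite /staircase /q laE // subnK // aj_ge.
have {}IHk := IHk (ltnW kd).
(* As (1 + G X)^k has constant term 1, r has only exponents above a k; the outer induction expands
   its contribution. *)
pose r := q k k - 'X ^+ a k.
apply: (@eq_expandable (upd (q k) k (-1 *: r + q k k))).
  move=> j jd; rewrite /upd /q /r; case: eqP => [->|jk].
    by rewrite ltnSn scaleN1r opprB subrK.
  by have -> : (j < k.+1)%N = (j < k)%N by lia.
apply: expandable_lin => //; last first.
  by apply: (eq_expandable _ IHk) => j jd; rewrite /upd; case: eqP => // ->.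
apply: expandable_monomials => b bP.
have coefq j c : ('X ^+ a j * oneGX ^+ j)`_c != 0 -> (a j <= c <= a j + j)%N.
  rewrite coefXnM; case: ltnP => [_|ac]; first by rewrite eqxx.
  rewrite /= -leq_subLR; apply: contraR; rewrite -ltnNge => lt_j.
  by rewrite nth_default // (leq_trans (size_oneGX_exp j)).
have bj j : (j < d)%N -> (a j <= b j <= a j + j)%N /\ (j = k -> a j < b j)%N.
  move=> jd; have := bP j jd; rewrite /upd /r /q; case: (eqVneq j k) => [jk|/eqP jk].
    rewrite ltnn coefB coefXn -jk => H; split; last first.
      move=> _; rewrite ltnNge; apply: contra H => ba.
      rewrite coefXnM; case: ltnP => [lt_ba|ab].
        have -> : (b j == a j) = false by lia.
        by rewrite subr0.
      have -> : b j = a j by lia.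
      by rewrite subnn oneGX_exp0 eqxx subrr.
    case: (eqVneq (b j) (a j)) H => [-> _|_]; first by rewrite leqnn leq_addr.
    by rewrite subr0 => /coefq.
  move=> H; split=> //; move: H; case: ifP => _; last by move=> /coefq.
  by rewrite coefXn; case: (eqVneq (b j) (a j)) => [->|_]; rewrite ?leqnn ?leq_addr // eqxx.
apply: IHN => [|j jd]; last first.
  by have [/andP[_ h] _] := bj j jd; apply: leq_trans h (aj_le j jd).
rewrite -ltnS; apply: leq_trans aN; rewrite ltnS.
rewrite (bigD1 (Ordinal kd)) //= [X in (_ < X)%N](bigD1 (Ordinal kd)) //=.
rewrite -addSn; apply: leq_add.
  have [/andP[_ h] /(_ erefl) h'] := bj k kd; have := aj_le k kd; lia.
apply: leq_sum => j _; have [/andP[h _] _] := bj j (ltn_ord j).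
exact: leq_sub2l.
Qed.

Theorem expandable_all p : expandable p.
Proof. by apply: expandable_monomials => b _; exact: expandable_Xn. Qed.

(* Unitriangular column operations: the polynomials X^(m-j-1) for j < d and    *)
(* X^(m-j-1) (1 + G X)^(j-d) Bp for j >= d form a basis of those of size <= m. *)
Lemma det_columns (m : nat) (Ap Bp : {poly A}) : (d <= m)%N -> (size Bp <= d.+1)%N -> Bp`_0 = 1 ->
  (forall i, (i < m)%N -> pev Ap i * pev Bp i = (1 + ev G * y i) ^+ d) ->
  \det (Dmx m (fun j => 'X ^+ (d - j.+1) * Ap)) =
  (\prod_(i < m) pev Ap i) * \det (\matrix_(i < m, j < m) y i ^+ (m - j.+1)).
Proof.
move=> dm szB B0 AB.
rewrite -det_scale_rows.
pose r (j : 'I_m) : {poly A} := if (j < d)%N then 1 else oneGX ^+ (j - d) * Bp.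
pose q (j : 'I_m) : {poly A} := 'X ^+ (m - j.+1) * r j.
have r0 j : (r j)`_0 = 1.
  rewrite /r; case: ifP => _; first by rewrite coefC eqxx.
  by rewrite -horner_coef0 hornerM !horner_coef0 oneGX_exp0 B0 mulr1.
have szq (j : 'I_m) : (size (q j) <= m)%N.
  have jm := ltn_ord j.
  apply: leq_trans (size_polyMleq _ _) _; rewrite size_polyXn /=.
  suff h : (size (r j) <= j.+1)%N by rewrite -[leqRHS](subnK jm) leq_add2l.
  rewrite /r; case: ltnP => jd; first by rewrite size_poly1.
  apply: leq_trans (size_polyMleq _ _) _.
  have := size_oneGX_exp (j - d); lia.
pose N := \matrix_(k < m, j < m) ev (q j)`_(m - k.+1).
have detN : \det N = 1.
  rewrite -det_tr det_trig; last first.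
    apply/is_trig_mxP => j k jk; rewrite !mxE /q coefXnM.
    have -> : (m - k.+1 < m - j.+1)%N by case: j k jk => j ? [k ?] /=; lia.
    by rewrite rmorph0.
  by apply: big1 => j _; rewrite !mxE /q coefXnM ltnn subnn r0 rmorph1.
rewrite -[RHS]mulr1 -detN -det_mulmx; congr (\det _); apply/matrixP => i j; rewrite !mxE.
have -> : \sum_k (\matrix_(i < m, j < m) (pev Ap i * y i ^+ (m - j.+1))) i k * N k j
          = pev Ap i * pev (q j) i.
  have szq' : (size (map_poly ev (q j)) <= m)%N by exact: leq_trans (size_poly _ _) (szq j).
  rewrite -[pev (q j) i]/((map_poly ev (q j)).[y i]) (horner_coef_wide _ szq') mulr_sumr (reindex_inj rev_ord_inj) /=.
  apply: eq_bigr => k _; rewrite !mxE coef_map /=.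
  have -> : (m - (m - k.+1).+1 = k)%N by have := ltn_ord k; lia.
  by rewrite -mulrA; congr (_ * _); rewrite mulrC.
rewrite /q /r; case: ifP => jd.
  rewrite !pevM !pevXn pevX pev1 mulr1 mulrA -exprD mulrC; congr (_ * _ ^+ _); lia.
rewrite !pevM !pevXn pevX pev_oneGX mulrCA; congr (_ * _).
rewrite mulrCA AB // -exprD subnK //; lia.
Qed.

End Width.
End Expansion.

(** The case d = 0, A = B = 1 of [det_columns]: column operations remove the factors (1 + G
    y_i)^j. *)
Lemma Gdet_nil (A S : comNzRingType) (ev : {rmorphism A -> S}) (y : nat -> S) (G : A) m :
  Gdet ev y G m [::] = \det (\matrix_(i < m, j < m) y i ^+ (m - j.+1)).
Proof.
have := @det_columns _ _ ev y G 0 m 1 1 (leq0n m).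
rewrite size_poly1 coefC eqxx => /(_ isT erefl) H.
transitivity (\det (Dmx ev y G 0 m (fun j => 'X ^+ (0 - j.+1) * 1))).
  by congr (\det _); apply/matrixP => i j; rewrite !mxE nth_nil add0n.
rewrite H => [|i _]; last by rewrite !pev1 mulr1.
by rewrite big1 ?mul1r // => i _; rewrite pev1.
Qed.

Lemma subst_aux (A : comNzRingType) (v x p q : A) :
  v * (1 - p * x) = 1 -> 1 + (p + q) * (x * v) = (1 + q * x) * v.
Proof. by move=> {1}<-; ring. Qed.

Lemma row_aux (A : comNzRingType) (x v u : A) k l j :
  x ^+ (k + l) * v ^+ (k + l) * (u * v) ^+ j = v ^+ (l + j) * (x ^+ (k + l) * u ^+ j * v ^+ k).
Proof. by rewrite exprMn !exprD; ring. Qed.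

Section FiniteExpansion.
Variables (R : comNzRingType) (a b : R) (n : nat).
Hypothesis n_gt0 : (0 < n)%N.
Local Notation d := n.-1.
Local Notation g := (a + b).
Local Notation C := (bicom g d).
Local Notation S := (pseries C).
Local Notation sc := (scal g d).
Definition yC i : S := map_ps sc (yvar a i).
Local Notation y := yC.
Local Notation "''x_' i" := (var _ i : pseries (bicom g d)) (at level 8, i at level 2).

Lemma yvarE i : y i = 'x_i * geom (sc a) i.
Proof. by rewrite /yC /yvar map_psM map_ps_var map_ps_geom. Qed.

Definition Apoly : {poly C} := \sum_(k < d.+1) hC g d k *: 'X ^+ k.
(** This is (1 + g y)^d times the reversed product at -z, a polynomial in y because z = y/(1 + g
    y). *)
Definition Bpoly : {poly C} :=
  \sum_(k < d.+1) hbC g d k *: ((- 'X) ^+ k * oneGX (sc g) ^+ (d - k)).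

Lemma pev_Apoly i : pev (in_alg S) y Apoly i = Aser (y i).
Proof.
rewrite /Apoly /Aser /pev rmorph_sum horner_sum; apply: eq_bigr => k _.
by rewrite -/(pev _ _ _ _) pevZ pevXn pevX /= mulr_algl.
Qed.

Lemma Apoly_Bpoly i :
  pev (in_alg S) y Apoly i * pev (in_alg S) y Bpoly i = (1 + (sc g)%:A * y i) ^+ d.
Proof.
pose z := map_ps sc (yvar (- b) i).
have rel := @geom_rel _ g a b i erefl.
have yz : y i = z * (1 + (sc g)%:A * y i).
  have := congr1 (map_ps sc) rel; rewrite !map_psB !map_psM map_psZ map_ps1 -!map_psM.
  rewrite -/(yvar a i) -/(yvar (- b) i) -/z -/(y i) (raddf0 (map_ps sc)) => /eqP.
  rewrite subr_eq0 subr_eq => /eqP e; rewrite [LHS]e; ring.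
transitivity (pev (in_alg S) y Apoly i * ((1 + (sc g)%:A * y i) ^+ d * Abar (- z))); last first.
  rewrite mulrCA pev_Apoly AserAbar ?mulr1 //.
congr (_ * _); rewrite /Bpoly /Abar /pev rmorph_sum horner_sum mulr_sumr.
apply: eq_bigr => k _; have kd : (k <= d)%N by rewrite -ltnS.
rewrite -/(pev _ _ _ _) pevZ pevM !pevXn pev_oneGX /= (mulr_algl (hbC g d k)) -scalerAr; congr (_ *: _).
have -> : pev (in_alg S) y (- 'X) i = - y i by rewrite -scaleN1r pevZ pevX rmorphN1 mulN1r.
rewrite [in X in X * _]yz -mulNr exprMn -mulrA -exprD subnKC // mulrC //.
Qed.

Lemma size_Bpoly : (size Bpoly <= d.+1)%N.
Proof.
apply: (leq_trans (size_sum _ _ _)); apply/bigmax_leqP => k _.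
apply: leq_trans (size_scale_leq _ _) _; apply: leq_trans (size_polyMleq _ _) _.
have s1 : (size ((- 'X : {poly C}) ^+ k) <= k.+1)%N.
  by rewrite -scaleN1r exprZn (leq_trans (size_scale_leq _ _)) ?size_polyXn.
rewrite -subn1 leq_subLR; apply: leq_trans (leq_add s1 (size_oneGX_exp _ _)) _.
have := ltn_ord k; lia.
Qed.

Lemma Bpoly0 : Bpoly`_0 = 1.
Proof.
rewrite -horner_coef0 horner_sum big_ord_recl big1 => [|k _].
  by rewrite hbC0 scale1r expr0 mul1r subn0 horner_coef0 oneGX_exp0 addr0.
by rewrite hornerZ hornerM exprS hornerM hornerN hornerX oppr0 !mul0r mulr0.
Qed.

(** As 1 + g y = (1 + b x)/(1 - a x), column j carries 1/(1 - a x_i) to the power la_j + m - 1. The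
    part m - 1 is common to row i, and la_j is the exponent in G_la. *)
Lemma Gdet_Gnum m la :
  Gdet (in_alg S) y (sc g) m la =
  (\prod_(i < m) geom (sc a) i ^+ m.-1) * Gnum (sc a) (sc b) m la.
Proof.
rewrite /Gnum -det_scale_rows; congr (\det _); apply/matrixP => i j; rewrite !mxE.
rewrite yvarE exprMn.
have -> : 1 + in_alg S (sc g) * ('x_i * geom (sc a) i)
    = (1 + sc b *: 'x_i) * geom (sc a) i.
  rewrite /= rmorphD /= scalerDl -[sc b *: _]mulr_algl; apply: subst_aux.
  by rewrite mulr_algl geomK.
have -> : m.-1 = (m - j.+1 + j)%N by have := ltn_ord j; lia.
exact: row_aux.
Qed.

Lemma regular_geom_prod m : regular_series (\prod_(i < m) geom (sc a) i ^+ m.-1).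
Proof.
apply: regular_prod => i _; elim: (m.-1) => [|k IH]; first exact: regular1.
by rewrite exprS; apply: regularM IH; exact: regular_geom.
Qed.

Lemma Gnum_nil m (A : comNzRingType) (c e : A) : Gnum c e m [::] = vandermonde A m.
Proof.
rewrite vandermondeE -(Gdet_nil (in_alg (pseries A)) (var A) e).
congr (\det _); apply/matrixP => i j.
by rewrite !mxE nth_nil expr0 mulr1 /= mulr_algl.
Qed.

(** The expansion is computed once over the ring [bicom]; [entry] then turns its coefficients into
    scalars for the given w. *)
Lemma Gperm_expansion (w : 'S_n) : exists L : seq (R * seq nat),
  all (fun x => is_part x.2) L /\
  Gperm a b w = \sum_(x <- L) x.1 *: Gpart a b x.2.
Proof.
have [L [LP LE]] := expandable_all (in_alg S) y (sc g) d (fun j => 'X ^+ (d - j.+1) * Apoly).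
exists [seq (entry (npof w) x.1, x.2) | x <- L]; split.
  by rewrite all_map; apply: sub_all LP => x /andP[].
apply: (@eq_trunc _ _ _ d) => m dm; apply: (regular_inj (@regular_vandermonde R m)).
have {}LE := LE m dm.
rewrite (det_columns dm size_Bpoly Bpoly0) in LE; last by move=> i _; exact: Apoly_Bpoly.
rewrite -(Gdet_nil (in_alg S) y (sc g)) Gdet_Gnum Gnum_nil in LE.
have {}LE : vandermonde C m * \prod_(i < m) Aser (y i)
    = \sum_(x <- L) x.1 *: Gnum (sc a) (sc b) m x.2.
  apply: (regular_inj (@regular_geom_prod m)).
  have <- : \prod_(i < m) pev (in_alg S) y Apoly i = \prod_(i < m) Aser (y i).
    by apply: eq_bigr => i _; exact: pev_Apoly.
  rewrite mulrA mulrC LE mulr_sumr.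
  by apply: eq_bigr => x _; rewrite Gdet_Gnum /= mulr_algl -scalerAr.
rewrite trunc_Gperm // -(@map_ps_linear _ _ sc); last exact: entry_scal.
rewrite map_ps_vandermonde LE map_ps_sum trunc_sum mulr_sumr big_map big_seq [RHS]big_seq.
apply: eq_bigr => x xL; have /andP[_ szx] := allP LP x xL.
rewrite truncZ -scalerAr trunc_GpartM ?(leq_trans szx) //.
apply/pseriesP => mu; rewrite map_psE !ps_coefZ -map_ps_Gnum map_psE.
transitivity (entry (npof w) (sc (Gnum a b m x.2 mu) * x.1)); first by rewrite mulrC.
by rewrite entry_scal mulrC.
Qed.

Theorem Gperm_finite (w : 'S_n) : exists (P : seq (seq nat)) (c : seq nat -> R),
  all is_part P /\ Gperm a b w = \sum_(la <- P) c la *: Gpart a b la.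
Proof.
have [L [LP ->]] := Gperm_expansion w.
exists (undup [seq x.2 | x <- L]), (fun la => \sum_(x <- L | x.2 == la) x.1); split.
  by apply/allP => la; rewrite mem_undup => /mapP[x xL ->]; exact: (allP LP).
under [RHS]eq_bigr => la _ do rewrite scaler_suml big_mkcond.
rewrite exchange_big [LHS]big_seq [RHS]big_seq; apply: eq_bigr => x xL /=.
rewrite (bigD1_seq x.2) ?undup_uniq ?mem_undup ?map_f //= eqxx big1 ?addr0 // => la.
by rewrite eq_sym => /negPf ->.
Qed.

End FiniteExpansion.

(** * Inversion and conjugation by the longest element *)

Section Inversion.
Variables (R : comNzRingType) (g : R).
Implicit Types (F : natperm -> R) (w : natperm).

Definition invf F : natperm -> R := fun w => F (npinv w).

Lemma invfK : involutive invf.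
Proof. by move=> F; apply/funext => w; rewrite /invf npinvK. Qed.

Lemma invf_T1 : invf (T1 R) = T1 R.
Proof.
apply/funext => w; rewrite /invf /T1; congr (if _ then _ else _).
apply/asboolP/asboolP => [e|->]; last exact: natpermP.
by rewrite -[w]npinvK e; exact: natpermP.
Qed.

(* Left and right multiplications commute: the descents of s_i w at j are     *)
(* those of w, unless {w j, w (j + 1)} = {i, i + 1}, when s_i w = w s_j.      *)
Lemma invf_uopC i j F :
  invf (uop g i (invf (uop g j F))) = uop g j (invf (uop g i (invf F))).
Proof.
apply/funext => w; rewrite /invf /uop /=.
have sw_w : npinv (npmul (npinv w) (npsw i)) = npmul (npsw i) w by exact: natpermP.
have sw_w' : npinv (npmul (npinv (npmul w (npsw j))) (npsw i)) =
    npmul (npmul (npsw i) w) (npsw j) by exact: natpermP.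
rewrite !npinvK !sw_w !sw_w'.
case: (boolP [&& w j.+1 == i & w j == i.+1]) => [/andP[/eqP e1 /eqP e0]|n1].
  have b0 : pback w i = j.+1 by rewrite -e1 pfwdK.
  have b1 : pback w i.+1 = j by rewrite -e0 pfwdK.
  have f1 : (i.+1 < i)%N = false by lia.
  have f2 : (j.+1 < j)%N = false by lia.
  rewrite e1 e0 b0 b1 ?swapl ?swapr !ltnSn ?f1 ?f2.
  suff -> : npmul (npsw i) w = npmul w (npsw j) by [].
  apply: natpermP => k /=.
  case: (k =P j) => [->|kj]; first by rewrite e0 swapr swapl e1.
  case: (k =P j.+1) => [->|kj1]; first by rewrite e1 swapl swapr e0.
  have wi : (w k == i) = false by rewrite -e1 (inj_eq (@natperm_inj w)); exact/eqP.
  have wi1 : (w k == i.+1) = false by rewrite -e0 (inj_eq (@natperm_inj w)); exact/eqP.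
  by rewrite /swap wi wi1; move/eqP/negPf: kj => ->; move/eqP/negPf: kj1 => ->.
case: (boolP [&& w j.+1 == i.+1 & w j == i]) => [/andP[/eqP e1 /eqP e0]|n2].
  have b0 : pback w i.+1 = j.+1 by rewrite -e1 pfwdK.
  have b1 : pback w i = j by rewrite -e0 pfwdK.
  have f1 : (i.+1 < i)%N = false by lia.
  have f2 : (j.+1 < j)%N = false by lia.
  by rewrite e1 e0 b0 b1 f1 f2.
have cw : (swap i (w j.+1) < swap i (w j))%N = (w j.+1 < w j)%N.
  have := inj_eq (@natperm_inj w) j j.+1; move: n1 n2; rewrite /swap.
  by repeat (case: eqP => ? //=); lia.
have cb : (swap j (pback w i.+1) < swap j (pback w i))%N = (pback w i.+1 < pback w i)%N.
  have := inj_eq (can_inj (pbackK w)) i i.+1; move: n1 n2.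
  rewrite !(can2_eq (pfwdK w) (pbackK w)) /swap.
  by repeat (case: eqP => ? //=); lia.
rewrite cw cb; case: ifP => c1; case: ifP => c2; rewrite ?c1 ?c2 //; ring.
Qed.

Lemma invfD F G : invf (fun w => F w + G w) = fun w => invf F w + invf G w.
Proof. by []. Qed.

Lemma invf_hop_uop js k j F :
  invf (hop g js k (invf (uop g j F))) = uop g j (invf (hop g js k (invf F))).
Proof.
elim: js k => [|i js IH] [|k].
- by rewrite /= !invfK.
- by apply/funext => w; rewrite /invf /uop /=; case: ifP => // _; ring.
- by rewrite !hop0 !invfK.
have -> : forall G, hop g (i :: js) k.+1 G = fun w => hop g js k.+1 G w + uop g i (hop g js k G) w.
  by [].
have -> : forall G, hop g (i :: js) k.+1 G = fun w => hop g js k.+1 G w + uop g i (hop g js k G) w.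
  by [].
rewrite invfD IH [in RHS]invfD uopD; apply/funext => w; congr (_ + _).
have := IH k; move=> /(congr1 invf); rewrite invfK => ->.
by rewrite -[RHS]/(uop g j _ w) -invf_uopC.
Qed.

Lemma uop_T1 j : uop g j (T1 R) = invf (uop g j (T1 R)).
Proof.
apply/funext => w; rewrite /invf /uop /T1 /=.
have e1 : `[< npmul w (npsw j) = np1 >] = `[< w = npsw j >].
  apply/asboolP/asboolP => [e|->]; last exact: npsw2.
  by rewrite -[w]npmul1 -(npsw2 j) npmulA e np1mul.
have e2 : `[< npmul (npinv w) (npsw j) = np1 >] = `[< w = npsw j >].
  apply/asboolP/asboolP => [e|->]; last by rewrite npinv_sw npsw2.
  rewrite -[w]npinvK -[npinv w]npmul1 -(npsw2 j) npmulA e np1mul; exact: npinv_sw.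
rewrite e1 e2; case: asboolP => [->|_].
  have h1 : `[< npsw j = np1 >] = false.
    by apply/asboolP => /(congr1 (fun v : natperm => v j)); rewrite /= swapl; lia.
  have h2 : `[< npinv (npsw j) = np1 >] = false.
    by apply/asboolP => /(congr1 (fun v : natperm => v j)); rewrite /= swapl; lia.
  by rewrite ?h1 ?h2 /= swapl swapr.
case: asboolP => [->|wn1].
  by rewrite /= ltnNge leqnSn.
have -> : `[< npinv w = np1 >] = false.
  apply/asboolP => e; apply: wn1; rewrite -[w]npinvK e; exact: natpermP.
by rewrite mulr0 addr0; case: ifP; case: ifP.
Qed.

Lemma hop_rcons js j k F : hop g (rcons js j) k F =
  fun w => hop g js k F w + (if k is k'.+1 then hop g js k' (uop g j F) w else 0).
Proof.
elim: js k => [|i js IH] [|k].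
- by [].
- by case: k => [|k] //; apply/funext => w /=; rewrite /uop; case: ifP => // _; ring.
- by rewrite hop0 hop0; apply/funext => w; rewrite addr0.
have hopS G js' l : hop g (i :: js') l.+1 G = fun w => hop g js' l.+1 G w + uop g i (hop g js' l G) w.
  by [].
rewrite rcons_cons !hopS !IH uopD; apply/funext => w.
case: k => [|k]; last by rewrite hopS; ring.
rewrite !hop0 [X in _ + (_ + X)](_ : _ = 0); first by ring.
by rewrite /uop; case: ifP => // _; ring.
Qed.

(** Inversion reverses products of generators: on the unit, left and right multiplication by u_j
    agree ([uop_T1]). *)
Lemma hop_T1 js k : hop g js k (T1 R) = invf (hop g (rev js) k (T1 R)).
Proof.
elim: js k => [|j js IH] k; first by case: k => [|k] //; rewrite [RHS]/= invf_T1.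
rewrite rev_cons hop_rcons invfD; apply/funext => w; rewrite [LHS]/= IH; congr (_ + _).
case: k => [//|k]; rewrite IH.
by rewrite -{1}invf_T1 -invf_hop_uop -uop_T1.
Qed.

(** The anti-automorphism T_v -> T_(v^-1) reverses every factor, as wanted, and also the order of
    the factors, which is immaterial since they commute. Concretely, [hop] conjugated by [invf] is a
    left multiplication, which commutes with right ones ([hopH]). *)
Lemma hprod_rev d e m w :
  hprod g (rev (iota 0 d)) e m w = hprod g (iota 0 d) e m (npinv w).
Proof.
suff H : invf (hprod g (rev (iota 0 d)) e m) = hprod g (iota 0 d) e m.
  by rewrite -H /invf npinvK.
have hopH js k l F : invf (hop g (rev (iota 0 d)) k (invf (hop g js l F))) =
    hop g js l (invf (hop g (rev (iota 0 d)) k (invf F))).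
  elim: js l => [|i js IHjs] [|l].
  - by [].
  - by rewrite /= (_ : invf (fun=> 0) = fun=> 0) // hop0f.
  - by rewrite !hop0.
  have hopS G : hop g (i :: js) l.+1 G = fun w => hop g js l.+1 G w + uop g i (hop g js l G) w.
    by [].
  by rewrite !hopS invfD hopD invfD IHjs invf_hop_uop IHjs.
have left k l : invf (hop g (rev (iota 0 d)) k (invf (hprod g (iota 0 d) e l))) =
    hop g (iota 0 d) k (hprod g (iota 0 d) e l).
  elim: l => [|l IH]; first by rewrite /= invf_T1 -hop_T1.
  by rewrite [hprod _ _ _ _]/= hopH IH hopC.
elim: m => [|m IH]; first exact: invf_T1.
by rewrite [hprod _ _ _ _]/= -[hprod g (rev _) e m]invfK IH left.
Qed.

End Inversion.

Section Conjugation.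
Variables (R : comNzRingType) (g : R) (n : nat).
Implicit Types (F : natperm -> R) (w : natperm).

Definition conjw w : natperm := npmul (npmul (w0 n) w) (w0 n).
Definition preserves w := forall k, (w k < n)%N = (k < n)%N.

(** w0 reverses both positions and values below n, so descents are kept and position j becomes n - j
    - 2. It fixes everything from n on, hence the restriction to w preserving the numbers below
    n. *)
Lemma uop_conj j F F' : (j.+1 < n)%N ->
  (forall w, preserves w -> F (conjw w) = F' w) ->
  forall w, preserves w -> uop g j F (conjw w) = uop g (n - j.+2)%N F' w.
Proof.
move=> jn FF' w pw.
have pws : preserves (npmul w (npsw (n - j.+2))).
  move=> k; rewrite -[npmul _ _ k]/(w (swap (n - j.+2) k)) pw swap_lt //; lia.
rewrite /uop -(FF' w pw) -(FF' _ pws).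
have e1 : w0 n j.+1 = (n - j.+2)%N by rewrite w0E.
have e0 : w0 n j = (n - j.+2).+1 by rewrite w0E; lia.
rewrite -[conjw w j.+1]/(w0 n (w (w0 n j.+1))) -[conjw w j]/(w0 n (w (w0 n j))) e1 e0.
have l1 : (w (n - j.+2) < n)%N by rewrite pw; lia.
have l2 : (w (n - j.+2).+1 < n)%N by rewrite pw; lia.
rewrite !w0E //.
have -> : (n - (w (n - j.+2)).+1 < n - (w (n - j.+2).+1).+1)%N =
  (w (n - j.+2).+1 < w (n - j.+2)%N)%N by lia.
case: ifP => // _.
congr (F _ + _); apply: natpermP => k.
rewrite -[LHS]/(w0 n (w (w0 n (swap j k)))) -[RHS]/(w0 n (w (swap (n - j.+2) (w0 n k)))).
congr (w0 n (w _)); case: (ltnP k n) => kn.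
  rewrite !w0E ?swap_lt // /swap.
  by repeat (case: eqP => ? //=); lia.
rewrite [w0 n k]w0_out // swap_id; last by lia.
by rewrite w0_out // swap_id //; lia.
Qed.

Lemma hop_conj js k F F' : all (fun j => j.+1 < n)%N js ->
  (forall w, preserves w -> F (conjw w) = F' w) ->
  forall w, preserves w ->
  hop g js k F (conjw w) = hop g [seq (n - j.+2)%N | j <- js] k F' w.
Proof.
elim: js k F F' => [|j js IH] k F F' jsn FF' w pw.
  by case: k => [|k]; rewrite /= ?FF'.
have /andP[jn jsn'] := jsn.
case: k => [|k]; first by rewrite !hop0 FF'.
rewrite /= (IH _ _ F') //; congr (_ + _).
by apply: uop_conj => // v pv; exact: IH.
Qed.

Lemma hprod_conj e m w : preserves w ->
  hprod g (iota 0 n.-1) e m (conjw w) = hprod g (rev (iota 0 n.-1)) e m w.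
Proof.
have -> : rev (iota 0 n.-1) = [seq (n - j.+2)%N | j <- iota 0 n.-1].
  apply: (@eq_from_nth _ 0%N); first by rewrite size_rev size_map.
  move=> i; rewrite size_rev size_iota => id.
  rewrite nth_rev ?size_iota // (nth_map 0%N) ?size_iota // !nth_iota //; lia.
elim: m w => [|m IH] w pw.
  rewrite /= /T1; congr (if _ then _ else _); apply/asboolP/asboolP => [e1|->].
    have -> : w = npmul (npmul (w0 n) (conjw w)) (w0 n).
      by rewrite /conjw !npmulA w02 np1mul -npmulA w02 npmul1.
    by rewrite e1 npmul1 w02.
  by rewrite /conjw npmul1 w02.
apply: hop_conj => //; by apply/allP => j; rewrite mem_iota; lia.
Qed.

End Conjugation.

(** * The dual Jacobi-Trudi identity *)

Lemma is_part_cons p la : is_part (p :: la) -> is_part la /\ all (fun q => q <= p)%N la.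
Proof.
rewrite /is_part /= in_cons negb_or => /andP[pla /andP[_ ->]].
rewrite (path_sorted pla); split=> //.
by apply: order_path_min pla => x y z; rewrite /geq /=; lia.
Qed.

(** Both sides say that the box (i, j) lies in the diagram of la. *)
Lemma lt_nth_count la i j : is_part la ->
  (j < nth 0%N la i)%N = (i < count (fun p => j < p) la)%N.
Proof.
elim: la i => [|p la IH] i; first by rewrite nth_nil.
move=> /is_part_cons[pla /allP le_p]; case: (ltnP j p) => jp /=.
  by case: i => [|i]; rewrite /= jp // add1n ltnS IH.
have c0 : count (fun q => j < q)%N la = 0%N.
  by apply/eqP; rewrite -leqn0 leqNgt -has_count; apply/hasPn => q /le_p; lia.
rewrite c0; case: i => [|i] /=; first by rewrite ltnNge jp.
rewrite IH // c0; lia.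
Qed.

Lemma nth_le_head la i : is_part la -> (nth 0%N la i <= head 0%N la)%N.
Proof.
case: la => [|p la]; first by rewrite nth_nil.
move=> /is_part_cons[_ /allP le_p]; case: i => [//|i] /=.
case: (ltnP i (size la)) => il; last by rewrite nth_default.
exact/le_p/mem_nth.
Qed.

Lemma nth_conj_part la j : is_part la ->
  nth 0%N (conj_part la) j = count (fun p => j < p)%N la.
Proof.
move=> pla; case: (ltnP j (head 0%N la)) => jh; first by rewrite nth_mkseq.
rewrite nth_default ?size_mkseq //; apply/esym/eqP.
rewrite -leqn0 leqNgt -(lt_nth_count 0 j pla) nth0; lia.
Qed.

Lemma size_conj_part la : size (conj_part la) = head 0%N la.
Proof. by rewrite size_mkseq. Qed.

Lemma nth_part_noninc la i k : is_part la -> (i <= k)%N -> (nth 0%N la k <= nth 0%N la i)%N.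
Proof.
move=> pla ik; rewrite leqNgt; apply/negP.
rewrite lt_nth_count // => /(leq_ltn_trans ik).
by rewrite -lt_nth_count // ltnn.
Qed.

Lemma count_noninc la j k : (j <= k)%N ->
  (count (fun p => k < p) la <= count (fun p => j < p) la)%N.
Proof. by move=> jk; apply: sub_count => p; exact: leq_ltn_trans. Qed.

Lemma sum_ltn m c : (c <= m)%N -> (\sum_(i < m) (i < c) = c)%N.
Proof.
elim: m c => [|m IH] c cm; first by rewrite big_ord0; lia.
rewrite big_ord_recr /=; case: (ltnP m c) => mc; last by rewrite IH ?addn0.
have -> : c = m.+1 by lia.
by rewrite (eq_bigr (fun=> 1%N)) ?sum1_card ?card_ord ?addn1 // => i _; rewrite ltnS ltnW.
Qed.

Lemma is_part_conj la : is_part la -> is_part (conj_part la).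
Proof.
move=> pla; apply/andP; split.
  apply/(sortedP 0%N) => j; rewrite size_mkseq => jh.
  rewrite !nth_conj_part //; apply: sub_count => p /=; lia.
apply/negP => /mapP[j]; rewrite mem_iota /= add0n => jh /esym/eqP.
by rewrite -leqn0 leqNgt -(lt_nth_count 0 j pla) nth0 jh.
Qed.

Section SignInversions.
Import Order.TTheory Num.Theory.

(** Permuting the columns of the integer Vandermonde matrix of 0, ..., N - 1 multiplies its positive
    determinant by the sign of s, while each inversion makes one factor of the product formula
    negative. *)
Lemma sign_inversions N (s : 'S_N) :
  odd_perm s = odd (\sum_(i < N) \sum_(j < N | (i < j)%N) (s j < s i)%N).
Proof.
suff : (-1) ^+ s = (-1) ^+ (\sum_(i < N) \sum_(j < N | (i < j)%N) (s j < s i)%N) :> int.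
  by rewrite -[in RHS]signr_odd => /signr_inj.
have detV (t : 'S_N) : \det (\matrix_(i < N, j < N) ((t j : nat)%:Z ^+ i)) =
    \prod_(i < N) \prod_(j < N | (i < j)%N) ((t j : nat)%:Z - (t i : nat)%:Z).
  have := det_Vandermonde (\row_j (t j : nat)%:Z).
  rewrite /Vandermonde => e; transitivity (\prod_(i < N) \prod_(j < N | (i < j)%N)
      ((\row_j (t j : nat)%:Z) 0 j - (\row_j (t j : nat)%:Z) 0 i)).
    by rewrite -e; congr (\det _); apply/matrixP => i j; rewrite !mxE.
  by apply: eq_bigr => i _; apply: eq_bigr => j _; rewrite !mxE.
have e : \det (\matrix_(i < N, j < N) ((s j : nat)%:Z ^+ i)) =
    (-1) ^+ s * \det (\matrix_(i < N, j < N) (((1%g : 'S_N) j : nat)%:Z ^+ i)).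
  have -> : \matrix_(i < N, j < N) ((s j : nat)%:Z ^+ i) =
      col_perm s (\matrix_(i < N, j < N) (((1%g : 'S_N) j : nat)%:Z ^+ i)).
    by apply/matrixP => i j; rewrite !mxE perm1.
  by rewrite col_permE det_mulmx det_perm odd_permV mulrC.
move: e; rewrite !detV => /(congr1 (@Num.sg int)).
rewrite sgrM sgrX sgrN1 [X in _ * X]gtr0_sg ?mulr1; last first.
  apply: prodr_gt0 => i _; apply: prodr_gt0 => j ij.
  by rewrite !perm1 subr_gt0 ltz_nat.
move=> <-; rewrite (big_morph _ (@sgrM int) (sgr1 _)) -prodrXr.
apply: eq_bigr => i _; rewrite (big_morph _ (@sgrM int) (sgr1 _)) -prodrXr.
apply: eq_bigr => j ij.
have neq : s j != s i by rewrite (inj_eq (@perm_inj _ s)) -val_eqE /= neq_ltn ij orbT.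
case: ltnP => lt_s.
  by rewrite ltr0_sg ?expr1 // subr_lt0 ltz_nat.
by rewrite gtr0_sg ?expr0 // subr_gt0 ltz_nat ltn_neqAle lt_s andbT eq_sym.
Qed.

End SignInversions.

Section DualJacobiTrudi.
Variable A : comNzRingType.
Implicit Types (h e : nat -> A) (la : seq nat).

Definition hsub h p q : A := if (q <= p)%N then h (p - q)%N else 0.

(** For l = [plus_delta m la] the entries are h_(la_i - i + j), so this is the Jacobi-Trudi
    determinant; other l are needed as exponents of monomials. *)
Definition Hdet h m (l : nat -> nat) : A :=
  \det (\matrix_(i < m, j < m) hsub h (l i) (m - j.+1)).

Definition plus_delta m la i := (nth 0%N la i + (m - i.+1))%N.

Lemma det_toeplitz h M : h 0%N = 1 -> \det (\matrix_(p < M, q < M) hsub h p q) = 1.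
Proof.
move=> h0; rewrite det_trig; last first.
  by apply/is_trig_mxP => p q pq; rewrite mxE /hsub leqNgt pq.
by apply: big1 => p _; rewrite mxE /hsub leqnn subnn h0.
Qed.

Lemma toeplitz_inv h b M : (forall k, \sum_(j < k.+1) h j * b (k - j)%N = (k == 0%N)%:R) ->
  (\matrix_(p < M, q < M) hsub h p q) *m (\matrix_(p < M, q < M) hsub b p q) = 1%:M.
Proof.
move=> hb; apply/matrixP => p r; rewrite !mxE.
under eq_bigr => q _ do rewrite !mxE /hsub.
case: (leqP r p) => rp; last first.
  rewrite -val_eqE /= (ltn_eqF rp) big1 // => q _.
  by case: leqP => qp; rewrite ?mul0r //; case: leqP => rq; rewrite ?mulr0 //; lia.
transitivity (\sum_(j < (p - r).+1) h j * b (p - r - j)%N).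
  rewrite -(big_mkord predT (fun j => h j * b (p - r - j)%N)).
  rewrite -(big_mkord predT (fun q => (if (q <= p)%N then h (p - q)%N else 0) * (if (r <= q)%N then b (q - r)%N else 0))).
  rewrite (@big_cat_nat _ _ _ p.+1) ?leq0n ?ltn_ord //= [X in _ + X]big_nat_cond [X in _ + X]big1 ?addr0; last first.
    by move=> q /andP[/andP[pq _] _]; rewrite leqNgt pq mul0r.
  rewrite big_nat_rev /= add0n.
  rewrite (@big_cat_nat _ _ _ (p - r).+1) //=; last by lia.
  rewrite [X in _ + X]big_nat_cond [X in _ + X]big1 ?addr0; last first.
    move=> q /andP[/andP[q1 q2] _]; have -> : (r <= p.+1 - q.+1)%N = false by lia.
    by rewrite mulr0.
  rewrite big_nat_cond [RHS]big_nat_cond; apply: eq_bigr => q /andP[/andP[_ q2] _].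
  have -> : (p.+1 - q.+1 <= p)%N by lia.
  have -> : (r <= p.+1 - q.+1)%N by lia.
  congr (h _ * b _); lia.
by rewrite hb -val_eqE /= subn_eq0 eqn_leq rp andbT.
Qed.

(* Jacobi's complementary minor: right multiplication of P by [[1, Q12], [0,  *)
(* Q22]] yields [[P11, 0], [P21, 1]].                                         *)
Lemma jacobi_minor m d (P Q : 'M[A]_(m + d)) : P *m Q = 1%:M ->
  \det P * \det (drsubmx Q) = \det (ulsubmx P).
Proof.
move=> PQ; have := PQ; rewrite -{1}[P]submxK -{1}[Q]submxK mulmx_block scalar_mx_block.
move=> /eq_block_mx[_ E12 _ E22].
rewrite -[\det (drsubmx Q)]mul1r -[1](det1 A m) -(det_ublock 1%:M (ursubmx Q)) -det_mulmx.
rewrite -{1}[P]submxK mulmx_block !mulmx1 !mulmx0 !addr0 E12 E22.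
by rewrite det_lblock det1 mulr1.
Qed.

Section Complement.
Variables (la : seq nat) (m d : nat).
Hypotheses (pla : is_part la) (la_m : (size la <= m)%N) (la_d : (head 0%N la <= d)%N).
Local Notation lc j := (count (fun p => j < p)%N la).

(* The increasing values of la_i + m - i - 1, i < m, followed by those of     *)
(* m + j - la'_j, j < d.                                                      *)
Definition cval (k : nat) : nat :=
  if (k < m)%N then (nth 0%N la (m - k.+1) + k)%N else (k - lc (k - m))%N.

Let lc_m j : (lc j <= m)%N. Proof. exact: leq_trans (count_size _ _) la_m. Qed.
Let nth_d i : (nth 0%N la i <= d)%N. Proof. exact: leq_trans (nth_le_head i pla) la_d. Qed.

Lemma cval_lt k : (k < m + d)%N -> (cval k < m + d)%N.
Proof.
rewrite /cval; case: (ltnP k m) => km; last by lia.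
have := nth_d (m - k.+1); lia.
Qed.

Lemma cval_inc a b : (a < b)%N -> (a < m)%N = (b < m)%N -> (cval a < cval b)%N.
Proof.
move=> ab; rewrite /cval; case: (ltnP a m) => am <-.
  by have := @nth_part_noninc la (m - b.+1) (m - a.+1) pla; lia.
have h : (a - m <= b - m)%N by lia.
by have := count_noninc la h; have := lc_m (b - m); have := lc_m (a - m); lia.
Qed.

(** A crossing of the two runs corresponds to a box of the diagram, by [lt_nth_count]. That the runs
    never meet makes [cval] a permutation. *)
Lemma cval_cross a j : (a < m)%N ->
  ((cval (m + j) < cval a)%N = (j < nth 0%N la (m - a.+1))%N) /\ cval (m + j) != cval a.
Proof.
move=> am; have mj : (m + j < m)%N = false by lia.
rewrite /cval am mj addKn.
have := lt_nth_count (m - a.+1) j pla; have := lc_m j; lia.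
Qed.

Lemma cval_inj a b : (a < m + d)%N -> (b < m + d)%N -> cval a = cval b -> a = b.
Proof.
wlog ab : a b / (a < b)%N => [H ad bd e|_ _ e].
  by case: (ltngtP a b) => // ab; [apply: H | apply/esym/H].
case: (boolP ((a < m)%N == (b < m)%N)) => [/eqP h|h].
  by have := cval_inc ab h; rewrite e ltnn.
have am : (a < m)%N by lia.
have mb : (m <= b)%N by lia.
by have [_] := cval_cross (b - m) am; rewrite subnKC // e eqxx.
Qed.

Fact cperm_inj : injective (fun k : 'I_(m + d) => Ordinal (cval_lt (ltn_ord k))).
Proof. by move=> a b [] /cval_inj ab; apply: val_inj; exact: ab. Qed.
Definition cperm : 'S_(m + d) := perm cperm_inj.

Lemma cpermE k : cperm k = cval k :> nat. Proof. by rewrite permE. Qed.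

(** Each run is increasing, so all inversions are crossings, one for each box of la. *)
Lemma odd_cperm : odd_perm cperm = odd (\sum_(j < d) lc j).
Proof.
rewrite sign_inversions; congr odd.
under eq_bigr => a _ do (under eq_bigr => b _ do rewrite !cpermE).
rewrite big_split_ord /= [X in (_ + X)%N]big1 ?addn0 => [|a _]; last first.
  apply: big1 => b ab; have := @cval_inc (m + a) b ab.
  by rewrite !ltnNge leq_addr /=; case: leqP => // mb; move: ab => /=; lia.
transitivity (\sum_(a < m) \sum_(j < d) (j < nth 0%N la (m - a.+1))%N)%N.
  apply: eq_bigr => a _; rewrite big_mkcond big_split_ord /= big1 ?add0n => [|b _].
    apply: eq_bigr => j _; rewrite (_ : (a < m + j)%N) ?(cval_cross j (ltn_ord a)).1 //.
    by have := ltn_ord a; lia.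
  case: ifP => // ab; have := cval_inc ab; rewrite !ltn_ord => /(_ erefl).
  by case: ltngtP.
rewrite exchange_big; apply: eq_bigr => j _ /=.
rewrite -[RHS](sum_ltn (lc_m j)) [RHS](reindex_inj rev_ord_inj) /=.
by apply: eq_bigr => i _; rewrite lt_nth_count.
Qed.

(** The Toeplitz matrices of h and of the signed e are inverse to each other. Their rows and
    columns, permuted by [cperm], give P and Q, and Jacobi's complementary minors are the two
    determinants. The sign of [cperm] cancels the signs in e. *)
Theorem dual_jacobi_trudi h e : h 0%N = 1 ->
  (forall k, \sum_(j < k.+1) h j * ((-1) ^+ (k - j) * e (k - j)%N) = (k == 0%N)%:R) ->
  Hdet h m (plus_delta m la) = Hdet e d (plus_delta d (conj_part la)).
Proof.
move=> h0 he; pose b k := (-1) ^+ k * e k.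
pose P : 'M[A]_(m + d) := \matrix_(i, q) hsub h (cval i) q.
pose Q : 'M[A]_(m + d) := \matrix_(q, i) hsub b q (cval i).
pose T : 'M[A]_(m + d) := \matrix_(p, q) hsub h p q.
have PQ : P *m Q = 1%:M.
  apply/matrixP => i k.
  have /matrixP/(_ (cperm i) (cperm k)) := @toeplitz_inv h b (m + d) he.
  rewrite !mxE (inj_eq (@perm_inj _ cperm)) => <-; apply: eq_bigr => q _.
  by rewrite !mxE !cpermE.
have detP : \det P = (-1) ^+ cperm.
  have -> : P = row_perm cperm T by apply/matrixP => i q; rewrite !mxE cpermE.
  by rewrite row_permE det_mulmx det_perm det_toeplitz // mulr1.
have P11 : \det (ulsubmx P) = Hdet h m (plus_delta m la).
  rewrite /Hdet -(det_rev (fun i j : 'I_m => hsub h (plus_delta m la i) (m - j.+1))).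
  congr (\det _); apply/matrixP => i j; rewrite !mxE /= /plus_delta /cval ltn_ord.
  have -> : (m - (m - i.+1).+1 = i)%N by have := ltn_ord i; lia.
  by have -> : (m - (m - j.+1).+1 = j)%N by have := ltn_ord j; lia.
have Q22 : \det (drsubmx Q) =
    (-1) ^+ (\sum_(j < d) lc j) * Hdet e d (plus_delta d (conj_part la)).
  rewrite -det_tr.
  (* The sign of an entry splits into a row part and a column part; together these leave (-1) to the
     number of boxes. *)
  transitivity (\det (\matrix_(j < d, k < d)
      ((-1) ^+ (lc j + j) * ((-1) ^+ k * hsub e (plus_delta d (conj_part la) j) (d - k.+1))))).
    congr (\det _); apply/matrixP => j k; rewrite !mxE /= /cval.
    have -> : (m + j < m)%N = false by lia.
    rewrite addKn.
    rewrite /plus_delta nth_conj_part // /hsub.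
    have := lc_m j; have := ltn_ord j; have := ltn_ord k => kd jd lcm.
    have -> : (m + j - lc j <= m + k)%N = (j <= lc j + k)%N by lia.
    have -> : (d - k.+1 <= lc j + (d - j.+1))%N = (j <= lc j + k)%N by lia.
    case: leqP => jk; last by rewrite !mulr0.
    have -> : (m + k - (m + j - lc j) = lc j + k - j)%N by lia.
    have -> : (lc j + (d - j.+1) - (d - k.+1) = lc j + k - j)%N by lia.
    rewrite /b mulrA -exprD; congr (_ * _); rewrite -signr_odd -[RHS]signr_odd; congr (_ ^+ _).
    by rewrite oddB // !oddD addbAC.
  rewrite det_scale_rows -det_tr.
  have -> : (\matrix_(j < d, k < d) ((-1) ^+ k * hsub e (plus_delta d (conj_part la) j) (d - k.+1)))^T
      = \matrix_(k < d, j < d) ((-1) ^+ k * hsub e (plus_delta d (conj_part la) j) (d - k.+1)) :> 'M[A]_d.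
    by apply/matrixP => j k; rewrite !mxE.
  rewrite det_scale_rows mulrA -big_split /=.
  have -> : \prod_(j < d) ((-1) ^+ (lc j + j) * (-1) ^+ j) = (-1) ^+ (\sum_(j < d) lc j) :> A.
    rewrite -prodrXr; apply: eq_bigr => j _.
    by rewrite exprD -mulrA -exprD addnn -[(-1) ^+ j.*2]signr_odd odd_double mulr1.
  congr (_ * _); rewrite -det_tr; congr (\det _); apply/matrixP => j k; by rewrite !mxE.
have := jacobi_minor PQ; rewrite detP P11 Q22 odd_cperm signr_odd mulrA -exprD addnn.
by rewrite -signr_odd odd_double mul1r => ->.
Qed.

End Complement.
End DualJacobiTrudi.

(** * Schur expansions *)

Section UnivariateSeries.
Variable A : comNzRingType.
Implicit Types (f h : nat -> A) (P : pseries A).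

Definition useries f i : pseries A :=
  PSeries (fun mu => if mu == msetn (mu i) i then f (mu i) else 0).

Lemma useriesE f i mu : useries f i mu = if mu == msetn (mu i) i then f (mu i) else 0.
Proof. by []. Qed.

Lemma coefM_useries P f i mu : (forall nu : monomial, i \in nu -> P nu = 0) ->
  (P * useries f i) mu = P (mdrop i mu) * f (mu i).
Proof.
move=> P0; rewrite ps_coefM.
have sub : (mdrop i mu `<=` mu)%mset.
  by apply/msubsetP => j; rewrite mdropE; case: eqP.
have diff : (mu `\` mdrop i mu)%mset = msetn (mu i) i.
  by apply/msetP => j; rewrite msetE2 mdropE msetnE; case: eqP => [->|_]; rewrite ?subn0 ?subnn.
rewrite (bigD1_seq (mdrop i mu)) ?in_msubs ?fset_uniq //= diff msetnxx eqxx.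
rewrite big_seq_cond big1 ?addr0 // => nu /andP[]; rewrite in_msubs => nu_mu nu_neq.
case: (boolP (i \in (nu : monomial))) => [/P0 ->|inu]; first by rewrite mul0r.
case: eqP => [e|_]; last by rewrite mulr0.
case/eqP: nu_neq; apply/msetP => j; rewrite mdropE; case: eqP => [->|ji].
  exact/mset_eq0P.
move/msetP/(_ j): e; rewrite msetE2 msetnE; case: eqP => // _ /eqP.
by rewrite subn_eq0 => le1; apply/eqP; rewrite eqn_leq le1 (msubsetP nu_mu).
Qed.

Lemma prod_useries (F : nat -> nat -> A) m mu :
  (\prod_(i < m) useries (F i) i) mu =
  if below m mu then \prod_(i < m) F i (mu i) else 0.
Proof.
elim: m mu => [|m IH] mu.
  rewrite !big_ord0 ps_coef1; case: eqP => [->|neq].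
    by case: belowP => // -[] i; rewrite in_mset0.
  case: belowP => // b0; case: neq; apply/msetP => i; rewrite mset0E; apply/mset_eq0P.
  by apply/negP => /b0.
have -> : \prod_(i < m.+1) useries (F i) i = (\prod_(i < m) useries (F i) i) * useries (F m) m.
  exact: big_ord_recr.
rewrite coefM_useries => [|nu mnu]; last first.
  by rewrite IH; case: belowP => // /(_ _ mnu); rewrite ltnn.
rewrite IH; have -> : below m (mdrop m mu) = below m.+1 mu.
  apply/below_leP/below_leP => H i mi; have := H i.
    by rewrite mdropE; case: eqP => [?|_ -> //]; [subst; lia | exact: ltnW].
  by rewrite mdropE; case: eqP => // neq; apply; lia.
case: ifP => _; last by rewrite mul0r.
rewrite big_ord_recr /=; congr (_ * _); apply: eq_bigr => i _.
by rewrite mdropE ltn_eqF.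
Qed.

Lemma coef_det_useries (F : nat -> nat -> A) m mu :
  (\det (\matrix_(i < m, j < m) useries (F j) i)) mu =
  if below m mu then \det (\matrix_(i < m, j < m) F j (mu i)) else 0.
Proof.
rewrite /determinant ps_coef_sum.
have signE (s : 'S_m) P : ((-1) ^+ s * P) mu = (-1) ^+ s * P mu.
  by case: (odd_perm s); rewrite ?expr1 ?expr0 ?mul1r ?mulN1r.
transitivity (\sum_(s : 'S_m) (-1) ^+ s *
    (if below m mu then \prod_(i < m) F (s i) (mu i) else 0)).
  apply: eq_bigr => s _; rewrite signE; congr (_ * _).
  pose G i := if insub i is Some i' then F (s i' : 'I_m) else fun=> 0.
  have GE (i : 'I_m) : G i = F (s i) by rewrite /G valK.
  transitivity ((\prod_(i < m) useries (G i) i) mu).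
    by congr (pcoef _ mu); apply: eq_bigr => i _; rewrite !mxE GE.
  by rewrite prod_useries; case: ifP => // _; apply: eq_bigr => i _; rewrite GE.
case: ifP => _; last by rewrite big1 // => s _; rewrite mulr0.
by apply: eq_bigr => s _; congr (_ * _); apply: eq_bigr => i _; rewrite mxE.
Qed.

Lemma useries_mulX h i p : useries h i * var A i ^+ p = useries (fun k => hsub h k p) i.
Proof.
elim: p => [|p IH].
  by rewrite mulr1; apply/pseriesP => mu; rewrite !useriesE /hsub leq0n subn0.
rewrite exprSr mulrA IH mulrC; apply/pseriesP => mu; rewrite ps_coefXM !useriesE.
case: (boolP (i \in mu)) => imu; last first.
  have -> : mu i = 0%N by exact/mset_eq0P.
  by rewrite /hsub; case: ifP.
have mui : (0 < mu i)%N by rewrite mset_gt0.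
rewrite msetE2 msetnxx.
have -> : ((mu `\ i)%mset == msetn (mu i - 1)%N i) = (mu == msetn (mu i) i).
  apply/eqP/eqP => [e|{1}->]; apply/msetP => x; last first.
    by rewrite msetE2 !msetnE; case: eqP.
  move/msetP/(_ x): e; rewrite msetE2 !msetnE; case: eqP => [->|_] //.
  by rewrite subn0.
case: ifP => // _; rewrite /hsub; have -> : (p <= mu i - 1)%N = (p < mu i)%N by lia.
by case: ifP => // _; congr h; lia.
Qed.

Lemma useries1 i : useries (fun k => (k == 0%N)%:R) i = 1.
Proof.
apply/pseriesP => mu; rewrite ps_coef1 useriesE.
case: (eqVneq mu mset0) => [->|neq]; first by rewrite mset0E msetn0 eqxx.
case: ifP => // /eqP e; case: eqP => // mui.
by case/eqP: neq; rewrite e mui msetn0.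
Qed.

Lemma varX_useries i p : var A i ^+ p = useries (fun k => (k == p)%:R) i.
Proof.
rewrite -[LHS]mul1r -(useries1 i).
rewrite useries_mulX; apply/pseriesP => mu; rewrite !useriesE; case: ifP => // _.
rewrite /hsub; case: leqP => pk; last by rewrite ltn_eqF.
by congr (nat_of_bool _)%:R; lia.
Qed.

(** Multiplying row i of the alternant by h(x_i) shifts its entries to hsub coefficients, so each
    coefficient of the product is itself a determinant. *)
Lemma vandermonde_prod_useries h m mu :
  (vandermonde A m * \prod_(i < m) useries h i) mu = if below m mu then Hdet h m mu else 0.
Proof.
rewrite vandermondeE mulrC -det_scale_rows.
have -> : \matrix_(i < m, j < m) (useries h i * var A i ^+ (m - j.+1)) =
    \matrix_(i < m, j < m) useries (fun k => hsub h k (m - j.+1)) i.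
  by apply/matrixP => i j; rewrite !mxE useries_mulX.
exact: (coef_det_useries (fun j k => hsub h k (m - j.+1))).
Qed.

(** The coefficient of \prod_i x_i ^ (l i) in the alternant with exponents la + delta, the numerator
    of s_la. *)
Definition Adet m la (l : nat -> nat) : A :=
  \det (\matrix_(i < m, j < m) (l i == plus_delta m la j)%:R).

Lemma Gnum00E m la mu : Gnum (0 : A) 0 m la mu = if below m mu then Adet m la mu else 0.
Proof.
have -> : Gnum (0 : A) 0 m la =
    \det (\matrix_(i < m, j < m) useries (fun k => (k == plus_delta m la j)%:R) i).
  congr (\det _); apply/matrixP => i j; rewrite !mxE.
  have -> : geom (0 : A) i = 1 by have := geomK (0 : A) i; rewrite scale0r subr0 mulr1.
  by rewrite scale0r addr0 !expr1n !mulr1 varX_useries.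
exact: (coef_det_useries (fun j k => (k == plus_delta m la j)%:R)).
Qed.

End UnivariateSeries.

Section Alternating.
Variables (R : comNzRingType) (m : nat) (D : (nat -> nat) -> R) (s : nat).
Hypothesis D_ext : forall l l', (forall i, (i < m)%N -> l i = l' i) -> D l = D l'.
Hypothesis D_alt : forall l i, (i.+1 < m)%N -> l i = l i.+1 -> D l = 0.
Hypothesis D_swap : forall l i, (i.+1 < m)%N -> D (fun j => l (swap i j)) = - D l.
Hypothesis D_part : forall la, is_part la -> (size la <= m)%N ->
  (\sum_(i < m) plus_delta m la i = s)%N -> D (plus_delta m la) = 0.

(** Sorting l by adjacent exchanges only changes signs. A repeated value gives 0, and a strictly
    decreasing l is la + delta for some partition la. *)
Lemma alternating_eq0 (l : nat -> nat) : (\sum_(i < m) l i = s)%N -> D l = 0.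
Proof.
have [M] := ubnP (\sum_(j < m) j * l j); elim: M l => // M IHM l lM ls.
case: (boolP [exists i : 'I_m, (i.+1 < m)%N && (l i < l i.+1)%N]) => [/existsP[i /andP[id lt_l]]|].
  apply/eqP; rewrite -oppr_eq0 -(D_swap _ id); apply/eqP/IHM.
    by have := sum_swap_lt id lt_l; lia.
  by rewrite (sum_swap l id).
rewrite negb_exists => /forallP noasc.
case: (boolP [exists i : 'I_m, (i.+1 < m)%N && (l i == l i.+1)]) => [/existsP[i /andP[id /eqP]]|].
  exact: D_alt.
rewrite negb_exists => /forallP noeq.
have dec i : (i.+1 < m)%N -> (l i.+1 < l i)%N.
  move=> id; have := noasc (Ordinal (ltnW id)); have := noeq (Ordinal (ltnW id)).
  by rewrite /= id /=; lia.
have l_ge j : (j < m)%N -> (m - j.+1 <= l j)%N.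
  have [k] := ubnP (m - j); elim: k j => // k IHk j kj jd.
  case: (ltnP j.+1 m) => [j1d|]; last by lia.
  by have := dec j j1d; have := IHk j.+1 _ j1d; lia.
have [|la [pla szla laE]] := @exists_part m (fun j => l j - (m - j.+1))%N.
  by move=> j jd; have := dec j jd; lia.
have lE j : (j < m)%N -> l j = plus_delta m la j.
  by move=> jm; rewrite /plus_delta laE // subnK ?l_ge.
rewrite (D_ext lE); apply: D_part => //.
by rewrite -ls; apply: eq_bigr => i _; rewrite lE.
Qed.

End Alternating.

Lemma increasing_perm m (s : 'S_m) : (forall i j : 'I_m, (i < j)%N -> (s i < s j)%N) -> s = 1%g.
Proof.
move=> inc.
have le_s (i : 'I_m) : (i <= s i)%N.
  case: i => i; elim: i => // i IH im; have lt_s := inc (Ordinal (ltnW im)) (Ordinal im) (ltnSn i).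
  exact: leq_ltn_trans (IH (ltnW im)) lt_s.
apply/permP => i; rewrite perm1; apply: val_inj => /=.
apply/eqP; rewrite eqn_leq le_s andbT leqNgt; apply/negP => lt_i.
have : (\sum_(j < m) j = \sum_(j < m) s j)%N by rewrite (reindex_inj (@perm_inj _ s)).
rewrite (bigD1 i) //= [RHS](bigD1 i) //= => e.
have : (\sum_(j < m | j != i) j <= \sum_(j < m | j != i) s j)%N by apply: leq_sum => j _.
move: e lt_i; set u := bigop _ _ _; set v := bigop _ _ _; move: u v (nat_of_ord (s i)) (nat_of_ord i) => u v x y; lia.
Qed.

Lemma part_eq la la' : is_part la -> is_part la' ->
  (forall i, nth 0%N la i = nth 0%N la' i) -> la = la'.
Proof.
move=> pla pla' e.
have le_size l1 l2 : is_part l2 -> (forall i, nth 0%N l1 i = nth 0%N l2 i) ->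
    (size l2 <= size l1)%N.
  move=> /andP[_ l2N] e12; rewrite leqNgt; apply/negP => lt12.
  by have := mem_nth 0%N lt12; rewrite -e12 nth_default // (negPf l2N).
apply: (@eq_from_nth _ 0%N) => [|i _]; last exact: e.
by apply/eqP; rewrite eqn_leq !le_size.
Qed.

Lemma plus_delta_dec m la i j : is_part la -> (i < j < m)%N ->
  (plus_delta m la j < plus_delta m la i)%N.
Proof.
by move=> pla /andP[ij jm]; rewrite /plus_delta; have := nth_part_noninc pla (ltnW ij); lia.
Qed.

Lemma sum_nth_part m la : (size la <= m)%N -> (\sum_(i < m) nth 0%N la i = sumn la)%N.
Proof.
elim: la m => [|p la IH] [|m] //= szm; first by rewrite big_ord0.
  by rewrite big1 // => i _; rewrite nth_nil.
by rewrite big_ord_recl /= IH.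
Qed.

Lemma sum_plus_delta m la : (size la <= m)%N ->
  (\sum_(i < m) plus_delta m la i = sumn la + \sum_(i < m) (m - i.+1))%N.
Proof. by move=> szm; rewrite big_split /= sum_nth_part. Qed.

(** A finite list containing all partitions of size at most N, and some larger ones. *)
Definition parts (N : nat) : seq (seq nat) :=
  undup [seq la <- flatten [seq [seq [seq val i | i <- tval t] | t : k.-tuple 'I_N.+1] | k <- iota 0 N.+1]
        | is_part la].

Lemma parts_part N la : la \in parts N -> is_part la.
Proof. by rewrite mem_undup mem_filter => /andP[]. Qed.

Lemma mem_parts N la : is_part la -> (sumn la <= N)%N -> la \in parts N.
Proof.
move=> pla sla; rewrite mem_undup mem_filter pla andTb.
have nz : 0%N \notin la by case/andP: pla.
have szla : (size la <= N)%N.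
  apply: leq_trans sla; elim: la nz {pla} => //= p la IH; rewrite in_cons negb_or => /andP[p0 /IH].
  by lia.
have le_la x : x \in la -> (x < N.+1)%N.
  move=> xla; rewrite ltnS; apply: leq_trans sla; elim: la xla {pla nz szla} => //= p la IH.
  by rewrite in_cons => /orP[/eqP ->|/IH]; lia.
apply/flattenP; exists [seq [seq val i | i <- tval t] | t : (size la).-tuple 'I_N.+1].
  by apply/mapP; exists (size la); rewrite // mem_iota.
apply/mapP; exists [tuple of [seq inord i | i <- in_tuple la]]; first exact: mem_enum.
rewrite /= -map_comp -[LHS]map_id; apply/eq_in_map => x xla /=.
by rewrite inordK ?le_la.
Qed.

Definition deg m (mu : monomial) : nat := (\sum_(i < m) mu i)%N.

Section AlternantDeterminants.
Variable R : comNzRingType.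
Implicit Types (la : seq nat) (l : nat -> nat).

Lemma Hdet_ext (h : nat -> R) m l l' : (forall i, (i < m)%N -> l i = l' i) -> Hdet h m l = Hdet h m l'.
Proof. by move=> e; congr (\det _); apply/matrixP => i j; rewrite !mxE e. Qed.

Lemma det_rows_alt m (F : nat -> nat -> R) l i : (i.+1 < m)%N -> l i = l i.+1 ->
  \det (\matrix_(a < m, j < m) F (l a) j) = 0.
Proof.
move=> im e; apply: (@determinant_alternate _ _ _ (Ordinal (ltnW im)) (Ordinal im)).
  by rewrite -val_eqE /=; lia.
by move=> j; rewrite !mxE /= e.
Qed.

Lemma det_rows_swap m (F : nat -> nat -> R) l i : (i.+1 < m)%N ->
  \det (\matrix_(a < m, j < m) F (l (swap i a)) j) = - \det (\matrix_(a < m, j < m) F (l a) j).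
Proof.
move=> im; pose s := tperm (Ordinal (ltnW im)) (Ordinal im).
have -> : \matrix_(a < m, j < m) F (l (swap i a)) j = row_perm s (\matrix_(a < m, j < m) F (l a) j).
  apply/matrixP => k j; rewrite !mxE /s.
  case: tpermP => [->|->|/eqP + /eqP]; rewrite /= ?swapl ?swapr //.
  by rewrite -!val_eqE /= /swap => /negPf -> /negPf ->.
rewrite row_permE det_mulmx det_perm odd_tperm -val_eqE /=.
have -> : (i == i.+1) = false by lia.
by rewrite expr1 mulN1r.
Qed.

Lemma Adet_part m la la' : is_part la -> is_part la' -> (size la <= m)%N -> (size la' <= m)%N ->
  Adet R m la (plus_delta m la') = (la == la')%:R.
Proof.
move=> pla pla' sla sla'; rewrite /Adet /determinant.
have term (s : 'S_m) : \prod_(i < m) (\matrix_(i < m, j < m)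
      (plus_delta m la' i == plus_delta m la j)%:R : 'M[R]_m) i (s i)
    = ((s == 1%g) && (la == la'))%:R.
  case: (boolP [forall i : 'I_m, plus_delta m la' i == plus_delta m la (s i)]) => [/forallP H|].
    rewrite big1 => [|i _]; last by rewrite mxE (eqP (H i)) eqxx.
    have s1 : s = 1%g.
      apply: increasing_perm => i j ij; rewrite ltnNge; apply/negP => sij.
      have := @plus_delta_dec m la' i j pla'; rewrite ij ltn_ord (eqP (H i)) (eqP (H j)) => /(_ isT).
      case: (ltngtP (s j) (s i)) sij => // [lt_s|/val_inj/perm_inj e] _; last by move: ij; rewrite e ltnn.
      by have := @plus_delta_dec m la (s j) (s i) pla; rewrite lt_s ltn_ord => /(_ isT); lia.
    rewrite s1 eqxx /=; suff -> : la = la' by rewrite eqxx.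
    apply: part_eq => // i; case: (ltnP i m) => im; last by rewrite !nth_default // (leq_trans _ im).
    by move/eqP: (H (Ordinal im)); rewrite s1 perm1 /plus_delta => /addIn.
  rewrite negb_forall => /existsP[i Hi]; rewrite (bigD1 i) //= mxE (negPf Hi) mul0r.
  case: eqP => //= s1; case: eqP => //= e; move: Hi; by rewrite s1 perm1 e eqxx.
rewrite (eq_bigr _ (fun s _ => congr1 ( *%R _) (term s))) (bigD1 1%g) //= big1 ?addr0.
  by rewrite eqxx odd_perm1 expr0 mul1r.
by move=> s /negPf ->; rewrite mulr0.
Qed.

Lemma Adet_deg m la l : Adet R m la l != 0 ->
  (\sum_(i < m) l i = \sum_(i < m) plus_delta m la i)%N.
Proof.
apply: contraNeq => neq; apply/eqP; rewrite /Adet /determinant big1 // => s _.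
case: (boolP [forall i : 'I_m, l i == plus_delta m la (s i)]) => [/forallP H|].
  case/eqP: neq; rewrite [RHS](reindex_inj (@perm_inj _ s)) /=.
  by apply: eq_bigr => i _; exact/eqP/H.
by rewrite negb_forall => /existsP[i Hi]; rewrite (bigD1 i) //= mxE (negPf Hi) mul0r mulr0.
Qed.

End AlternantDeterminants.

Section SchurSums.
Variable R : comNzRingType.
Implicit Types (la : seq nat) (f : pseries R) (c : seq nat -> R).

Lemma schurE la : schur R la = Gpart 0 0 la.
Proof.
rewrite /schur /Gpart; congr ps_lim; apply/funext => m; rewrite /Gpart_fin.
congr (ps_quo (\det _) _); apply/matrixP => i j; rewrite !mxE varE ps_quo_geom.
have -> : geom (0 : R) i = 1 by have := geomK (0 : R) i; rewrite scale0r subr0 mulr1.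
by rewrite scale0r addr0 !expr1n !mulr1.
Qed.

Lemma vandermonde_schur m la mu : (size la <= m)%N ->
  (vandermonde R m * trunc m (schur R la)) mu = if below m mu then Adet R m la mu else 0.
Proof. by move=> sla; rewrite schurE trunc_GpartM // Gnum00E. Qed.

(** With one variable fewer than la has parts, the last row of the numerator vanishes, as every
    exponent in it is positive. *)
Lemma trunc_schur0 m la : is_part la -> (m < size la)%N -> trunc m (schur R la) = 0.
Proof.
move=> pla; case szla : (size la) => [|M]; [by rewrite ltn0 | rewrite ltnS => mM].
suff s0 : trunc M (schur R la) = 0.
  by rewrite -(minn_idPl mM) -trunc_trunc s0 trunc0.
apply: (regular_inj (regularM (@regular_prod_var R M) (@regular_vandermonde R M))).
have e : trunc M (vandermonde R M.+1 * trunc M.+1 (schur R la)) = 0.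
  rewrite schurE trunc_GpartM ?szla // /Gnum trunc_det (expand_det_row _ ord_max) big1 // => j _.
  rewrite !mxE !truncM !truncX trunc_var ltnn.
  have nz : (0 < nth 0%N la j)%N.
    rewrite lt0n; apply/eqP => e; have : (j < size la)%N by rewrite szla.
    by move=> /(mem_nth 0%N); rewrite e; case/andP: pla => _ /negPf ->.
  by rewrite expr0n /= addn_eq0 (gtn_eqF nz) /= !mul0r.
by move: e; rewrite truncM trunc_vandermondeS trunc_trunc (minn_idPl (leqnSn M)) mulr0.
Qed.

Definition hom_part m k f : pseries R := PSeries (fun mu => if deg m mu == k then f mu else 0).

Lemma deg_sub m (mu nu : monomial) : (nu `<=` mu)%mset ->
  (deg m mu = deg m nu + deg m (mu `\` nu)%mset)%N.
Proof.
move=> /msubsetP sub; rewrite /deg -big_split /=; apply: eq_bigr => i _.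
by rewrite msetE2 subnKC.
Qed.

Lemma hom_partM m (G : pseries R) D k f : (forall mu, G mu != 0 -> deg m mu = D) ->
  G * hom_part m k f = hom_part m (D + k)%N (G * f).
Proof.
move=> GD; apply/pseriesP => mu.
rewrite -[RHS]/(if deg m mu == (D + k)%N then (G * f) mu else 0) !ps_coefM.
have e nu : nu \in msubs mu -> G nu * hom_part m k f (mu `\` nu)%mset =
    if deg m mu == (D + k)%N then G nu * f (mu `\` nu)%mset else 0.
  rewrite in_msubs => sub; case: (eqVneq (G nu) 0) => [->|/GD Gnu].
    by rewrite !mul0r; case: ifP.
  by rewrite (deg_sub m sub) Gnu eqn_add2l /=; case: ifP; rewrite ?mulr0.
rewrite big_seq (eq_bigr _ e) -big_seq; case: ifP => // _; exact: big1.
Qed.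

(** Numerator and Vandermonde product are homogeneous; a component of s_la in any other degree is
    killed by the regular Vandermonde product. *)
Lemma schur_deg m la mu : below m mu -> schur R la mu != 0 -> deg m mu = sumn la.
Proof.
wlog sla : m / (size la <= m)%N => [H bmu|bmu snz].
  have bmu' := below_le (leq_maxl m (size la)) bmu.
  move=> /(H _ (leq_maxr m (size la)) bmu') <-.
  rewrite /deg (big_ord_widen (maxn m (size la)) mu (leq_maxl _ _)) big_mkcond /=.
  by apply: eq_bigr => i _; case: ltnP => // mi; rewrite (below_leP _ _ bmu).
apply/eqP; apply: contraNT snz => neq.
have vdeg nu : vandermonde R m nu != 0 -> deg m nu = (\sum_(i < m) (m - i.+1))%N.
  rewrite -(Gnum_nil m (0 : R) 0) Gnum00E; case: ifP => [_|]; last by rewrite eqxx.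
  by move=> /Adet_deg e; rewrite /deg e sum_plus_delta.
suff /pseriesP/(_ mu) : hom_part m (deg m mu) (trunc m (schur R la)) = 0.
  by rewrite /= eqxx bmu => ->.
apply: (@regular_vandermonde R m); rewrite (hom_partM _ _ vdeg).
apply/pseriesP => nu; rewrite -[LHS]/(if _ == _ then (_ * _ : pseries R) nu else 0).
rewrite vandermonde_schur //; case: eqP => // dnu; case: ifP => // bnu.
apply/eqP; apply: contraNT neq => /Adet_deg.
rewrite -/(deg m nu) dnu sum_plus_delta // addnC => /addIn ->; exact: eqxx.
Qed.

Lemma schur_sumE c m N mu : below m mu -> (deg m mu <= N)%N ->
  schur_sum c mu = \sum_(la <- parts N) c la * schur R la mu.
Proof.
move=> bmu dN.
rewrite -[LHS]/(\sum_(la \in [set la | is_part la]%classic) c la * schur R la mu) (fsbigE (parts N)).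
- rewrite big_seq_cond [RHS]big_seq; apply: eq_bigl => la; rewrite andb_idr //.
  by move=> /parts_part pla; apply/mem_set.
- exact: undup_uniq.
- by move=> la /parts_part.
move=> la pla lN; apply/eqP; apply: contraNT lN => nz; apply: mem_parts => //.
rewrite -(schur_deg bmu) //; apply: contraNneq nz => snz.
by rewrite snz mulr0.
Qed.

Lemma vandermonde_schur_sum c m mu : below m mu ->
  (vandermonde R m * trunc m (schur_sum c)) mu =
  \sum_(la <- parts (deg m mu) | (size la <= m)%N) c la * Adet R m la mu.
Proof.
move=> bmu.
have -> : (vandermonde R m * trunc m (schur_sum c)) mu =
    \sum_(la <- parts (deg m mu)) c la * (vandermonde R m * trunc m (schur R la)) mu.
  rewrite ps_coefM; under [RHS]eq_bigr => la _ do rewrite ps_coefM mulr_sumr.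
  rewrite exchange_big big_seq [RHS]big_seq; apply: eq_bigr => nu; rewrite in_msubs => sub.
  have bnu := below_sub (msubsetDl mu nu) bmu.
  have dnu : (deg m (mu `\` nu)%mset <= deg m mu)%N by rewrite (deg_sub m sub) leq_addl.
  have -> : trunc m (schur_sum c) (mu `\` nu)%mset = schur_sum c (mu `\` nu)%mset.
    by rewrite -[LHS]/(if _ then _ else _) bnu.
  rewrite (schur_sumE c bnu dnu) mulr_sumr; apply: eq_bigr => la _.
  rewrite mulrCA; congr (_ * (_ * _)).
  by rewrite -[RHS]/(if _ then _ else _) bnu.
rewrite [RHS]big_mkcond big_seq [RHS]big_seq; apply: eq_bigr => la /parts_part pla.
case: leqP => sla; first by rewrite vandermonde_schur // bmu.
by rewrite trunc_schur0 // mulr0 mulr0.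
Qed.

Lemma sum_parts_part c N m la : is_part la -> (size la <= m)%N -> (sumn la <= N)%N ->
  \sum_(la' <- parts N | (size la' <= m)%N) c la' * Adet R m la' (plus_delta m la) = c la.
Proof.
move=> pla sla laN; rewrite big_mkcond (bigD1_seq la) ?undup_uniq ?mem_parts //= sla.
rewrite Adet_part // eqxx mulr1 big_seq_cond big1 ?addr0 // => la' /andP[/parts_part pla' neq].
by case: ifP => // sla'; rewrite Adet_part // (negPf neq) mulr0.
Qed.

(** The coefficient of x^(la + delta) in the Vandermonde product times the sum isolates c la. *)
Lemma schur_sum_inj c c' la : schur_sum c = schur_sum c' -> is_part la -> c la = c' la.
Proof.
move=> e pla; pose m := size la.
pose mu : monomial := mset_of (fun i : 'I_m => plus_delta m la i).
have muE i : (i < m)%N -> mu i = plus_delta m la i.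
  by move=> im; rewrite mset_ofE (insubT (fun j => j < m)%N im).
have bmu : below m mu by apply/below_leP => i mi; rewrite mset_ofE insubF // ltnNge mi.
have dN : (sumn la <= deg m mu)%N.
  have -> : deg m mu = (\sum_(i < m) plus_delta m la i)%N by apply: eq_bigr => i _; rewrite muE.
  by rewrite sum_plus_delta // leq_addr.
have coefE c1 : (vandermonde R m * trunc m (schur_sum c1)) mu = c1 la.
  rewrite vandermonde_schur_sum // -[RHS](sum_parts_part c1 pla (leqnn _) dN).
  apply: eq_bigr => la' _; congr (_ * _).
  by congr (\det _); apply/matrixP => i j; rewrite !mxE muE.
by rewrite -coefE e coefE.
Qed.

(* An alternating function of mu is determined by its values at la + delta.    *)
Theorem schur_sum_recognition f c (D : nat -> (nat -> nat) -> R) :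
  (forall m l l', (forall i, (i < m)%N -> l i = l' i) -> D m l = D m l') ->
  (forall m l i, (i.+1 < m)%N -> l i = l i.+1 -> D m l = 0) ->
  (forall m l i, (i.+1 < m)%N -> D m (fun j => l (swap i j)) = - D m l) ->
  (forall m la, is_part la -> (size la <= m)%N -> D m (plus_delta m la) = c la) ->
  (forall m mu, below m mu -> (vandermonde R m * trunc m f) mu = D m mu) ->
  f = schur_sum c.
Proof.
move=> D_ext D_alt D_swap D_part fD; apply: (@eq_trunc _ _ _ 0%N) => m _.
apply: (regular_inj (@regular_vandermonde R m)); apply/pseriesP => mu.
case: (boolP (below m mu)) => [bmu|/negPf bmu]; last first.
  rewrite -[vandermonde R m]trunc_vandermonde -!truncM.
  by rewrite -[LHS]/(if _ then _ else _) -[RHS]/(if _ then _ else _) bmu.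
rewrite fD // vandermonde_schur_sum //; apply/eqP; rewrite -subr_eq0; apply/eqP.
pose D' l := D m l - \sum_(la <- parts (deg m mu) | (size la <= m)%N) c la * Adet R m la l.
rewrite -/(D' mu); apply: (@alternating_eq0 _ m D' (deg m mu)) => //.
- move=> l l' e; rewrite /D' (D_ext _ _ _ e); congr (_ - _); apply: eq_bigr => la _.
  by congr (_ * \det _); apply/matrixP => i j; rewrite !mxE e.
- move=> l i im e; rewrite /D' (D_alt _ _ _ im e) big1 ?subrr // => la _.
  by rewrite /Adet (det_rows_alt (fun p j => (p == plus_delta m la j)%:R) im e) mulr0.
- move=> l i im; rewrite /D' D_swap // opprB addrC; congr (_ - _).
  rewrite -sumrN; apply: eq_bigr => la _.
  rewrite -mulrN; congr (_ * _); rewrite /Adet.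
  by rewrite (det_rows_swap (fun p j => (p == plus_delta m la j)%:R) l im) opprK.
move=> la pla sla dla; rewrite /D' D_part // sum_parts_part ?subrr //.
by rewrite -dla sum_plus_delta // leq_addr.
Qed.

End SchurSums.

(** * The involution omega *)

Section Convolution.
Variable A : comNzRingType.
Implicit Types (f h : nat -> A).

Definition conv f h k : A := \sum_(j < k.+1) f j * h (k - j)%N.

Fixpoint cpow f m : nat -> A := if m is m'.+1 then conv f (cpow f m') else fun k => (k == 0%N)%:R.

Lemma useries_msetn f i k : useries f i (msetn k i) = f k.
Proof. by rewrite useriesE msetnxx eqxx. Qed.

Lemma useriesM f h i : useries f i * useries h i = useries (conv f h) i.
Proof.
apply/pseriesP => mu; rewrite useriesE; case: eqP => [{1}->|muN].
  rewrite ps_coefM_msetn; apply: eq_bigr => j _; congr (_ * _); exact: useries_msetn.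
rewrite ps_coefM big_seq big1 // => nu; rewrite in_msubs => sub; rewrite !useriesE.
case: eqP => [e1|_]; last by rewrite mul0r.
case: eqP => [e2|_]; last by rewrite mulr0.
case: muN; apply/msetP => j; have := msubsetP sub j; rewrite msetnE.
move/msetP/(_ j): e1; move/msetP/(_ j): e2; rewrite !msetE2 !msetnE.
by case: eqP => [->//|_] e1 e2; lia.
Qed.

Lemma useriesX f i m : useries f i ^+ m = useries (cpow f m) i.
Proof.
elim: m => [|m IH]; first by rewrite expr0 -(useries1 A i).
by rewrite exprS IH useriesM.
Qed.

Lemma useries_lin N (c : nat -> A) (F : nat -> nat -> A) i :
  \sum_(m < N) c m *: useries (F m) i = useries (fun k => \sum_(m < N) c m * F m k) i.
Proof.
apply/pseriesP => mu; rewrite ps_coef_sum useriesE.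
under eq_bigr => m _ do rewrite ps_coefZ useriesE.
by case: ifP => // _; rewrite big1 // => m _; rewrite mulr0.
Qed.

Definition twist f k : A := (-1) ^+ k * f k.

Lemma conv_twist f h k : conv (twist f) (twist h) k = twist (conv f h) k.
Proof.
rewrite /conv /twist mulr_sumr; apply: eq_bigr => j _.
by rewrite mulrACA -exprD subnKC // -ltnS.
Qed.

Lemma cpow_twist f m k : cpow (twist f) m k = twist (cpow f m) k.
Proof.
elim: m k => [|m IH] k; first by rewrite /twist /=; case: k => [|k]; rewrite ?mul1r ?mulr0.
rewrite -[RHS]conv_twist; apply: eq_bigr => j _; congr (_ * _); exact: IH.
Qed.

(** Substituting -x for x in f(x) h(-x) = 1. *)
Lemma conv_twistC f h k : conv f (twist h) k = (k == 0%N)%:R -> conv h (twist f) k = (k == 0%N)%:R.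
Proof.
move=> e; have -> : conv h (twist f) k = (-1) ^+ k * conv f (twist h) k; last first.
  by rewrite e; case: k {e} => [|k]; rewrite ?mul1r ?mulr0.
rewrite /conv /twist mulr_sumr [RHS](reindex_inj rev_ord_inj); apply: eq_bigr => j _ /=.
rewrite subSS subKn; last by rewrite -ltnS.
have -> : (-1) ^+ k = (-1) ^+ (k - j)%N * (-1) ^+ j :> A by rewrite -exprD subnK // -ltnS.
rewrite -[LHS]mul1r; have {1}<- : (-1) ^+ j * (-1) ^+ j = 1 :> A.
  by rewrite -exprD addnn -signr_odd odd_double.
ring.
Qed.

(** The coefficients of x / (1 - c x). *)
Definition yser (c : A) k : A := hsub (fun j => c ^+ j) k 1.

Lemma varM_geom c i : var A i * geom c i = useries (yser c) i.
Proof.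
rewrite mulrC -(useries_mulX _ i 1); congr (_ * _).
by apply/pseriesP => mu; rewrite useriesE /geom unlock.
Qed.

Lemma twist_yser c k : twist (yser c) k = - yser (- c) k.
Proof.
rewrite /twist /yser /hsub; case: k => [|k]; first by rewrite mulr0 oppr0.
by rewrite subn1 /= exprS (exprNn c) mulN1r mulNr.
Qed.

Lemma cpow0 f m : f 0%N = 0 -> cpow f m 0 = (m == 0%N)%:R.
Proof. by case: m => [|m] f0 //=; rewrite /conv big_ord1 f0 mul0r. Qed.

End Convolution.

Section Operators.
Variables (R : comNzRingType) (g : R) (d : nat).
Local Notation C := (bicom g d).
Local Notation sc := (scal g d).

Lemma map_yvar c i : map_ps sc (yvar c i) = useries (yser (sc c)) i.
Proof. by rewrite /yvar map_psM map_ps_var map_ps_geom varM_geom. Qed.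

Definition hcoef (a : R) k : C := \sum_(m < d.+1) hC g d m * cpow (yser (sc a)) m k.
Definition ecoef (b : R) k : C := \sum_(m < d.+1) hbC g d m * cpow (yser (sc b)) m k.

Lemma Aser_useries a i : Aser (map_ps sc (yvar a i)) = useries (hcoef a) i.
Proof.
rewrite map_yvar /Aser -(useries_lin _ (hC g d) (cpow (yser (sc a)))).
by apply: eq_bigr => m _; rewrite useriesX.
Qed.

Lemma Abar_useries b i : Abar (map_ps sc (yvar b i)) = useries (ecoef b) i.
Proof.
rewrite map_yvar /Abar -(useries_lin _ (hbC g d) (cpow (yser (sc b)))).
by apply: eq_bigr => m _; rewrite useriesX.
Qed.

(** -x/(1 + b x) is x/(1 - b x) evaluated at -x. *)
Lemma Abar_twist b i : Abar (- map_ps sc (yvar (- b) i)) = useries (twist (ecoef b)) i.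
Proof.
have -> : - map_ps sc (yvar (- b) i) = useries (twist (yser (sc b))) i.
  rewrite map_yvar rmorphN; apply/pseriesP => mu.
  rewrite -[LHS]/(- (useries _ i mu)) !useriesE; case: ifP => _; last by rewrite oppr0.
  by rewrite twist_yser.
transitivity (useries (fun k => \sum_(m < d.+1) hbC g d m * cpow (twist (yser (sc b))) m k) i).
  rewrite -(useries_lin _ (hbC g d) (cpow (twist (yser (sc b))))).
  by apply: eq_bigr => m _; rewrite useriesX.
apply/pseriesP => mu; rewrite !useriesE; case: ifP => // _; rewrite /twist /ecoef mulr_sumr.
by apply: eq_bigr => m _; rewrite cpow_twist mulrCA.
Qed.

Lemma hcoef0 a : hcoef a 0 = 1.
Proof.
rewrite /hcoef big_ord_recl big1 => [|m _]; last by rewrite cpow0 ?mulr0.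
by rewrite cpow0 // hC0 mul1r addr0.
Qed.

Lemma ecoef0 b : ecoef b 0 = 1.
Proof.
rewrite /ecoef big_ord_recl big1 => [|m _]; last by rewrite cpow0 ?mulr0.
by rewrite cpow0 // hbC0 mul1r addr0.
Qed.

Lemma hcoef_ecoef a b k : a + b = g -> conv (hcoef a) (twist (ecoef b)) k = (k == 0%N)%:R.
Proof.
move=> abg; have /pseriesP/(_ (msetn k 0%N)) := AserAbar d (geom_rel 0 abg).
rewrite -/(yvar a 0) -/(yvar (- b) 0) Aser_useries Abar_twist useriesM useries_msetn => ->.
rewrite ps_coef1; congr (nat_of_bool _)%:R; apply/eqP/eqP => [/msetP/(_ 0%N)|->].
  by rewrite msetnxx mset0E.
exact: msetn0.
Qed.

Lemma entry_prodb w (e : nat -> nat) m :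
  entry w (\prod_(i < m) hbC g d (e i)) = hprod g (rev (iota 0 d)) e m w.
Proof.
rewrite /entry; have -> : (\prod_(i < m) hbC g d (e i)) (T1 R) = hprod g (rev (iota 0 d)) e m; last by [].
elim: m => [|m IH]; first by rewrite big_ord0.
have -> : \prod_(i < m.+1) hbC g d (e i) = hbC g d (e m) * \prod_(i < m) hbC g d (e i).
  exact: etrans (big_ord_recr _ _) (mulrC _ _).
by rewrite bcME IH.
Qed.

Lemma map_entry_prod w m (c : nat -> C) (y : nat -> pseries R) :
  map_ps (entry w) (\prod_(i < m) \sum_(k < d.+1) c k *: map_ps sc (y i) ^+ k) =
  \sum_(s : {ffun 'I_m -> 'I_d.+1})
    entry w (\prod_(i < m) c (s i)) *: \prod_(i < m) y i ^+ s i.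
Proof.
rewrite bigA_distr_bigA map_ps_sum; apply: eq_bigr => s _; apply/pseriesP => mu.
rewrite scaler_prod.
rewrite -[X in _ *: X](_ : map_ps sc (\prod_(i < m) y i ^+ s i) = _); last first.
  by rewrite map_ps_prod; apply: eq_bigr => i _; rewrite map_psX.
rewrite map_psE !ps_coefZ map_psE; set u := bigop _ _ _.
by rewrite [RHS]mulrC -[RHS](@entry_scal _ g d) mulrC.
Qed.

Lemma entry_Aser_inv w m (y : nat -> pseries R) :
  map_ps (entry (npinv w)) (\prod_(i < m) Aser (map_ps sc (y i))) =
  map_ps (entry w) (\prod_(i < m) Abar (map_ps sc (y i))).
Proof.
rewrite !map_entry_prod; apply: eq_bigr => s _; congr (_ *: _).
pose e : nat -> nat := mset_of (fun i => s i : nat).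
have eE (i : 'I_m) : s i = e i :> nat by rewrite /e mset_ofE valK.
have -> : \prod_(i < m) hC g d (s i) = \prod_(i < m) hC g d (e i).
  by apply: eq_bigr => i _; rewrite eE.
have -> : \prod_(i < m) hbC g d (s i) = \prod_(i < m) hbC g d (e i).
  by apply: eq_bigr => i _; rewrite eE.
by rewrite entry_prod entry_prodb hprod_rev.
Qed.

(** The coefficients of the product times the Vandermonde product are alternating, so
    [schur_sum_recognition] needs only their values at la + delta, the Jacobi-Trudi determinants. *)
Lemma schur_expansion (f : pseries R) w (h : nat -> C) c :
  (forall m, trunc m f = map_ps (entry w) (\prod_(i < m) useries h i)) ->
  (forall m la, is_part la -> (size la <= m)%N -> entry w (Hdet h m (plus_delta m la)) = c la) ->
  f = schur_sum c.
Proof.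
move=> fE hc; apply: (@schur_sum_recognition _ _ _ (fun m l => entry w (Hdet h m l))) => //.
- by move=> m l l' e; rewrite (Hdet_ext _ e).
- move=> m l i im e; rewrite /Hdet.
  by rewrite (det_rows_alt (fun p j => hsub h p (m - j.+1)) im e) entry0.
- move=> m l i im; rewrite /Hdet.
  by rewrite (det_rows_swap (fun p j => hsub h p (m - j.+1)) l im) raddfN.
move=> m mu bmu; rewrite fE -(@map_ps_linear _ _ sc); last exact: entry_scal.
by rewrite map_ps_vandermonde map_psE vandermonde_prod_useries bmu.
Qed.

End Operators.

Lemma schur_sum_ext (R : comNzRingType) (c c' : seq nat -> R) :
  (forall la, is_part la -> c la = c' la) -> schur_sum c = schur_sum c'.
Proof.
move=> e; apply/pseriesP => mu; apply: eq_fsbigr => la; rewrite inE => /e -> //.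
Qed.

(** Whichever expansion [schur_coef] picks, it agrees with c on partitions, and no other values
    enter the sum. *)
Lemma omega_schur_sum (R : comNzRingType) (c : seq nat -> R) :
  omega (schur_sum c) = schur_sum (fun la => c (conj_part la)).
Proof.
apply: schur_sum_ext => la pla; apply: schur_sum_inj (is_part_conj pla).
by apply: (@xgetPex _ (fun=> 0) [set c' | schur_sum c' = schur_sum c]%classic); exists c.
Qed.

(** * The action of omega, and the theorem *)

Section Main.
Variables (R : comNzRingType) (a b : R) (n : nat) (w : 'S_n).
Hypothesis n_gt0 : (0 < n)%N.

Theorem omega_Gperm : omega (Gperm a b w) = Gperm b a (w^-1)%g.
Proof.
pose h := hcoef (a + b) n.-1 a; pose e := ecoef (a + b) n.-1 b.
have he k : conv h (twist e) k = (k == 0%N)%:R by exact: hcoef_ecoef.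
have eh k : conv e (twist h) k = (k == 0%N)%:R by exact: conv_twistC.
pose c la := entry (npof w) (Hdet h (size la) (plus_delta (size la) la)).
have -> : Gperm a b w = schur_sum c.
  apply: (@schur_expansion _ _ _ _ (npof w) h) => [m|m la pla sla].
    rewrite trunc_Gperm //; congr (map_ps _ _); apply: eq_bigr => i _; exact: Aser_useries.
  (* The determinants of orders m and [size la] both equal the one for [e] and the conjugate
     partition, of order [head 0 la]; hence the value does not depend on m. *)
  rewrite (dual_jacobi_trudi pla sla (leqnn _) (hcoef0 _ _ _) he).
  by rewrite /c (dual_jacobi_trudi pla (leqnn _) (leqnn _) (hcoef0 _ _ _) he).
rewrite omega_schur_sum; apply/esym.
apply: (@schur_expansion _ (a + b) n.-1 _ (npof w) e) => [m|m la pla sla].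
  (* Since b + a = a + b, both sides live in the same ring; inverting w replaces A by the reversed
     product, whose coefficients are [e]. *)
  rewrite trunc_Gperm // npof_inv (addrC b a) entry_Aser_inv.
  by congr (map_ps _ _); apply: eq_bigr => i _; exact: Abar_useries.
rewrite /c size_conj_part.
by rewrite (dual_jacobi_trudi pla sla (leqnn _) (ecoef0 _ _ _) eh).
Qed.

End Main.

Lemma npof_preserves n (w : 'S_n) : preserves n (npof w).
Proof.
move=> k; case: (ltnP k n) => kn.
  by rewrite /= (extE _ (Ordinal kn)) ltn_ord.
by rewrite /= ext_out // ltnNge kn.
Qed.

(** Both sides are read off the reversed product at w, one through inversion and the other through
    conjugation. *)
Lemma stable_grothendieck_conj (R : comNzRingType) (g : R) n (w : 'S_n) : (0 < n)%N ->
  stable_grothendieck g (w^-1)%g = stable_grothendieck g (longest n * w * longest n)%g.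
Proof.
move=> n_gt0; apply/pseriesP => mu; have [m bmu] := below_exists mu.
rewrite !(stable_grothendieckE _ n_gt0 _ bmu) npof_inv -hprod_rev -hprod_conj; last first.
  exact: npof_preserves.
by congr (hprod _ _ _ _ _); rewrite /conjw !npof_mul npmulA.
Qed.

Theorem theorem11p1 (n : nat) (hn : (0 < n)%N) (w : 'S_n) :
  (exists (P : seq (seq nat)) (c : seq nat -> Zab),
     all is_part P /\
     Gperm alpha beta w = (\sum_(la <- P) c la *: Gpart alpha beta la)%R)
  /\
  (omega (Gperm alpha beta w) = Gperm beta alpha (w^-1)%g
   /\ Gperm beta alpha (w^-1)%g
      = Gperm beta alpha (longest n * w * longest n)%g).
Proof.
split; first exact: Gperm_finite.
split; first exact: omega_Gperm.
by rewrite /Gperm stable_grothendieck_conj.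
Qed.
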